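(* Let $T=[v_1,v_2,v_3]\subset\mathbb{R}^2$ be a nondegenerate triangle with 12-split $T_{12}$, and let $\mathcal{B}=\{S_1,\dots,S_{39}\}$ be one of the bases $\mathcal{B}_a,\dots,\mathcal{B}_f$ of $\mathcal{S}^3_5(T_{12})$ defined in the context, with dual points $p^*_{i,1},\dots,p^*_{i,5}$ of $S_i$. Define $\mathcal{Q}:C^0(T)\to\mathcal{S}^3_5(T_{12})$ by $\mathcal{Q}(f)=\sum_{i=1}^{39}L_i(f)S_i$, where $$L_i(f)=\sum_{k=1}^5\frac{k^5}{5!}(-1)^{k-1}\sum_{1\le r_1<\cdots<r_k\le5}f\Big(\frac{p^*_{i,r_1}+\cdots+p^*_{i,r_k}}{k}\Big).$$ Then: (i) $\mathcal{Q}$ reproduces polynomials up to degree 5, i.e. $\mathcal{Q}(p)=p$ for every bivariate polynomial $p$ of total degree at most 5. (ii) $\mathcal{Q}$ is bounded independently of the geometry of $T$: for all $f\in C^0(T)$, $$\|\mathcal{Q}(f)\|_{L_\infty(T)}\le\max_i|L_i(f)|\le\frac{275}{3}\|f\|_{L_\infty(T)}.$$ (iii) $\mathcal{Q}$ approximates locally with order 6: there is a constant $C$, independent of $T$ and $f$, such that for every function $f$ on $T$ whose derivatives up to order six are in $L_\infty(T)$, $\|f-\mathcal{Q}(f)\|_{L_\infty(T)}\le C\,h^6\max_{|\alpha|=6}\|D^\alpha f\|_{L_\infty(T)}$, where $h$ is the length of the longest edge of $T$.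
   Context: **12-split.** Let $v_4=\frac{v_1+v_2}2$, $v_5=\frac{v_2+v_3}2$, $v_6=\frac{v_1+v_3}2$, $v_7=\frac{v_4+v_6}2$, $v_8=\frac{v_4+v_5}2$, $v_9=\frac{v_5+v_6}2$, $v_{10}=\frac{v_1+v_2+v_3}3$. The 12-split $T_{12}$ is the triangulation of $T$ into 12 triangles obtained by drawing the segments $[v_1,v_5],[v_2,v_6],[v_3,v_4],[v_4,v_5],[v_5,v_6],[v_4,v_6]$; its vertices are $v_1,\dots,v_{10}$. $\mathcal{S}^3_5(T_{12})$ is the space of $C^3$ functions on $T$ that are polynomials of total degree at most 5 on each of the 12 triangles; it has dimension 39. **Simplex splines.** For a finite multiset $K=\{v_1^{m_1}\cdots v_{10}^{m_{10}}\}$ let $|K|=\sum m_i$ and $[K]$ its convex hull. For $x$ not on any line through two of the points $v_1,\dots,v_{10}$, define recursively $Q[K](x)=0$ if $\mathrm{area}([K])=0$; $Q[K](x)=\mathbf 1_{[K]}(x)\,\mathrm{area}(T)/\mathrm{area}([K])$ if $\mathrm{area}([K])\ne0$ and $|K|=3$; and $Q[K](x)=\sum_{j=1}^{10}\beta_jQ[K\setminus v_j](x)$ if $\mathrm{area}([K])\neq 0$ and $|K|>3$, where $x=\sum_j\beta_jv_j$, $\sum_j\beta_j=1$, $\beta_j=0$ whenever $m_j=0$, and $K\setminus v_j$ removes one copy of $v_j$ (the value does not depend on the choice of the $\beta_j$). On $T$ the function $Q[K]$ is extended by continuity (possible for all simplex splines used here). Write $Q_{ijklmn}:=Q[v_1^iv_2^jv_3^kv_4^lv_5^mv_6^n]$.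 **The bases and dual points.** Each permutation of $v_1,v_2,v_3$ extends to an affine map of $T$ permuting $v_1,\dots,v_{10}$; this gives a group $S_3$ of permutations $\sigma$. Each basis below (39 functions, order immaterial) is described by representatives $(wQ[K];P)$, where $P$ is a multiset of five ''dual points''; the basis consists of all the functions $wQ[\sigma(K)]$, $\sigma\in S_3$, with dual points $\sigma(P)$. All six bases contain the orbits of $(\frac14Q_{600101};v_1^5)$, $(\frac14Q_{500201};v_1^4v_4)$, $(\frac12Q_{410201};v_1^3v_4^2)$, $(Q_{141110};v_2^3v_4v_5)$, $(\frac12Q_{131210};v_1v_2^2v_4v_5)$. In addition: - $\mathcal{B}_a$: $(\frac12Q_{320201};v_1^2v_2v_4^2)$, $(\frac34Q_{222110};v_1v_2^2v_3v_{10})$, $(\frac34Q_{221210};v_1v_2^2v_4v_{10})$. - $\mathcal{B}_b$: $(\frac12Q_{320201};v_1^2v_2v_4^2)$, $(\frac34Q_{221111};v_1v_2v_3v_4v_{10})$, $(\frac34Q_{221210};v_1v_2^2v_4v_{10})$. - $\mathcal{B}_c$: $(\frac12Q_{320201};v_1^2v_2v_4^2)$, $(\frac34Q_{220211};v_1v_2v_4^2v_{10})$, $(\frac34Q_{121211};v_1v_2v_4v_5v_{10})$. - $\mathcal{B}_d$: $(Q_{321200};v_1^2v_2v_4^2)$, $(\frac34Q_{222110};v_1v_2^2v_3v_{10})$, $(\frac14Q_{221210};v_1v_2^2v_3v_4)$. - $\mathcal{B}_e$: $(Q_{321200};v_1^2v_2v_4^2)$, $(\frac34Q_{221111};v_1v_2v_3v_4v_{10})$,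 $(\frac14Q_{221210};v_1v_2^2v_3v_4)$. - $\mathcal{B}_f$: $(Q_{321200};v_1^2v_2v_4^2)$, $(\frac14Q_{220211};v_1v_2v_3v_4^2)$, $(\frac12Q_{121211};v_1v_2v_3v_4v_8)$. *)

(* Defs.v *)
From HB Require Import structures.
From mathcomp Require Import all_boot all_order all_algebra.
From mathcomp Require Import all_classical all_reals all_analysis.

Set Implicit Arguments.
Unset Strict Implicit.
Unset Printing Implicit Defensive.

Import Order.TTheory GRing.Theory Num.Theory.
Import numFieldNormedType.Exports.

Local Open Scope classical_set_scope.
Local Open Scope ring_scope.

(* Points of the plane are pairs.  The library's norm on [R * R] is the sup
   norm; it is used only through the topology it induces. *)
Definition edist (R : realType) (p q : R * R) : R :=
  Num.sqrt ((p.1 - q.1) ^+ 2 + (p.2 - q.2) ^+ 2).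

Definition lebesgue2 (R : realType) :
    {measure set (measurableTypeR R * measurableTypeR R) -> \bar R} :=
  (@lebesgue_measure R \x @lebesgue_measure R)%E.

Definition area (R : realType) (A : set (R * R)) : R := fine (lebesgue2 R A).

Definition hull (R : realType) (s : seq (R * R)) : set (R * R) :=
  [set x | exists c : 'I_(size s) -> R,
    [/\ forall i, 0 <= c i, \sum_i c i = 1 & x = \sum_i c i *: nth 0 s i]].

Definition nondegenerate_triangle (R : realType) (v : 'I_3 -> R * R) : Prop :=
  ((v 1).1 - (v 0).1) * ((v 2).2 - (v 0).2)
    - ((v 2).1 - (v 0).1) * ((v 1).2 - (v 0).2) != 0.

Definition triangle (R : realType) (v : 'I_3 -> R * R) : set (R * R) :=
  hull [:: v 0; v 1; v 2].

Definition longest_edge (R : realType) (v : 'I_3 -> R * R) : R :=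
  Num.max (edist (v 0) (v 1)) (Num.max (edist (v 1) (v 2)) (edist (v 0) (v 2))).

(* [vertex v k] is the point v_k of the 12-split, for 1 <= k <= 10. *)
Definition vertex (R : realType) (v : 'I_3 -> R * R) (k : nat) : R * R :=
  let mid (p q : R * R) := 2^-1 *: (p + q) in
  let v1 := v 0 in let v2 := v 1 in let v3 := v 2 in
  let v4 := mid v1 v2 in let v5 := mid v2 v3 in let v6 := mid v1 v3 in
  let v7 := mid v4 v6 in let v8 := mid v4 v5 in let v9 := mid v5 v6 in
  let v10 := 3^-1 *: (v1 + v2 + v3) in
  nth 0 [:: v1; v2; v3; v4; v5; v6; v7; v8; v9; v10] k.-1.

Definition split12 : seq (seq nat) :=
  [:: [:: 1; 4; 7]; [:: 1; 6; 7]; [:: 2; 4; 8]; [:: 2; 5; 8];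
      [:: 3; 5; 9]; [:: 3; 6; 9];
      [:: 4; 7; 10]; [:: 6; 7; 10]; [:: 4; 8; 10]; [:: 5; 8; 10];
      [:: 5; 9; 10]; [:: 6; 9; 10]]%N.

Definition bipoly (R : realType) (d : nat) (p : R * R -> R) : Prop :=
  exists c : nat -> nat -> R, forall x,
    p x = \sum_(i < d.+1) \sum_(j < d.+1 | (i + j <= d)%N)
            c i j * x.1 ^+ i * x.2 ^+ j.

Definition dir1 (R : realType) : R * R := (1, 0).
Definition dir2 (R : realType) : R * R := (0, 1).

(* C^n functions on the whole plane. *)
Fixpoint Ck (R : realType) (n : nat) (g : R * R -> R) : Prop :=
  continuous g /\
  if n is m.+1 then
    [/\ forall x, derivable g x (dir1 R), forall x, derivable g x (dir2 R),
        Ck m (fun x => 'D_(dir1 R) g x) & Ck m (fun x => 'D_(dir2 R) g x)]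
  else True.

(* C^3 on the closed triangle means: restriction of a C^3 function. *)
Definition spline_space (R : realType) (v : 'I_3 -> R * R) (g : R * R -> R) :
    Prop :=
  (exists2 G : R * R -> R, Ck 3 G & forall x, triangle v x -> g x = G x) /\
  forall t, t \in split12 ->
    exists2 p : R * R -> R, bipoly 5 p &
      forall x, hull [seq vertex v k | k <- t] x -> g x = p x.

(* A finite multiset of vertices v_k is a list of labels k with repetitions:
   |K| is [size K] and removing one copy of v_j is [rem j K]. *)
Definition chull (R : realType) (v : 'I_3 -> R * R) (K : seq nat) :
    set (R * R) :=
  hull [seq vertex v k | k <- K].

(* The value of the recursion does not depend on the affine coordinates
   chosen, so an arbitrary choice is made. *)
Definition affine_coords (R : realType) (v : 'I_3 -> R * R) (K : seq nat)
    (x : R * R) : nat -> R :=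
  xget (fun=> 0) [set b : nat -> R |
    [/\ forall j, j \notin K -> b j = 0,
        \sum_(1 <= j < 11) b j = 1 &
        \sum_(1 <= j < 11) b j *: vertex v j = x]].

(* [n] is |K| - 3. *)
Fixpoint simplex_spline_rec (R : realType) (v : 'I_3 -> R * R) (n : nat)
    (K : seq nat) (x : R * R) : R :=
  if area (chull v K) == 0 then 0
  else if n is m.+1 then
    \sum_(1 <= j < 11)
      affine_coords v K x j * simplex_spline_rec v m (rem j K) x
  else \1_(chull v K) x * (area (triangle v) / area (chull v K)).

(* Meaningful only at points satisfying [off_lines]. *)
Definition simplex_spline (R : realType) (v : 'I_3 -> R * R) (K : seq nat) :
    R * R -> R :=
  simplex_spline_rec v (size K - 3) K.

Definition off_lines (R : realType) (v : 'I_3 -> R * R) : set (R * R) :=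
  [set x | forall i j, (1 <= i <= 10)%N -> (1 <= j <= 10)%N ->
    vertex v i != vertex v j ->
    forall t : R, x <> (1 - t) *: vertex v i + t *: vertex v j].

(* The extension by continuity to the closed triangle. *)
Definition simplex_splineT (R : realType) (v : 'I_3 -> R * R) (K : seq nat)
    (x : R * R) : R :=
  lim (simplex_spline v K y @[y --> within (triangle v `&` off_lines v) (nbhs x)]).

(* The action of S_3 on the labels: the k-th entry is the label of the image
   of v_k (see [vertex_permsP]). *)
Definition vertex_perms : seq (seq nat) :=
  [:: [:: 1; 2; 3; 4; 5; 6; 7; 8; 9; 10];
      [:: 1; 3; 2; 6; 5; 4; 7; 9; 8; 10];
      [:: 2; 1; 3; 4; 6; 5; 8; 7; 9; 10];
      [:: 2; 3; 1; 5; 6; 4; 8; 9; 7; 10];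
      [:: 3; 1; 2; 6; 4; 5; 9; 7; 8; 10];
      [:: 3; 2; 1; 5; 4; 6; 9; 8; 7; 10]]%N.

Definition apply_perm (s : seq nat) (k : nat) : nat := nth 0%N s k.-1.

(* [s] is the affine extension of its action on the three corners: relabelling
   the corners by [s] relabels the ten vertices by [s]. *)
Lemma vertex_permsP (R : realType) (v : 'I_3 -> R * R) (s : seq nat) (k : nat) :
  s \in vertex_perms -> (1 <= k <= 10)%N ->
  vertex (fun i : 'I_3 => vertex v (apply_perm s i.+1)) k
    = vertex v (apply_perm s k).
Proof.
move=> s_in k_in; have {k_in} : k \in iota 1 10 by rewrite mem_iota.
move: s_in; rewrite !inE => s_in.
have half (x y : R * R) : 2^-1 *: (x + y) = 2^-1 *: (y + x) by rewrite addrC.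
have cent (x y z : R * R) :
    [/\ x + z + y = x + y + z, y + x + z = x + y + z, y + z + x = x + y + z,
        z + x + y = x + y + z & z + y + x = x + y + z].
  split; [by rewrite addrAC | by rewrite (addrC y)
    | by rewrite addrC addrA | by rewrite -addrA addrC
    | by rewrite addrC (addrC z) addrA].
have [c1 c2 c3 c4 c5] := cent (v 0) (v 1) (v 2).
repeat case/orP: s_in => s_in; move/eqP: s_in => ->; rewrite /vertex /apply_perm;
  do 10?[case/predU1P => [-> /=|]]; rewrite ?inE //.
all: try by rewrite ?(half (v 1) (v 0)) ?(half (v 2) (v 0)) ?(half (v 2) (v 1)).
all: by move=> /eqP -> /=; rewrite ?(c1, c2, c3, c4, c5).
Qed.

Lemma vertex_perms_all :
  perm_eq [seq take 3 s | s <- vertex_perms] (permutations [:: 1; 2; 3]%N).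
Proof. by vm_compute. Qed.

(* [Qms i j k l m n] is the multiset of Q_{ijklmn}. *)
Definition Qms (i j k l m n : nat) : seq nat :=
  nseq i 1%N ++ nseq j 2%N ++ nseq k 3%N ++ nseq l 4%N ++ nseq m 5%N
    ++ nseq n 6%N.

Inductive basis_name := Ba | Bb | Bc | Bd | Be | Bf.

(* Representatives (w, (K, P)) of the orbits, for w Q[K] with dual points P. *)
Definition common_reps (R : realType) : seq (R * (seq nat * seq nat)) :=
  [:: (1 / 4, (Qms 6 0 0 1 0 1, [:: 1; 1; 1; 1; 1]%N));
      (1 / 4, (Qms 5 0 0 2 0 1, [:: 1; 1; 1; 1; 4]%N));
      (1 / 2, (Qms 4 1 0 2 0 1, [:: 1; 1; 1; 4; 4]%N));
      (1,     (Qms 1 4 1 1 1 0, [:: 2; 2; 2; 4; 5]%N));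
      (1 / 2, (Qms 1 3 1 2 1 0, [:: 1; 2; 2; 4; 5]%N))].

Definition extra_reps (R : realType) (B : basis_name) :
    seq (R * (seq nat * seq nat)) :=
  match B with
  | Ba => [:: (1 / 2, (Qms 3 2 0 2 0 1, [:: 1; 1; 2; 4; 4]%N));
              (3 / 4, (Qms 2 2 2 1 1 0, [:: 1; 2; 2; 3; 10]%N));
              (3 / 4, (Qms 2 2 1 2 1 0, [:: 1; 2; 2; 4; 10]%N))]
  | Bb => [:: (1 / 2, (Qms 3 2 0 2 0 1, [:: 1; 1; 2; 4; 4]%N));
              (3 / 4, (Qms 2 2 1 1 1 1, [:: 1; 2; 3; 4; 10]%N));
              (3 / 4, (Qms 2 2 1 2 1 0, [:: 1; 2; 2; 4; 10]%N))]
  | Bc => [:: (1 / 2, (Qms 3 2 0 2 0 1, [:: 1; 1; 2; 4; 4]%N));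
              (3 / 4, (Qms 2 2 0 2 1 1, [:: 1; 2; 4; 4; 10]%N));
              (3 / 4, (Qms 1 2 1 2 1 1, [:: 1; 2; 4; 5; 10]%N))]
  | Bd => [:: (1,     (Qms 3 2 1 2 0 0, [:: 1; 1; 2; 4; 4]%N));
              (3 / 4, (Qms 2 2 2 1 1 0, [:: 1; 2; 2; 3; 10]%N));
              (1 / 4, (Qms 2 2 1 2 1 0, [:: 1; 2; 2; 3; 4]%N))]
  | Be => [:: (1,     (Qms 3 2 1 2 0 0, [:: 1; 1; 2; 4; 4]%N));
              (3 / 4, (Qms 2 2 1 1 1 1, [:: 1; 2; 3; 4; 10]%N));
              (1 / 4, (Qms 2 2 1 2 1 0, [:: 1; 2; 2; 3; 4]%N))]
  | Bf => [:: (1,     (Qms 3 2 1 2 0 0, [:: 1; 1; 2; 4; 4]%N));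
              (1 / 4, (Qms 2 2 0 2 1 1, [:: 1; 2; 3; 4; 4]%N));
              (1 / 2, (Qms 1 2 1 2 1 1, [:: 1; 2; 3; 4; 8]%N))]
  end.

(* Labels are sorted so that equal multisets become equal lists, and [undup]
   keeps a single copy of each function of the orbit. *)
Definition s3_orbit (KP : seq nat * seq nat) : seq (seq nat * seq nat) :=
  undup [seq (sort leq [seq apply_perm s k | k <- KP.1],
              sort leq [seq apply_perm s k | k <- KP.2]) | s <- vertex_perms].

Definition basis_data (R : realType) (B : basis_name) :
    seq (R * (seq nat * seq nat)) :=
  [seq (r.1, KP) | r <- common_reps R ++ extra_reps R B, KP <- s3_orbit r.2].

Lemma size_basis (R : realType) (B : basis_name) : size (basis_data R B) = 39%N.
Proof. by case: B; vm_compute. Qed.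

Lemma uniq_basis (R : realType) (B : basis_name) :
  uniq [seq e.2.1 | e <- basis_data R B].
Proof. by case: B; vm_compute. Qed.

Definition basis_fun (R : realType) (v : 'I_3 -> R * R)
    (e : R * (seq nat * seq nat)) (x : R * R) : R :=
  e.1 * simplex_splineT v e.2.1 x.

Definition dual_point (R : realType) (v : 'I_3 -> R * R)
    (e : R * (seq nat * seq nat)) (r : 'I_5) : R * R :=
  vertex v (nth 0%N e.2.2 r).

Definition dual_functional (R : realType) (v : 'I_3 -> R * R)
    (e : R * (seq nat * seq nat)) (f : R * R -> R) : R :=
  \sum_(1 <= k < 6) (k%:R ^+ 5 / (5`!)%:R) * (-1) ^+ k.-1 *
    \sum_(A : {set 'I_5} | #|A| == k)
      f (k%:R^-1 *: \sum_(r in A) dual_point v e r).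

Definition quasi_interpolant (R : realType) (v : 'I_3 -> R * R)
    (B : basis_name) (f : R * R -> R) (x : R * R) : R :=
  \sum_(e <- basis_data R B) dual_functional v e f * basis_fun v e x.

Definition max_functional (R : realType) (v : 'I_3 -> R * R)
    (B : basis_name) (f : R * R -> R) : R :=
  \big[Num.max/0]_(e <- basis_data R B) `|dual_functional v e f|.

(* The norm of L_oo(A), as an essential supremum. *)
Definition Linf (R : realType) (A : set (R * R)) (f : R * R -> R) : \bar R :=
  'N[lebesgue2 R]_+oo [(fun x => (\1_A x * f x)%:E)]%E.

Definition in_Linf (R : realType) (A : set (R * R)) (f : R * R -> R) : Prop :=
  measurable_fun (A : set (measurableTypeR R * measurableTypeR R)) f /\
  (Linf A f < +oo)%E.

Definition iter_partial (R : realType) (i j : nat) (g : R * R -> R) :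
    R * R -> R :=
  iter i (fun h x => 'D_(dir1 R) h x) (iter j (fun h x => 'D_(dir2 R) h x) g).

(* Smooth functions with compact support in the interior of [A]. *)
Definition test_function (R : realType) (A : set (R * R)) (phi : R * R -> R) :
    Prop :=
  (forall n, Ck n phi) /\
  exists C : set (R * R),
    [/\ compact C, C `<=` A° & forall x, ~ C x -> phi x = 0].

(* [g] is the weak derivative D^(i,j) f on [A]. *)
Definition weak_derivative (R : realType) (A : set (R * R)) (i j : nat)
    (f g : R * R -> R) : Prop :=
  forall phi, test_function A phi ->
    (\int[lebesgue2 R]_(x in A) (f x * iter_partial i j phi x)
      = (-1) ^+ (i + j) * \int[lebesgue2 R]_(x in A) (g x * phi x))%R.

(* Main.v *)
From Stdlib Require Import ZArith Ring_polynom InitialRing.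
Require Import Defs.
From mathcomp Require Import all_boot all_order all_algebra.
From mathcomp Require Import all_classical all_reals all_analysis.
From mathcomp Require Import measurable_realfun ess_sup_inf.
From mathcomp Require Import ring lra zify.

Import Order.TTheory GRing.Theory Num.Theory.
Import numFieldNormedType.Exports.

Local Open Scope classical_set_scope.
Local Open Scope ring_scope.

Set Implicit Arguments.
Unset Strict Implicit.
Unset Printing Implicit Defensive.

(** Barycentric coordinates turn every triangle into one and the same problem.
    On each of the twelve cells of the split the recursion that defines [Q[K]]
    yields a polynomial in these coordinates with integer coefficients, and the
    polynomials are computed once, for all triangles ([pieces]).  They do not
    depend on the coefficients [beta] of the recursion: two choices differ by
    affine dependencies of the vertices, so finitely many polynomial identities
    suffice ([admissible_sum], [rec_value]).  The pieces of two neighbouring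
    cells differ by a multiple of the fourth power of the form of the line between them;
    hence [Q[K]] is a polynomial plus a sum of terms [max(l, 0)^4 * q] over the
    six lines [l] that cross the triangle.  Such a function is C^3 on the whole
    plane ([Ck_spline_ext]), it is the extension of [Q[K]] by continuity
    ([simplex_splineTE]), and it is nonnegative on the triangle because the
    recursion can be run with nonnegative coefficients ([spline_ext_ge0]).  This
    gives the range of the quasi-interpolant ([quasi_interpolant_spline]).

    Reproduction.  On a homogeneous quintic the factor [k ^ 5] of the dual
    functional cancels the division of the points by [k]: what is left is the
    polarization formula, so that [L_i] takes the value of the polar form at the
    five dual points ([dual_functional_mono]).  On the 21 monomials of degree
    five in the barycentric coordinates the claim is then an identity between
    the truncated power forms, checked over the integers ([spline_monomial]);
    these monomials span the polynomials of degree five ([reproduction]).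

    Bounds.  By reproduction of the constant one, the nonnegative functions [S_i]
    sum to one, so a value of the quasi-interpolant is a convex combination of
    the [L_i(f)] ([quasi_interpolant_bound]), and the absolute values of the
    coefficients of [L_i] sum to 275/3 ([dual_functional_bound]).  A continuous
    function is bounded at every point by its essential supremum
    ([continuous_Linf]), which turns bounds by point values into bounds by the
    norm.

    Order.  The error of the quasi-interpolant at a point is a combination of
    values of [f] at finitely many points that vanishes on quintics, with
    coefficients of total size at most [1 + 275/3].  If [f] were smooth, its
    Taylor polynomial at a corner would finish the proof.  In general [f] is
    replaced by a mollification, composed with a contraction of the triangle to
    an interior point so that the mollifier only sees the interior.  The
    derivatives of order six of the mollified function are the mollified weak
    derivatives ([moll_weak]), so they obey the same bound; its Taylor polynomial
    ([moll_taylor]) gives an error of order [h ^ 6] with a constant that depends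
    neither on the triangle nor on the mollifier, and the mollified functions
    converge to [f] at each point of the triangle ([smoothed_cvg],
    [quasi_interpolant_order]). *)

Delimit Scope Z_scope with BZ.

(** * The polynomial pieces of the simplex splines, computed over the integers *)

Definition Z3 : Type := (Z * Z * Z)%type.

(** Barycentric coordinates of the vertices of the 12-split, multiplied by 12
    so that they are integers. *)
Definition wt (k : nat) : Z3 :=
  nth (0, 0, 0)%BZ
    [:: (12, 0, 0); (0, 12, 0); (0, 0, 12); (6, 6, 0); (0, 6, 6); (6, 0, 6);
        (6, 3, 3); (3, 6, 3); (3, 3, 6); (4, 4, 4)]%BZ k.-1.

Definition det3 (p q r : Z3) : Z :=
  let: (p1, p2, p3) := p in
  let: (q1, q2, q3) := q in
  let: (r1, r2, r3) := r in
  (p1 * (q2 * r3 - q3 * r2) - p2 * (q1 * r3 - q3 * r1)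
     + p3 * (q1 * r2 - q2 * r1))%BZ.

Definition dt (i j k : nat) : Z := det3 (wt i) (wt j) (wt k).

Definition dot3 (u v : Z3) : Z :=
  let: (a, b, c) := u in let: (x, y, z) := v in (a * x + b * y + c * z)%BZ.

Definition add3 (u v : Z3) : Z3 :=
  let: (a, b, c) := u in let: (x, y, z) := v in (a + x, b + y, c + z)%BZ.

(** Polynomials in the first two barycentric coordinates; the third one is
    eliminated, so that equal functions have equal normal forms. *)
Notation zpoly := (Pol Z).

Definition padd : zpoly -> zpoly -> zpoly := Padd 0%BZ Z.add Z.eqb.
Definition pmul : zpoly -> zpoly -> zpoly := Pmul 0%BZ 1%BZ Z.add Z.mul Z.eqb.
Definition pscale (c : Z) (p : zpoly) : zpoly := PmulC 0%BZ 1%BZ Z.mul Z.eqb p c.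
Definition peq : zpoly -> zpoly -> bool := Ring_polynom.Peq Z.eqb.
Definition pcst (c : Z) : zpoly := Pc c.
Definition psum : seq zpoly -> zpoly := foldr padd (pcst 0).

Definition bX1 : zpoly := mk_X 0%BZ 1%BZ 1.
Definition bX2 : zpoly := mk_X 0%BZ 1%BZ 2.
Definition bX3 : zpoly :=
  padd (pcst 1) (padd (pscale (-1) bX1) (pscale (-1) bX2)).

Definition pform (l : Z3) : zpoly :=
  let: (a, b, c) := l in
  padd (pscale a bX1) (padd (pscale b bX2) (pscale c bX3)).

(** The triangle with labels [i, j, k] is nondegenerate and contains the cell
    whose corners have the labels [c]. *)
Definition covers (c : seq nat) (t : nat * nat * nat) : bool :=
  let: (i, j, k) := t in let D := dt i j k in
  ~~ (D =? 0)%BZ &&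
  all (fun u => [&& 0 <=? D * dt u j k, 0 <=? D * dt i u k
                  & 0 <=? D * dt i j u]%BZ) c.

Definition label_triples (K : seq nat) : seq (nat * nat * nat) :=
  let s := undup K in
  [seq (p, k) | p <- [seq p <- [seq (i, j) | i <- s, j <- s] | (p.1 < p.2)%N],
                k <- [seq k <- s | (p.2 < k)%N]].

(** A triangle with corners in [K] around the cell, if there is one; by
    Caratheodory there is one exactly when the cell lies in the hull of [K]. *)
Definition frame (c K : seq nat) : option (nat * nat * nat) :=
  ohead (seq.filter (covers c) (label_triples K)).

(** Barycentric coordinate, with respect to a frame of determinant [D], of the
    frame corner that precedes the labels [j, k] in cyclic order. *)
Definition frame_coord (j k : nat) (D : Z) : zpoly :=
  pform (dt 1 j k / D, dt 2 j k / D, dt 3 j k / D)%BZ.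

Definition table : Type := seq (seq nat * zpoly).

Fixpoint look (T : table) (K : seq nat) : zpoly :=
  if T is e :: T' then if e.1 == K then e.2 else look T' K else pcst 0.

(** One step of the recursion for [Q[K]] on the cell, with the coefficients
    [beta] taken from the frame, so that they are nonnegative on the cell. *)
Definition next_piece (c : seq nat) (T : table) (K : seq nat) : zpoly :=
  if frame c K is Some (i, j, k) then
    let D := dt i j k in
    padd (pmul (frame_coord j k D) (look T (rem i K)))
   (padd (pmul (frame_coord k i D) (look T (rem j K)))
         (pmul (frame_coord i j D) (look T (rem k K))))
  else pcst 0.

Definition base_piece (c K : seq nat) : zpoly :=
  if frame c K is Some (i, j, k) then pcst (1728 / Z.abs (dt i j k))
  else pcst 0.

(** Independence of the choice of [beta]: the coefficients attached to two
    choices differ by affine dependencies of the labels, and these are spanned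
    by the ones that express a label [l] through the frame.  Without a frame
    everything vanishes on the cell. *)
Definition step_ok (c : seq nat) (T : table) (K : seq nat) : bool :=
  if frame c K is Some (i, j, k) then
    let D := dt i j k in
    let Pi := look T (rem i K) in
    let Pj := look T (rem j K) in
    let Pk := look T (rem k K) in
    all (fun s => [&& dt s j k mod D =? 0, dt s k i mod D =? 0
                    & dt s i j mod D =? 0]%BZ) [:: 1; 2; 3]%N &&
    all (fun l => peq (pscale D (look T (rem l K)))
                      (padd (pscale (dt l j k) Pi)
                      (padd (pscale (dt i l k) Pj) (pscale (dt i j l) Pk))))
        [seq l <- undup K | l \notin [:: i; j; k]]
  else all (fun l => peq (look T (rem l K)) (pcst 0)) (undup K).

(** A line through two vertices with the cell on one side and [K] on the
    other. *)
Definition separated (c K : seq nat) : bool :=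
  has (fun ij => let: (i, j) := ij in
         [&& all (fun k => dt i j k <=? 0)%BZ K,
             all (fun u => 0 <=? dt i j u)%BZ c
           & has (fun u => 0 <? dt i j u)%BZ c])
    [seq (i, j) | i <- iota 1 6, j <- iota 1 6].

Definition base_ok (c K : seq nat) : bool :=
  if frame c K is Some (i, j, k) then
    (K == [:: i; j; k]) && (1728 mod Z.abs (dt i j k) =? 0)%BZ
  else separated c K.

Definition faces (Ks : seq (seq nat)) : seq (seq nat) :=
  undup (flatten [seq [seq rem j K | j <- undup K] | K <- Ks]).

(** The pieces on the cell [c] for the multisets in [Ks], of size [n + 3], and
    the verification of the recursion at all levels below. *)
Fixpoint pieces (c : seq nat) (n : nat) (Ks : seq (seq nat)) : table * bool :=
  if n is m.+1 then
    let: (T, ok) := pieces c m (faces Ks) in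
    ([seq (K, next_piece c T K) | K <- Ks], ok && all (step_ok c T) Ks)
  else ([seq (K, base_piece c K) | K <- Ks], all (base_ok c) Ks).

(** * The integer data of the six bases *)

(** The weights are multiplied by 4 to be integers. *)
Definition zcommon : seq (Z * (seq nat * seq nat)) :=
  [:: (1, (Qms 6 0 0 1 0 1, [:: 1; 1; 1; 1; 1]%N));
      (1, (Qms 5 0 0 2 0 1, [:: 1; 1; 1; 1; 4]%N));
      (2, (Qms 4 1 0 2 0 1, [:: 1; 1; 1; 4; 4]%N));
      (4, (Qms 1 4 1 1 1 0, [:: 2; 2; 2; 4; 5]%N));
      (2, (Qms 1 3 1 2 1 0, [:: 1; 2; 2; 4; 5]%N))]%BZ.

Definition zextra (B : basis_name) : seq (Z * (seq nat * seq nat)) :=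
  match B with
  | Ba => [:: (2, (Qms 3 2 0 2 0 1, [:: 1; 1; 2; 4; 4]%N));
              (3, (Qms 2 2 2 1 1 0, [:: 1; 2; 2; 3; 10]%N));
              (3, (Qms 2 2 1 2 1 0, [:: 1; 2; 2; 4; 10]%N))]
  | Bb => [:: (2, (Qms 3 2 0 2 0 1, [:: 1; 1; 2; 4; 4]%N));
              (3, (Qms 2 2 1 1 1 1, [:: 1; 2; 3; 4; 10]%N));
              (3, (Qms 2 2 1 2 1 0, [:: 1; 2; 2; 4; 10]%N))]
  | Bc => [:: (2, (Qms 3 2 0 2 0 1, [:: 1; 1; 2; 4; 4]%N));
              (3, (Qms 2 2 0 2 1 1, [:: 1; 2; 4; 4; 10]%N));
              (3, (Qms 1 2 1 2 1 1, [:: 1; 2; 4; 5; 10]%N))]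
  | Bd => [:: (4, (Qms 3 2 1 2 0 0, [:: 1; 1; 2; 4; 4]%N));
              (3, (Qms 2 2 2 1 1 0, [:: 1; 2; 2; 3; 10]%N));
              (1, (Qms 2 2 1 2 1 0, [:: 1; 2; 2; 3; 4]%N))]
  | Be => [:: (4, (Qms 3 2 1 2 0 0, [:: 1; 1; 2; 4; 4]%N));
              (3, (Qms 2 2 1 1 1 1, [:: 1; 2; 3; 4; 10]%N));
              (1, (Qms 2 2 1 2 1 0, [:: 1; 2; 2; 3; 4]%N))]
  | Bf => [:: (4, (Qms 3 2 1 2 0 0, [:: 1; 1; 2; 4; 4]%N));
              (1, (Qms 2 2 0 2 1 1, [:: 1; 2; 3; 4; 4]%N));
              (2, (Qms 1 2 1 2 1 1, [:: 1; 2; 3; 4; 8]%N))]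
  end%BZ.

Definition zbasis (B : basis_name) : seq (Z * (seq nat * seq nat)) :=
  [seq (r.1, KP) | r <- zcommon ++ zextra B, KP <- s3_orbit r.2].

Definition all_bases : seq basis_name := [:: Ba; Bb; Bc; Bd; Be; Bf].

Definition basis_knots : seq (seq nat) :=
  undup (flatten [seq [seq e.2.1 | e <- zbasis B] | B <- all_bases]).

(** * Truncated powers *)

(** The six lines of the 12-split that cross the triangle, as linear forms in
    the barycentric coordinates that are nonpositive on the cell [1, 4, 7].
    With each line come two cells separated by a segment of that line alone,
    the first one on its positive side. *)
Definition cut_lines : seq (Z3 * (seq nat * seq nat)) :=
  [:: (( 0, -1,  1)%BZ, ([:: 1; 6; 7], [:: 1; 4; 7]));
      ((-1,  1,  1)%BZ, ([:: 4; 7; 10], [:: 1; 4; 7]));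
      ((-1,  1,  0)%BZ, ([:: 4; 8; 10], [:: 4; 7; 10]));
      ((-1,  1, -1)%BZ, ([:: 2; 4; 8], [:: 4; 8; 10]));
      ((-1,  0,  1)%BZ, ([:: 2; 5; 8], [:: 2; 4; 8]));
      ((-1, -1,  1)%BZ, ([:: 3; 5; 9], [:: 5; 9; 10]))]%N.

Definition evalZ (p : zpoly) (u : Z3) : Z :=
  let: (x, y, _) := u in Pphi 0%BZ Z.add Z.mul id [:: x; y] p.

Definition pow4 (p : zpoly) : zpoly := pmul (pmul p p) (pmul p p).

Definition unit3 (s : nat) : Z3 :=
  nth (0, 0, 0)%BZ [:: (1, 0, 0); (0, 1, 0); (0, 0, 1)]%BZ s.

(** The linear form [q] with [D = l ^ 4 * q], for a form [l] with coefficients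
    in [-1, 0, 1].  It is read off from [D] at the corners where [l] does not
    vanish; at a corner [s] where it does, the value at the reflection of a
    corner [t] in [s] is used. *)
Definition quartic_quotient (l : Z3) (D : zpoly) : zpoly :=
  let vanishes s := (dot3 l (unit3 s) =? 0)%BZ in
  let t := find (predC vanishes) (iota 0 3) in
  let reflection s :=
    add3 (add3 (unit3 s) (unit3 s)) (let: (x, y, z) := unit3 t in (-x, -y, -z)%BZ) in
  let q s := if vanishes s
             then ((evalZ D (reflection s) + evalZ D (unit3 t)) / 2)%BZ
             else evalZ D (unit3 s) in
  pform (q 0%N, q 1%N, q 2%N).

Definition nonneg_on (c : seq nat) (l : Z3) : bool :=
  all (fun u => 0 <=? dot3 l (wt u))%BZ c.

Definition nonpos_on (c : seq nat) (l : Z3) : bool :=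
  all (fun u => dot3 l (wt u) <=? 0)%BZ c.

(** [P c] is the piece on the cell [c]; the pieces are those of
    [g.1 + sum_l max(l, 0)^4 q_l] with [g.2] the list of the [q_l]. *)
Definition truncated_form (P : seq nat -> zpoly) : zpoly * seq zpoly :=
  (P [:: 1; 4; 7]%N,
   [seq quartic_quotient l.1 (padd (P l.2.1) (pscale (-1) (P l.2.2)))
   | l <- cut_lines]).

Definition truncated_ok (P : seq nat -> zpoly) (g : zpoly * seq zpoly) : bool :=
  all (fun c => peq (P c)
    (padd g.1 (psum [seq if nonneg_on c lq.1.1
                         then pmul (pow4 (pform lq.1.1)) lq.2 else pcst 0
                    | lq <- zip cut_lines g.2]))) split12.

(** * Reproduction of monomials *)

(** [120 * 12 ^ 5] times a dual functional on a quintic monomial in the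
    barycentric coordinates: by homogeneity the factors [k ^ 5] cancel, and
    what is left is the alternating sum over the subsets of [us] of the
    monomial at the sum of the subset. *)
Fixpoint subset_sum (f : Z3 -> Z) (sg : Z) (acc : Z3) (us : seq Z3) : Z :=
  if us is u :: us' then
    (subset_sum f sg acc us' + subset_sum f (- sg) (add3 acc u) us')%BZ
  else (sg * f acc)%BZ.

Definition zmono (a : nat * nat * nat) (u : Z3) : Z :=
  let: (i, j, k) := a in let: (x, y, z) := u in
  (iter i (Z.mul x) 1 * (iter j (Z.mul y) 1 * iter k (Z.mul z) 1))%BZ.

Definition pmono (a : nat * nat * nat) : zpoly :=
  let: (i, j, k) := a in
  pmul (iter i (pmul bX1) (pcst 1))
       (pmul (iter j (pmul bX2) (pcst 1)) (iter k (pmul bX3) (pcst 1))).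

Definition quintic_exponents : seq (nat * nat * nat) :=
  [seq (p, 5 - (p.1 + p.2))%N
  | p <- [seq (i, j) | i <- iota 0 6, j <- iota 0 6] & (p.1 + p.2 <= 5)%N].

Definition dual_mono (a : nat * nat * nat) (P : seq nat) : Z :=
  subset_sum (zmono a) (-1) (0, 0, 0)%BZ [seq wt k | k <- P].

Definition reproduces (g : seq nat -> zpoly * seq zpoly) (B : basis_name) : bool :=
  let rows := [seq (e, g e.2.1) | e <- zbasis B] in
  all (fun a =>
    let ns := [seq ((r.1.1 * dual_mono a r.1.2.2)%BZ, r.2) | r <- rows] in
    peq (psum [seq pscale n.1 n.2.1 | n <- ns])
        (pscale (4 * 120 * 12 ^ 5) (pmono a)) &&
    all (fun l => peq (psum [seq pscale n.1 (nth (pcst 0) n.2.2 l) | n <- ns])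
                      (pcst 0)) (iota 0 6)) quintic_exponents.

(** * Running the verification *)

Definition cell_tables : seq (seq nat * (table * bool)) :=
  [seq (c, pieces c 5 basis_knots) | c <- split12].

Definition piece_in (Ts : seq (seq nat * (table * bool))) (K c : seq nat) :=
  look (nth ([::], false) (unzip2 Ts) (index c (unzip1 Ts))).1 K.

Definition truncated_table (Ts : seq (seq nat * (table * bool))) :
    seq (seq nat * (zpoly * seq zpoly)) :=
  [seq (K, truncated_form (piece_in Ts K)) | K <- basis_knots].

Definition truncated_in (Gs : seq (seq nat * (zpoly * seq zpoly)))
    (K : seq nat) : zpoly * seq zpoly :=
  nth (pcst 0, [::]) (unzip2 Gs) (index K (unzip1 Gs)).

(** The recursion on every cell, the truncated power form of every basis
    function, the reproduction of the quintic monomials, and the fact that no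
    line cuts a cell. *)
Definition verified : bool :=
  let Ts := cell_tables in
  let Gs := truncated_table Ts in
  [&& all (fun T => T.2.2) Ts,
      all (fun K => truncated_ok (piece_in Ts K) (truncated_in Gs K)) basis_knots,
      all (reproduces (truncated_in Gs)) all_bases
    & all (fun c => all (fun l => nonneg_on c l.1 || nonpos_on c l.1) cut_lines)
          split12].

Definition piece : seq nat -> seq nat -> zpoly := piece_in cell_tables.

Definition truncated : seq nat -> zpoly * seq zpoly :=
  truncated_in (truncated_table cell_tables).

Lemma verified_true : verified.
Proof. by vm_cast_no_check (erefl true). Qed.

(** * Evaluation in the real field *)

Section evaluation.
Variable R : realType.

Definition zr : Z -> R := gen_phiZ 0 1 +%R *%R -%R.
Arguments zr : simpl never.

Let R_ring : ring_theory (0 : R) 1 +%R *%R (fun x y => x - y) -%R eq.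
Proof.
split=> //; [exact: add0r|exact: addrC|exact: addrA|exact: mul1r|exact: mulrC
  |exact: mulrA|exact: mulrDl|exact: subrr].
Qed.

Let R_ext : ring_eq_ext +%R *%R -%R (@eq R).
Proof. by split=> [x y -> z t ->|x y -> z t ->|x y ->]. Qed.

Let zr_morph := gen_phiZ_morph (Eqsth R) R_ext R_ring.
Let R_almost := Rth_ARth (Eqsth R) R_ext R_ring.

Lemma zr0 : zr 0 = 0. Proof. by []. Qed.
Lemma zr1 : zr 1 = 1. Proof. by []. Qed.
Lemma zrD x y : zr (x + y) = zr x + zr y.
Proof. exact: (morph_add zr_morph). Qed.
Lemma zrM x y : zr (x * y) = zr x * zr y.
Proof. exact: (morph_mul zr_morph). Qed.
Lemma zrN x : zr (- x) = - zr x.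
Proof. exact: (morph_opp zr_morph). Qed.
Lemma zrB x y : zr (x - y) = zr x - zr y.
Proof. exact: (morph_sub zr_morph). Qed.
Definition zrE := (zrD, zrN, zrM, zrB).

Lemma zr_pos p : 0 < zr (Zpos p).
Proof.
rewrite /zr (same_genZ (Eqsth R) R_ext R_ring)/=.
by elim: p => [p IH|p IH|] //=; rewrite ?ltr01// ?addr_gt0 ?mulr_gt0 ?ltr01//
  ?addr_gt0 ?ltr01.
Qed.

Lemma zr_ge0 x : (0 <=? x)%BZ -> 0 <= zr x.
Proof. by case: x => // p _; exact/ltW/zr_pos. Qed.

Lemma zr_gt0 x : (0 <? x)%BZ -> 0 < zr x.
Proof. by case: x => // p _; exact/zr_pos. Qed.

Lemma zr_le0 x : (x <=? 0)%BZ -> zr x <= 0.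
Proof. by case: x => // p _; rewrite -oppr_ge0 -zrN; exact/ltW/zr_pos. Qed.

Lemma zr_eq0 x : (zr x == 0) = (x =? 0)%BZ.
Proof.
case: x => [|p|p]; first by rewrite eqxx.
- by rewrite gt_eqF// zr_pos.
- by rewrite lt_eqF// -oppr_gt0 -zrN; exact: zr_pos.
Qed.

Lemma zr_abs x : zr (Z.abs x) = `|zr x|.
Proof.
case: x => [|p|p] /=; first by rewrite normr0.
- by rewrite gtr0_norm// zr_pos.
- by have -> : zr (Zneg p) = - zr (Zpos p) by []; rewrite normrN gtr0_norm// zr_pos.
Qed.

(** The determinants that occur as denominators are exact divisors, as the
    verification checks; so integer division suffices there. *)
Lemma zr_div x d : (x mod d =? 0)%BZ -> zr d * zr (x / d) = zr x.
Proof.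
move=> /Z.eqb_eq xd; rewrite -zrM; congr zr.
case: (Z.eq_dec d 0) xd => [-> | d0 xd]; first by rewrite Zmod_0_r => ->.
by rewrite {2}(Z.div_mod x d d0) xd Z.add_0_r.
Qed.

Definition ev (x y : R) (p : zpoly) : R := Pphi 0 +%R *%R zr [:: x; y] p.

Lemma ev_add x y p q : ev x y (padd p q) = ev x y p + ev x y q.
Proof. exact: (Padd_ok (Eqsth R) R_ext R_almost zr_morph). Qed.
Lemma ev_mul x y p q : ev x y (pmul p q) = ev x y p * ev x y q.
Proof. exact: (Pmul_ok (Eqsth R) R_ext R_almost zr_morph). Qed.
Lemma ev_scale x y c p : ev x y (pscale c p) = zr c * ev x y p.
Proof.
by rewrite mulrC; exact: (PmulC_ok (Eqsth R) R_ext R_almost zr_morph).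
Qed.
Lemma ev_cst x y c : ev x y (pcst c) = zr c.
Proof. by []. Qed.
Lemma ev_eq x y p q : peq p q -> ev x y p = ev x y q.
Proof. by move=> pq; exact: (Peq_ok (Eqsth R) R_ext zr_morph _ _ pq [:: x; y]). Qed.
Lemma ev_X1 x y : ev x y bX1 = x.
Proof. by rewrite /ev/= mul1r addr0. Qed.
Lemma ev_X2 x y : ev x y bX2 = y.
Proof. by rewrite /ev/= mul1r addr0. Qed.
Lemma ev_X3 x y : ev x y bX3 = 1 - x - y.
Proof.
rewrite /bX3 !(ev_add, ev_scale) ev_X1 ev_X2 ev_cst zr1.
by have -> : zr (-1)%BZ = -1 by []; rewrite !mulN1r addrA.
Qed.
Lemma ev_form x y a b c :
  ev x y (pform (a, b, c)) = zr a * x + zr b * y + zr c * (1 - x - y).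
Proof. by rewrite /pform 2!ev_add 3!ev_scale ev_X1 ev_X2 ev_X3 addrA. Qed.
Lemma ev_sum x y ps : ev x y (psum ps) = \sum_(p <- ps) ev x y p.
Proof.
by elim: ps => [|p ps IH]; rewrite ?big_nil ?ev_cst// big_cons /= ev_add IH.
Qed.

End evaluation.

(** * Barycentric coordinates *)

Section barycentric.
Variable R : realType.
Implicit Types (v : 'I_3 -> R * R) (x : R * R).

Definition tri_det v : R :=
  ((v 1).1 - (v 0).1) * ((v 2).2 - (v 0).2)
    - ((v 2).1 - (v 0).1) * ((v 1).2 - (v 0).2).

Definition bary2 v x : R :=
  ((x.1 - (v 0).1) * ((v 2).2 - (v 0).2)
    - ((v 2).1 - (v 0).1) * (x.2 - (v 0).2)) / tri_det v.

Definition bary3 v x : R :=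
  (((v 1).1 - (v 0).1) * (x.2 - (v 0).2)
    - (x.1 - (v 0).1) * ((v 1).2 - (v 0).2)) / tri_det v.

Definition bary1 v x : R := 1 - bary2 v x - bary3 v x.

Lemma fst_add (p q : R * R) : (p + q).1 = p.1 + q.1. Proof. by []. Qed.
Lemma snd_add (p q : R * R) : (p + q).2 = p.2 + q.2. Proof. by []. Qed.
Lemma fst_opp (p : R * R) : (- p).1 = - p.1. Proof. by []. Qed.
Lemma snd_opp (p : R * R) : (- p).2 = - p.2. Proof. by []. Qed.
Lemma fst_scale a (p : R * R) : (a *: p).1 = a * p.1. Proof. by []. Qed.
Lemma snd_scale a (p : R * R) : (a *: p).2 = a * p.2. Proof. by []. Qed.
Definition coordE :=
  (fst_add, snd_add, fst_opp, snd_opp, fst_scale, snd_scale).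

Lemma pair_eq (p q : R * R) : p.1 = q.1 -> p.2 = q.2 -> p = q.
Proof. by case: p q => [? ?] [? ?] /= -> ->. Qed.

Lemma baryE v x : nondegenerate_triangle v ->
  x = bary1 v x *: v 0 + bary2 v x *: v 1 + bary3 v x *: v 2.
Proof.
rewrite /nondegenerate_triangle => D0.
apply: pair_eq; rewrite !coordE /bary1 /bary2 /bary3 /tri_det; field.
all: exact: D0.
Qed.

Definition affine (f : R * R -> R) : Prop :=
  exists a b c, forall x, f x = a * x.1 + b * x.2 + c.

Lemma affine_sum f (I : Type) (s : seq I) (t : I -> R) (p : I -> R * R) :
  affine f -> \sum_(i <- s) t i = 1 ->
  f (\sum_(i <- s) t i *: p i) = \sum_(i <- s) t i * f (p i).
Proof.
move=> [a [b [c fE]]] t1; rewrite fE.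
under [RHS]eq_bigr do rewrite fE !mulrDr.
rewrite !big_split /= -mulr_suml t1 mul1r; congr (_ + _ + _).
- rewrite (raddf_sum (fst : R * R -> R)) mulr_sumr.
  by apply: eq_bigr => i _ /=; rewrite mulrCA.
- rewrite (raddf_sum (snd : R * R -> R)) mulr_sumr.
  by apply: eq_bigr => i _ /=; rewrite mulrCA.
Qed.

Lemma affine_bary2 v : affine (bary2 v).
Proof.
exists (((v 2).2 - (v 0).2) / tri_det v), (- ((v 2).1 - (v 0).1) / tri_det v),
  (((v 2).1 - (v 0).1) * (v 0).2 / tri_det v
   - (v 0).1 * ((v 2).2 - (v 0).2) / tri_det v) => x.
by rewrite /bary2; ring.
Qed.

Lemma affine_bary3 v : affine (bary3 v).
Proof.
exists (- ((v 1).2 - (v 0).2) / tri_det v), (((v 1).1 - (v 0).1) / tri_det v),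
  (((v 1).2 - (v 0).2) * (v 0).1 / tri_det v
   - (v 0).2 * ((v 1).1 - (v 0).1) / tri_det v) => x.
by rewrite /bary3; ring.
Qed.

Lemma affine_comb f g (a b c : R) : affine f -> affine g ->
  affine (fun x => a * f x + b * g x + c).
Proof.
move=> [a1 [b1 [c1 fE]]] [a2 [b2 [c2 gE]]].
exists (a * a1 + b * a2), (a * b1 + b * b2), (a * c1 + b * c2 + c) => x.
by rewrite fE gE; ring.
Qed.

Lemma affine_bary1 v : affine (bary1 v).
Proof.
have [a [b [c E]]] := affine_comb (-1) (-1) 1 (affine_bary2 v) (affine_bary3 v).
by exists a, b, c => x; rewrite -E /bary1; ring.
Qed.

Definition bform (l : Z3) v x : R :=
  let: (a, b, c) := l in
  zr R a * bary1 v x + zr R b * bary2 v x + zr R c * bary3 v x.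

Lemma affine_bform l v : affine (bform l v).
Proof.
case: l => [[a b] c].
have [a1 [b1 [c1 E]]] := affine_comb (zr R b - zr R a) (zr R c - zr R a) (zr R a)
  (affine_bary2 v) (affine_bary3 v).
by exists a1, b1, c1 => x; rewrite -E /bform /bary1; ring.
Qed.

Definition evb v x : zpoly -> R := ev (bary1 v x) (bary2 v x).

Lemma bary_sum v x : 1 - bary1 v x - bary2 v x = bary3 v x.
Proof. by rewrite /bary1; ring. Qed.

Lemma evb_form v x l : evb v x (pform l) = bform l v x.
Proof. by case: l => [[a b] c]; rewrite /evb ev_form bary_sum. Qed.

Lemma bary_corners v : nondegenerate_triangle v ->
  [/\ bary2 v (v 0) = 0, bary2 v (v 1) = 1 & bary2 v (v 2) = 0] /\
  [/\ bary3 v (v 0) = 0, bary3 v (v 1) = 0 & bary3 v (v 2) = 1].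
Proof.
rewrite /nondegenerate_triangle -/(tri_det v) => D0.
by do !split; rewrite /bary2 /bary3 ?subrr ?(mul0r, mulr0, subr0, oppr0, sub0r)//
  ?[X in X / _](_ : _ = tri_det v) ?divff// /tri_det; ring.
Qed.

Lemma bform_vertex l v k : nondegenerate_triangle v -> (1 <= k <= 10)%N ->
  12 * bform l v (vertex v k) = zr R (dot3 l (wt k)).
Proof.
move=> ndv k10; have [[p0 p1 p2] [q0 q1 q2]] := bary_corners ndv.
have [a [b [c E]]] := affine_bform l v.
have l0 : bform l v (v 0) = zr R l.1.1.
  by case: l {E} => [[? ?] ?]; rewrite /bform /bary1 p0 q0; ring.
have l1 : bform l v (v 1) = zr R l.1.2.
  by case: l {E l0} => [[? ?] ?]; rewrite /bform /bary1 p1 q1; ring.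
have l2 : bform l v (v 2) = zr R l.2.
  by case: l {E l0 l1} => [[? ?] ?]; rewrite /bform /bary1 p2 q2; ring.
have {}k10 : k \in iota 1 10 by rewrite mem_iota.
move: l0 l1 l2; rewrite !E; case: l {E} => [[l0 l1] l2] /=.
set L0 := zr R l0; set L1 := zr R l1; set L2 := zr R l2.
rewrite !inE in k10; do ?[case/predU1P: k10 => [->|k10]]; last move: k10 => /eqP ->.
all: rewrite /vertex /wt /dot3 /= !zrE -/L0 -/L1 -/L2 => <- <- <-; rewrite /zr/=.
all: by rewrite /GRing.scale /=; field.
Qed.

End barycentric.

(** * Plane Lebesgue measure under affine maps *)

Section plane_measure.
Variable R : realType.
Local Notation mR := (measurableTypeR R).
Local Notation leb := (@lebesgue_measure R).
Local Notation m2 := (lebesgue2 R).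

Lemma lebesgue_affine_preimage (a t : R) (A : set R) : a != 0 ->
  measurable (A : set mR) ->
  leb ((fun y : R => a * y + t) @^-1` A) = (`|a|^-1%:E * leb A)%E.
Proof.
move=> a0 mA.
pose f (y : mR) : mR := a * y + t.
have mf : measurable_fun (setT : set mR) f by exact: measurable_funD.
have na0 : 0 <= `|a| by [].
pose mu := mscale (NngNum na0) (pushforward leb f).
suff /(_ A mA) -> : forall X : set mR, measurable X -> leb X = mu mf X.
  rewrite /mu /mscale /= /pushforward muleA -EFinM mulVf ?normr_eq0// mul1e.
  by [].
apply: (lebesgue_measure_unique (mu := mu mf)) => X [[p q] _ <-] /=.
rewrite /mu /mscale /= /pushforward.
have [a_gt0|a_lt0] : 0 < a \/ a < 0 by move: a0; rewrite neq_lt => /orP[]; tauto.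
  have -> : f @^-1` `]p, q] = `](p - t) / a, (q - t) / a]%classic.
    apply/seteqP; split=> y; rewrite /f /= !in_itv /= ltr_pdivrMr// ler_pdivlMr//;
    by rewrite ltrBlDr lerBrDr [y * a]mulrC.
  rewrite !lebesgue_measure_itv /= !lte_fin ltr_pM2r ?invr_gt0// ltrD2r.
  case: ifP => _; last by rewrite mule0.
  rewrite -!EFinD -EFinM gtr0_norm//; congr EFin; by field; rewrite gt_eqF.
have -> : f @^-1` `]p, q] = `[(q - t) / a, (p - t) / a[%classic.
  apply/seteqP; split=> y; rewrite /f /= !in_itv /= ltr_ndivlMr// ler_ndivrMr// andbC;
  by rewrite ltrBlDr lerBrDr [y * a]mulrC.
rewrite !lebesgue_measure_itv /= !lte_fin ltr_nM2r ?invr_lt0// ltrD2r.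
case: ifP => _; last by rewrite mule0.
rewrite -!EFinD -EFinM ltr0_norm//; congr EFin; by field; rewrite lt_eqF.
Qed.

(** Affine maps are only used through this property, with [k] the inverse of
    the absolute value of the determinant. *)
Definition rescales (phi : R * R -> R * R) (k : R) : Prop :=
  measurable_fun (setT : set (mR * mR)) (phi : mR * mR -> mR * mR) /\
  forall C : set (mR * mR), measurable C -> m2 (phi @^-1` C) = (k%:E * m2 C)%E.

Lemma rescales_comp phi psi k l : rescales phi k -> rescales psi l ->
  rescales (psi \o phi) (k * l).
Proof.
move=> [mphi phiE] [mpsi psiE]; split; first exact: measurableT_comp.
move=> C mC; rewrite comp_preimage phiE; last first.
  by rewrite -[X in measurable X]setTI; exact: mpsi.
by rewrite psiE// muleA -EFinM.
Qed.

Lemma rescales_swap : rescales (fun x => (x.2, x.1)) 1.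
Proof.
have msw : measurable_fun (setT : set (mR * mR))
    ((fun x => (x.2, x.1)) : mR * mR -> mR * mR).
  by apply: measurable_fun_pair; [exact: measurable_snd|exact: measurable_fst].
split=> // C mC; rewrite mul1e.
pose sw : mR * mR -> mR * mR := fun x => (x.2, x.1).
apply/esym; rewrite /lebesgue2.
apply: (@product_measure_unique _ _ mR mR R leb leb (pushforward m2 sw)) mC.
move=> A B mA mB; transitivity (m2 (B `*` A)).
  by congr (m2 _); apply/seteqP; split => -[x y] /= [].
by rewrite /lebesgue2 /= product_measure1E// muleC.
Qed.

(** A shear composed with a scaling of the second coordinate acts on each
    vertical section as a one-dimensional affine map. *)
Lemma rescales_shear (a c t : R) : a != 0 ->
  rescales (fun x => (x.1, a * x.2 + (c * x.1 + t))) `|a|^-1.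
Proof.
move=> a0.
have ms : measurable_fun (setT : set (mR * mR))
    ((fun x => (x.1, a * x.2 + (c * x.1 + t))) : mR * mR -> mR * mR).
  apply: measurable_fun_pair; first exact: measurable_fst.
  apply: measurable_funD; first by apply: measurable_funM => //; exact: measurable_snd.
  apply: measurable_funD => //; by apply: measurable_funM => //; exact: measurable_fst.
split=> // C mC; rewrite /lebesgue2 /= /product_measure1.
rewrite -ge0_integralZl//; last exact: measurable_fun_xsection.
apply: eq_integral => x _ /=; rewrite -(lebesgue_affine_preimage (c * x + t) a0).
  by congr (leb _); apply/seteqP; split=> y; rewrite /xsection /= !inE.
exact: measurable_xsection.
Qed.

Lemma rescales_affine (a b s c d t : R) : a * d - b * c != 0 ->
  rescales (fun x => (a * x.1 + b * x.2 + s, c * x.1 + d * x.2 + t))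
    `|a * d - b * c|^-1.
Proof.
(* With [d != 0]: replace the second coordinate, then the first one. *)
have main (a' b' s' c' d' t' : R) : d' != 0 -> a' * d' - b' * c' != 0 ->
  rescales (fun x => (a' * x.1 + b' * x.2 + s', c' * x.1 + d' * x.2 + t'))
    `|a' * d' - b' * c'|^-1.
  move=> d0 D0.
  have e0 : (a' * d' - b' * c') / d' != 0 by rewrite mulf_neq0 ?invr_eq0.
  have := rescales_comp (rescales_comp (rescales_comp
    (rescales_shear c' t' d0) rescales_swap)
    (rescales_shear (b' / d') (s' - b' * t' / d') e0)) rescales_swap.
  rewrite !mulr1 -invfM normrM normfV mulrCA mulfV ?normr_eq0// mulr1.
  congr rescales; apply/funext => -[x y] /=; congr pair; first by field.
  by ring.
move=> D0; have [d0|d0] := eqVneq d 0; last exact: main.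
have c0 : c != 0 by apply: contraNneq D0 => ->; rewrite d0 !mulr0 subrr.
have D1 : b * c - a * d != 0 by rewrite -opprB oppr_eq0.
have := rescales_comp rescales_swap (main b a s d c t c0 D1).
rewrite mul1r distrC; congr rescales; apply/funext => -[x y] /=.
by congr pair; ring.
Qed.

Definition unit_triangle : set (R * R) :=
  [set x | [/\ 0 <= x.1, 0 <= x.2 & x.1 + x.2 <= 1]].

Lemma measurable_unit_triangle : measurable (unit_triangle : set (mR * mR)).
Proof.
have mf := @measurable_fst _ _ mR mR; have ms := @measurable_snd _ _ mR mR.
have -> : unit_triangle = (fst @^-1` `[0, +oo[ `&` snd @^-1` `[0, +oo[) `&`
    (fun x : R * R => x.1 + x.2) @^-1` `]-oo, 1].
  apply/seteqP; split=> x; rewrite /unit_triangle /= !in_itv /= !andbT.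
    by case.
  by move=> [[]].
apply: measurableI; first apply: measurableI.
- by rewrite -[X in measurable X]setTI; exact: mf.
- by rewrite -[X in measurable X]setTI; exact: ms.
- rewrite -[X in measurable X]setTI.
  by have := measurable_funD mf ms; exact.
Qed.

Lemma unit_triangle_measure :
  exists2 k : R, 0 < k & m2 unit_triangle = k%:E.
Proof.
have seg (r : R) : 0 <= r -> leb `[0, r] = r%:E.
  rewrite lebesgue_measure_itv /= lte_fin.
  by case: ltgtP => // [r0 _|<- //]; rewrite -EFinD subr0.
have sq (r : R) : 0 <= r -> m2 (`[0, r] `*` `[0, r]) = (r * r)%:E.
  move=> r0; rewrite [LHS]product_measure1E// EFinM.
  by congr (_ * _)%E; exact: seg.
have m_sq (r : R) : measurable (`[0, r] `*` `[0, r] : set (mR * mR)).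
  exact: measurableX.
have lo : ((2^-1 * 2^-1)%:E <= m2 unit_triangle)%E.
  rewrite -sq ?invr_ge0//; apply: le_measure; rewrite ?inE//.
    exact: measurable_unit_triangle.
  move=> x [] /=; rewrite !in_itv /= => /andP[? ?] /andP[? ?].
  by split=> //; lra.
have hi : (m2 unit_triangle <= 1%:E)%E.
  rewrite -[1]mulr1 -sq//; apply: le_measure; rewrite ?inE//.
    exact: measurable_unit_triangle.
  by move=> x [? ? ?]; split; rewrite /= in_itv /=; apply/andP; split=> //; lra.
have fin : m2 unit_triangle \is a fin_num.
  by rewrite ge0_fin_numE// (le_lt_trans hi)// ltry.
exists (fine (m2 unit_triangle)); last by rewrite fineK.
by rewrite -lte_fin fineK// (lt_le_trans _ lo)// lte_fin mulr_gt0.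
Qed.

Lemma affine3 (f : R * R -> R) a b c p q r : affine f -> a + b + c = 1 ->
  f (a *: p + b *: q + c *: r) = a * f p + b * f q + c * f r.
Proof.
move=> [x [y [z fE]]] abc; rewrite !fE !coordE.
have -> : a = 1 - b - c by rewrite -abc; ring.
by ring.
Qed.

Lemma hull3P (p q r x : R * R) :
  hull [:: p; q; r] x <-> exists a b c : R,
    [/\ 0 <= a, 0 <= b, 0 <= c, a + b + c = 1 & x = a *: p + b *: q + c *: r].
Proof.
split=> [[c [c0 c1 ->]]|[a [b [c [a0 b0 c0 abc ->]]]]].
  exists (c ord0), (c (lift ord0 ord0)), (c (lift ord0 (lift ord0 ord0))).
  split=> //; first by rewrite -c1 !big_ord_recl big_ord0 addr0 addrA.
  by rewrite !big_ord_recl big_ord0 addr0 addrA.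
exists (fun i => nth 0 [:: a; b; c] i); split.
- by case=> [[|[|[|//]]]].
- by rewrite !big_ord_recl big_ord0 addr0 addrA.
- by rewrite !big_ord_recl big_ord0 addr0 addrA.
Qed.

Lemma triangleP (v : 'I_3 -> R * R) x : nondegenerate_triangle v ->
  triangle v x <-> [/\ 0 <= bary1 v x, 0 <= bary2 v x & 0 <= bary3 v x].
Proof.
move=> ndv; split=> [/hull3P[a [b [c [a0 b0 c0 abc ->]]]]|[b1 b2 b3]].
  have [[p0 p1 p2] [q0 q1 q2]] := bary_corners ndv.
  have aff f : affine f -> _ := fun hf => affine3 (v 0) (v 1) (v 2) hf abc.
  rewrite !aff; [|exact: affine_bary3|exact: affine_bary2|exact: affine_bary1].
  rewrite /bary1 p0 p1 p2 q0 q1 q2.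
  by rewrite !(subr0, mulr0, mulr1, addr0, add0r, subrr).
apply/hull3P; exists (bary1 v x), (bary2 v x), (bary3 v x).
by split=> //; [rewrite /bary1; ring|exact: baryE].
Qed.

Lemma triangle_preimage (v : 'I_3 -> R * R) : nondegenerate_triangle v ->
  triangle v = (fun x => (bary2 v x, bary3 v x)) @^-1` unit_triangle.
Proof.
move=> ndv; apply/seteqP; split=> x.
  by move=> /(triangleP _ ndv)[b1 b2 b3]; split=> //=; rewrite /bary1 in b1; lra.
by move=> [/= b2 b3 b1]; apply/(triangleP _ ndv); split=> //; rewrite /bary1; lra.
Qed.

Lemma rescales_bary (v : 'I_3 -> R * R) : nondegenerate_triangle v ->
  rescales (fun x => (bary2 v x, bary3 v x)) `|tri_det v|.
Proof.
move=> ndv; have D0 : tri_det v != 0 by [].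
pose a := ((v 2).2 - (v 0).2) / tri_det v.
pose b := - ((v 2).1 - (v 0).1) / tri_det v.
pose c := - ((v 1).2 - (v 0).2) / tri_det v.
pose d := ((v 1).1 - (v 0).1) / tri_det v.
have DE : a * d - b * c = (tri_det v)^-1.
  rewrite /a /b /c /d; move: D0; rewrite /tri_det => D0.
  by field.
have := @rescales_affine a b (- a * (v 0).1 - b * (v 0).2) c d
  (- c * (v 0).1 - d * (v 0).2).
rewrite DE invr_eq0 => /(_ D0); rewrite normfV invrK; congr rescales.
apply/funext => x; rewrite /bary2 /bary3 /a /b /c /d.
by congr pair; ring.
Qed.

Lemma measurable_triangle (v : 'I_3 -> R * R) : nondegenerate_triangle v ->
  measurable (triangle v : set (mR * mR)).
Proof.
move=> ndv; rewrite triangle_preimage// -[X in measurable X]setTI.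
by have [+ _] := rescales_bary ndv; apply=> //; exact: measurable_unit_triangle.
Qed.

(** The barycentric coordinates map every triangle to the same one, so ratios of
    areas are ratios of determinants. *)
Lemma measure_triangle :
  exists2 k : R, 0 < k & forall v : 'I_3 -> R * R, nondegenerate_triangle v ->
    m2 (triangle v) = (`|tri_det v| * k)%:E.
Proof.
have [k k0 kE] := unit_triangle_measure; exists k => // v ndv.
have [_ E] := rescales_bary ndv.
by rewrite triangle_preimage// E ?kE ?EFinM//; exact: measurable_unit_triangle.
Qed.

Lemma bary_vertex (v : 'I_3 -> R * R) k : nondegenerate_triangle v ->
  (1 <= k <= 10)%N ->
  [/\ 12 * bary1 v (vertex v k) = zr R (wt k).1.1,
      12 * bary2 v (vertex v k) = zr R (wt k).1.2
    & 12 * bary3 v (vertex v k) = zr R (wt k).2].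
Proof.
move=> ndv k10; have E l := bform_vertex l ndv k10.
have := (E (1, 0, 0)%BZ, E (0, 1, 0)%BZ, E (0, 0, 1)%BZ).
case: (wt k) => [[w1 w2] w3]; rewrite /dot3 /bform.
rewrite !zr0 !zr1 !mul0r !mul1r !addr0 !add0r.
by rewrite !Z.mul_0_l !Z.add_0_r !Z.add_0_l !Z.mul_1_l => -[[<- <-] <-].
Qed.

Lemma vertexE (v : 'I_3 -> R * R) k : nondegenerate_triangle v ->
  (1 <= k <= 10)%N ->
  12 *: vertex v k = zr R (wt k).1.1 *: v 0 + zr R (wt k).1.2 *: v 1
    + zr R (wt k).2 *: v 2.
Proof.
move=> ndv k10; rewrite [in LHS](baryE (vertex v k) ndv).
by have [<- <- <-] := bary_vertex ndv k10; rewrite !scalerDr !scalerA.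
Qed.

Lemma wt_sum k : (1 <= k <= 10)%N ->
  ((wt k).1.1 + (wt k).1.2 + (wt k).2 = 12)%BZ.
Proof.
move=> k10; have {k10} : k \in iota 1 10 by rewrite mem_iota.
by rewrite !inE; do ?[case/predU1P => [->|]] => // /eqP ->.
Qed.

Definition subtri (v : 'I_3 -> R * R) (t : seq nat) : 'I_3 -> R * R :=
  fun s => vertex v (nth 0%N t s).

Lemma chull_subtri v i j k :
  chull v [:: i; j; k] = triangle (subtri v [:: i; j; k]).
Proof. by []. Qed.

Lemma tri_det_subtri v i j k : nondegenerate_triangle v ->
  all (fun l => (1 <= l <= 10)%N) [:: i; j; k] ->
  1728 * tri_det (subtri v [:: i; j; k]) = tri_det v * zr R (dt i j k).
Proof.
move=> ndv /= /and4P[hi hj hk _].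
have [[hs1 hs2] hs3] := (wt_sum hi, wt_sum hj, wt_sum hk).
have [[vi vj] vk] := (vertexE ndv hi, vertexE ndv hj, vertexE ndv hk).
have zs (a b c : Z) : (a + b + c = 12)%BZ -> zr R a = 12 - zr R b - zr R c.
  move=> abc; have : zr R (a + b + c) = zr R 12 by rewrite abc.
  have -> : zr R 12 = 12 by rewrite /zr /=; ring.
  by rewrite !zrD => <-; ring.
have vE (x : R * R) y : 12 *: x = y -> x = 12^-1 *: y.
  by move=> <-; rewrite scalerA mulVf ?scale1r.
rewrite /tri_det /subtri /dt.
have -> : nth 0%N [:: i; j; k] (nat_of_ord (0%R : 'I_3)) = i by [].
have -> : nth 0%N [:: i; j; k] (nat_of_ord (1%R : 'I_3)) = j by [].
have -> : nth 0%N [:: i; j; k] (nat_of_ord (2%R : 'I_3)) = k by [].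
rewrite (vE _ _ vi) (vE _ _ vj) (vE _ _ vk) !coordE.
move: (wt i) (wt j) (wt k) hs1 hs2 hs3 => [[a1 a2] a3] [[b1 b2] b3] [[c1 c2] c3].
move=> /= /zs sa /zs sb /zs sc; rewrite !zrE sa sb sc.
by field.
Qed.

Lemma hull_sub (s1 s2 : seq (R * R)) :
  (forall p, p \in s1 -> hull s2 p) -> hull s1 `<=` hull s2.
Proof.
move=> s12 _ [c [c0 c1 ->]].
have /choice [d dP] i : exists d : 'I_(size s2) -> R,
    [/\ forall j, 0 <= d j, \sum_j d j = 1
       & nth 0 s1 (i : 'I_(size s1)) = \sum_j d j *: nth 0 s2 j].
  exact: s12 (mem_nth _ _).
exists (fun j => \sum_i c i * d i j); split.
- by move=> j; apply: sumr_ge0 => i _; rewrite mulr_ge0//; have [] := dP i.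
- rewrite exchange_big /= -c1; apply: eq_bigr => i _.
  by rewrite -mulr_sumr; have [_ -> _] := dP i; rewrite mulr1.
- under eq_bigr => i _ do have [_ _ ->] := dP i.
  under [RHS]eq_bigr => j _ do rewrite scaler_suml.
  rewrite exchange_big /=; apply: eq_bigr => i _.
  by rewrite scaler_sumr; apply: eq_bigr => j _; rewrite scalerA.
Qed.

Lemma mem_hull (s : seq (R * R)) p : p \in s -> hull s p.
Proof.
move=> ps; have ip : (index p s < size s)%N by rewrite index_mem.
exists (fun i => (i == Ordinal ip)%:R); split.
- by move=> i; rewrite ler0n.
- rewrite (bigD1 (Ordinal ip))//= eqxx big1 ?addr0// => i /negPf ->.
  by [].
- rewrite (bigD1 (Ordinal ip))//= eqxx big1 ?addr0 ?scale1r ?nth_index//.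
  by move=> i /negPf ->; rewrite scale0r.
Qed.
(** The hull is a continuous image of the standard simplex. *)
Lemma hull_compact (s : seq (R * R)) : compact (hull s).
Proof.
pose n := size s.
pose simplex := [set c : 'rV[R]_n | (forall i, `[0, 1]%classic (c ord0 i)) /\
  \sum_i c ord0 i = 1].
pose f (c : 'rV[R]_n) : R * R := \sum_i c ord0 i *: nth 0 s i.
have cc i : continuous (fun c : 'rV[R]_n => c ord0 i).
  exact: (@coord_continuous R 1 n ord0 i).
have -> : hull s = f @` simplex.
  apply/seteqP; split=> [x [c [c0 c1 ->]]|_ [c [c01 c1] <-]].
    exists (\row_i c i); last by apply: eq_bigr => i _; rewrite mxE.
    split; last by rewrite -c1; apply: eq_bigr => i _; rewrite mxE.
    move=> i; rewrite /= in_itv /= mxE c0 /= -c1 (bigD1 i)//= lerDl.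
    exact: sumr_ge0.
  exists (c ord0); split=> // i; have := c01 i.
  by rewrite /= in_itv => /andP[].
apply: continuous_compact.
  apply: continuous_subspaceT => c; rewrite /f.
  apply: (@continuous_big (R * R)%type _ +%R 0 xpredT (@add_continuous _)) => i _.
  move=> d; apply: continuousZr_tmp; exact: cc.
have closed_sum : closed [set c : 'rV[R]_n | \sum_i c ord0 i = 1].
  have cs : continuous (fun c : 'rV[R]_n => \sum_i c ord0 i).
    apply: (@continuous_big R _ +%R 0 xpredT (@add_continuous _)) => i _ d.
    exact: cc.
  have := closed_comp (fun c _ => cs c) (@closed_eq R 1).
  by apply.
pose cube := [set c : 'rV[R]_n | forall i, `[0, 1]%classic (c ord0 i)].
have cube_compact : compact cube.
  by apply: (@rV_compact R n (fun=> `[0, 1]%classic)) => i; exact: segment_compact.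
apply: (subclosed_compact _ cube_compact); last by move=> c [].
apply: (@closedI _ cube) => //; apply: compact_closed => //; exact: norm_hausdorff.
Qed.

Lemma hull_closed (s : seq (R * R)) : closed (hull s).
Proof.
by apply: compact_closed (@hull_compact s); exact: (@norm_hausdorff R (R * R)%type).
Qed.

(** A countable union of rational boxes. *)
Lemma open_measurable2 (U : set (R * R)) : open U ->
  measurable (U : set (mR * mR)).
Proof.
move=> oU.
pose box (q : (rat * rat) * (rat * rat)) : set (R * R) :=
  `]ratr q.1.1, ratr q.1.2[ `*` `]ratr q.2.1, ratr q.2.2[.
have -> : U = \bigcup_q (if `[< box q `<=` U >] then box q else set0).
  apply/seteqP; split=> [[x y] Ux|x [q _]]; last by case: asboolP => // + ?; exact.
  have /nbhs_ballP[e /= e0 eU] : nbhs (x, y) U by exact: open_nbhs_nbhs.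
  have [|a1] := @rat_in_itvoo R (x - e) x; first by rewrite ltrBlDr ltrDl.
  have [|a2] := @rat_in_itvoo R x (x + e); first by rewrite ltrDl.
  have [|b1] := @rat_in_itvoo R (y - e) y; first by rewrite ltrBlDr ltrDl.
  have [|b2] := @rat_in_itvoo R y (y + e); first by rewrite ltrDl.
  rewrite !in_itv /= => /andP[b21 b22] /andP[b11 b12] /andP[a21 a22] /andP[a11 a12].
  exists ((a1, a2), (b1, b2)) => //; rewrite asboolT.
    by split; rewrite /= in_itv /=; apply/andP.
  move=> [z w] [/=]; rewrite !in_itv /= => /andP[z1 z2] /andP[w1 w2].
  by apply: eU; split; rewrite /ball /= ltr_norml; apply/andP; split; lra.
apply: countable_bigcupT_measurable => // q.
by case: ifP => _ //; exact: measurableX.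
Qed.

Lemma closed_measurable2 (U : set (R * R)) : closed U ->
  measurable (U : set (mR * mR)).
Proof.
by move=> cU; rewrite -[U]setCK; apply: measurableC; apply: open_measurable2; exact: closed_openC.
Qed.

Lemma measurable_hull (s : seq (R * R)) : measurable (hull s : set (mR * mR)).
Proof. by apply: closed_measurable2; exact: hull_closed. Qed.

Implicit Type v : 'I_3 -> R * R.

Definition labels_ok (K : seq nat) : bool := all (fun k => 1 <= k <= 10)%N K.

Lemma vertex_in_triangle v k : nondegenerate_triangle v -> (1 <= k <= 10)%N ->
  triangle v (vertex v k).
Proof.
move=> ndv k10; apply/(triangleP _ ndv).
have : [/\ 0 <= zr R (wt k).1.1, 0 <= zr R (wt k).1.2 & 0 <= zr R (wt k).2].
  have : k \in iota 1 10 by rewrite mem_iota.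
  by rewrite !inE; do ?[case/predU1P => [->|]]; last (move=> /eqP ->);
    split; exact: zr_ge0.
have [<- <- <-] := bary_vertex ndv k10; have p12 : 0 < 12 :> R by rewrite ltr0n.
by rewrite !(pmulr_rge0 _ p12).
Qed.

Lemma chull_sub_triangle v K : nondegenerate_triangle v -> labels_ok K ->
  chull v K `<=` triangle v.
Proof.
move=> ndv /allP Kok; apply: hull_sub => _ /mapP[k kK ->].
exact/vertex_in_triangle/Kok.
Qed.

Lemma triangle_fin v : nondegenerate_triangle v -> m2 (triangle v) \is a fin_num.
Proof. by move=> ndv; have [k _ ->] := measure_triangle. Qed.

(** The hull of labels that contain a nondegenerate triangle has positive
    area. *)
Lemma area_chull_neq0 v K i j k : nondegenerate_triangle v -> labels_ok K ->
  i \in K -> j \in K -> k \in K -> ~~ (dt i j k =? 0)%BZ ->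
  area (chull v K) != 0.
Proof.
move=> ndv Kok iK jK kK D0.
have Kok3 : labels_ok [:: i; j; k].
  by move/allP : Kok => Kok; rewrite /= !Kok.
have ndt : nondegenerate_triangle (subtri v [:: i; j; k]).
  have := tri_det_subtri ndv Kok3; rewrite /nondegenerate_triangle -/(tri_det _).
  apply: contra_eq_neq => ->; rewrite mulr0 eq_sym mulf_neq0//.
  by rewrite zr_eq0.
have [c c0 cE] := measure_triangle.
have le1 : (m2 (triangle (subtri v [:: i; j; k])) <= m2 (chull v K))%E.
  apply: le_measure; rewrite ?inE; [exact: measurable_hull..|].
  rewrite -chull_subtri; apply: hull_sub => _ /mapP[l + ->].
  rewrite !inE => /or3P[] /eqP ->; apply: mem_hull; exact: map_f.
have le2 : (m2 (chull v K) <= m2 (triangle v))%E.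
  apply: le_measure; rewrite ?inE; [exact: measurable_hull..|].
  exact: chull_sub_triangle.
have fK : m2 (chull v K) \is a fin_num.
  by rewrite ge0_fin_numE// (le_lt_trans le2)// cE// ltry.
apply: lt0r_neq0; rewrite /area -lte_fin (fineK fK); apply: lt_le_trans le1.
by rewrite (cE _ ndt) lte_fin; apply: mulr_gt0 c0; rewrite normr_gt0; exact: ndt.
Qed.

Lemma area_ratio v i j k : nondegenerate_triangle v -> labels_ok [:: i; j; k] ->
  ~~ (dt i j k =? 0)%BZ ->
  area (triangle v) / area (chull v [:: i; j; k]) = 1728 / `|zr R (dt i j k)|.
Proof.
move=> ndv Kok D0; have zD0 : zr R (dt i j k) != 0 by rewrite zr_eq0.
have E := tri_det_subtri ndv Kok.
have ndt : nondegenerate_triangle (subtri v [:: i; j; k]).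
  rewrite /nondegenerate_triangle -/(tri_det _).
  by apply: contra_eq_neq E => ->; rewrite mulr0 eq_sym mulf_neq0.
have [c c0 cE] := measure_triangle.
rewrite chull_subtri /area (cE _ ndv) (cE _ ndt) /=.
have -> : tri_det (subtri v [:: i; j; k]) = tri_det v * zr R (dt i j k) / 1728.
  by rewrite -E; field.
rewrite !normrM normfV (@ger0_norm _ 1728 (ler0n _ _)).
have tv0 : `|tri_det v| != 0 by rewrite normr_eq0.
have zd0 : `|zr R (dt i j k)| != 0 by rewrite normr_eq0.
have n0 : (1728 : R) != 0 by rewrite pnatr_eq0.
have cn0 : c != 0 by rewrite gt_eqF.
move: (1728 : R) n0 => n n0; field.
by rewrite ?tv0 ?zd0 ?cn0 ?n0.
Qed.

End plane_measure.

(** * The recursion on a cell *)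

Section recursion.
Variable R : realType.
Variable v : 'I_3 -> R * R.
Hypothesis ndv : nondegenerate_triangle v.

Definition cross3 (q r : Z3) : Z3 :=
  let: (q1, q2, q3) := q in let: (r1, r2, r3) := r in
  (q2 * r3 - q3 * r2, q3 * r1 - q1 * r3, q1 * r2 - q2 * r1)%BZ.

(** The form [12 * edge_form j k] is the determinant [dt] with its first
    argument replaced by a point. *)
Definition edge_form (j k : nat) : Z3 := cross3 (wt j) (wt k).

Lemma dt_edge i j k :
  [/\ dot3 (edge_form j k) (wt i) = dt i j k,
      dot3 (edge_form k i) (wt j) = dt i j k
    & dot3 (edge_form i j) (wt k) = dt i j k].
Proof.
rewrite /edge_form /dt; case: (wt i) (wt j) (wt k) => [[? ?] ?] [[? ?] ?] [[? ?] ?].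
by split; rewrite /=; lia.
Qed.

Lemma dt_same i j : [/\ dt i i j = 0%BZ, dt i j i = 0%BZ & dt j i i = 0%BZ].
Proof.
rewrite /dt; case: (wt i) (wt j) => [[? ?] ?] [[? ?] ?].
by split; rewrite /=; lia.
Qed.

Lemma dt_corner j k :
  [/\ dt 1 j k = (12 * (edge_form j k).1.1)%BZ,
      dt 2 j k = (12 * (edge_form j k).1.2)%BZ
    & dt 3 j k = (12 * (edge_form j k).2)%BZ].
Proof.
rewrite /edge_form /dt; case: (wt j) (wt k) => [[? ?] ?] [[? ?] ?].
by split; rewrite /det3 /cross3 /wt; cbn [nth predn fst snd]; lia.
Qed.

(** A form is affine in the point, and its values at the vertices are integers
    up to the factor 12; this reduces signs of forms on a cell or on a hull to
    signs of integers. *)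
Lemma form_comb (I : eqType) (s : seq I) (lab : I -> nat) (t : I -> R) x l :
  (forall i, i \in s -> t i != 0 -> (1 <= lab i <= 10)%N) ->
  \sum_(i <- s) t i = 1 -> x = \sum_(i <- s) t i *: vertex v (lab i) ->
  12 * bform l v x = \sum_(i <- s) t i * zr R (dot3 l (wt (lab i))).
Proof.
move=> labok t1 ->; rewrite affine_sum//; last exact: affine_bform.
rewrite mulr_sumr big_seq [RHS]big_seq; apply: eq_bigr => i si.
have [->|ti0] := eqVneq (t i) 0; first by rewrite !mul0r mulr0.
by rewrite mulrCA bform_vertex// labok.
Qed.

(** [b] is admissible in the recursion for [Q[K]] at [x]. *)
Definition admissible (K : seq nat) (x : R * R) (b : nat -> R) : Prop :=
  [/\ forall j, j \notin K -> b j = 0, \sum_(1 <= j < 11) b j = 1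
    & \sum_(1 <= j < 11) b j *: vertex v j = x].

Lemma admissible_form K x b l : labels_ok K -> admissible K x b ->
  12 * bform l v x = \sum_(1 <= j < 11) b j * zr R (dot3 l (wt j)).
Proof.
move=> /allP Kok [b0 b1 bx].
apply: (@form_comb _ (index_iota 1 11) id) => // j _ bj.
by apply: Kok; apply: contraNT bj => /b0 ->.
Qed.

Section frame_coordinates.
Variables (i j k : nat).
Hypothesis lab : labels_ok [:: i; j; k].
Hypothesis D0 : ~~ (dt i j k =? 0)%BZ.
Let t := subtri v [:: i; j; k].

Lemma subtri_nondegenerate : nondegenerate_triangle t.
Proof.
have := tri_det_subtri ndv lab; rewrite /nondegenerate_triangle -/(tri_det _).
apply: contra_eq_neq => ->; rewrite mulr0 eq_sym mulf_neq0//.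
by rewrite zr_eq0.
Qed.

Lemma subtri_bary x :
  [/\ 12 * bform (edge_form j k) v x = zr R (dt i j k) * bary1 t x,
      12 * bform (edge_form k i) v x = zr R (dt i j k) * bary2 t x
    & 12 * bform (edge_form i j) v x = zr R (dt i j k) * bary3 t x].
Proof.
have E l : 12 * bform l v x = bary1 t x * zr R (dot3 l (wt i))
    + bary2 t x * zr R (dot3 l (wt j)) + bary3 t x * zr R (dot3 l (wt k)).
  have := @form_comb _ [:: 0; 1; 2]%N (nth 0%N [:: i; j; k])
    (nth 0 [:: bary1 t x; bary2 t x; bary3 t x]) x l.
  rewrite !big_cons !big_nil /= !addr0 !addrA; apply.
  - move: lab => /and4P[? ? ? _] s; rewrite !inE.
    by do ?[case/predU1P => [->|]] => // /eqP ->.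
  - by rewrite /bary1; ring.
  - exact: (baryE x subtri_nondegenerate).
have [z1 z2 z3] := dt_same i j; have [y1 y2 y3] := dt_same i k.
have [w1 w2 w3] := dt_same j k; have [u1 u2 u3] := dt_same j i.
have [s1 s2 s3] := dt_same k i; have [r1 r2 r3] := dt_same k j.
rewrite !E.
have [-> _ _] := dt_edge i j k; have [-> _ _] := dt_edge j j k.
have [-> _ _] := dt_edge k j k.
have [_ -> _] := dt_edge i i k; have [_ -> _] := dt_edge i j k.
have [_ -> _] := dt_edge i k k.
have [_ _ ->] := dt_edge i j i; have [_ _ ->] := dt_edge i j j.
have [_ _ ->] := dt_edge i j k.
rewrite w1 r2 y1 s3 z2 u3 zr0.
by split; ring.
Qed.

Lemma evb_frame_coord x (a b : nat) D :
  all (fun s => dt s a b mod D =? 0)%BZ [:: 1; 2; 3]%N ->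
  zr R D * evb v x (frame_coord a b D) = 12 * bform (edge_form a b) v x.
Proof.
move=> /and4P[e1 e2 e3 _].
rewrite evb_form /bform; have [d1 d2 d3] := dt_corner a b.
rewrite !mulrDr !mulrA !zr_div//.
rewrite d1 d2 d3; case: (edge_form a b) => [[? ?] ?].
by rewrite !zrM (_ : zr R 12 = 12)//= ?mulrDr ?mulrA// /zr /=; ring.
Qed.
End frame_coordinates.

Definition on_cell (c : seq nat) (x : R * R) (t : nat -> R) : Prop :=
  \sum_(u <- c) t u = 1 /\ x = \sum_(u <- c) t u *: vertex v u.

Definition in_cell c x := exists2 t, on_cell c x t & forall u, u \in c -> 0 <= t u.

Definition in_open_cell c x :=
  exists2 t, on_cell c x t & forall u, u \in c -> 0 < t u.

Lemma open_cellW c x : in_open_cell c x -> in_cell c x.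
Proof. by move=> [t ct t0]; exists t => // u /t0 /ltW. Qed.

Lemma cell_form_ge0 c x l : labels_ok c -> in_cell c x ->
  (forall u, u \in c -> (0 <=? dot3 l (wt u))%BZ) -> 0 <= bform l v x.
Proof.
move=> /allP cok [t [t1 tx] t0] lc.
rewrite -(@pmulr_rge0 _ 12) ?ltr0n//.
rewrite (form_comb (lab := id) l _ t1 tx); last by move=> u uc _; exact: cok.
by rewrite big_seq sumr_ge0// => u uc; rewrite mulr_ge0 ?t0// zr_ge0// lc.
Qed.

Lemma cell_form_gt0 c x l : labels_ok c -> in_open_cell c x ->
  (forall u, u \in c -> (0 <=? dot3 l (wt u))%BZ) ->
  has (fun u => 0 <? dot3 l (wt u))%BZ c -> 0 < bform l v x.
Proof.
move=> /allP cok [t [t1 tx] t0] lc /hasP[u0 u0c lu0].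
rewrite -(@pmulr_rgt0 _ 12) ?ltr0n//.
rewrite (form_comb (lab := id) l _ t1 tx); last by move=> u uc _; exact: cok.
have ge0 u : u \in c -> 0 <= t u * zr R (dot3 l (wt u)).
  by move=> uc; rewrite mulr_ge0 ?zr_ge0 ?lc// ltW// t0.
rewrite big_seq lt_neqAle sumr_ge0// andbT eq_sym psumr_neq0//.
by apply/hasP; exists u0 => //; rewrite u0c mulr_gt0 ?t0 ?zr_gt0.
Qed.

Lemma frameP c K i j k : frame c K = Some (i, j, k) ->
  [/\ i \in K, j \in K, k \in K & covers c (i, j, k)].
Proof.
rewrite /frame; set s := seq.filter _ _ => sE.
have : (i, j, k) \in s by case: s sE => //= a s [->]; rewrite mem_head.
rewrite mem_filter => /andP[cov /allpairsPdep[[a b] [l [abK lK E]]]].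
case: E cov => -> -> -> cov; move: abK lK; rewrite !mem_filter mem_undup.
move=> /andP[_ /allpairsPdep[a' [b' [aK bK E]]]] /andP[_ lK].
by case: E cov => -> -> cov; move: aK bK; rewrite !mem_undup.
Qed.

Lemma look_map (g : seq nat -> zpoly) Ks K : K \in Ks ->
  look [seq (L, g L) | L <- Ks] K = g K.
Proof.
elim: Ks => // L Ks IH; rewrite inE /=.
by case: eqVneq => [->//|_]; exact: IH.
Qed.

Lemma mem_faces Ks K l : K \in Ks -> l \in K -> rem l K \in faces Ks.
Proof.
move=> KKs lK; rewrite mem_undup; apply/flattenP.
exists [seq rem j K | j <- undup K]; first exact: (map_f (fun K => [seq rem j K | j <- undup K])).
by apply: map_f; rewrite mem_undup.
Qed.

Lemma labels_rem l K : labels_ok K -> labels_ok (rem l K).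
Proof. by move=> /allP Kok; apply/allP => m /mem_rem; exact: Kok. Qed.

Lemma faces_ok Ks : all labels_ok Ks -> all labels_ok (faces Ks).
Proof.
move=> /allP Ksok; apply/allP => L; rewrite mem_undup => /flattenP[_ /mapP[K KKs ->]].
by move=> /mapP[l _ ->]; exact/labels_rem/Ksok.
Qed.

Definition piece_value c n Ks x K : R := evb v x (look (pieces c n Ks).1 K).

(** The pieces obey the recursion with the frame coordinates, and with every
    other admissible choice of coefficients. *)
Lemma piece_value_step c n Ks x K : K \in Ks -> (pieces c n.+1 Ks).2 ->
  labels_ok K ->
  let f l := piece_value c n (faces Ks) x (rem l K) in
  if frame c K is Some (i, j, k) then
    let t := subtri v [:: i; j; k] in
    piece_value c n.+1 Ks x K = bary1 t x * f i + bary2 t x * f j + bary3 t x * f k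
    /\ forall l, l \in K -> zr R (dt i j k) * f l =
         zr R (dt l j k) * f i + zr R (dt i l k) * f j + zr R (dt i j l) * f k
  else piece_value c n.+1 Ks x K = 0 /\ forall l, l \in K -> f l = 0.
Proof.
move=> KKs; rewrite /piece_value /=; case: (pieces c n (faces Ks)) => T ok /=.
move=> /andP[_ /allP/(_ _ KKs)]; rewrite /step_ok look_map// /next_piece => step Kok.
case E : (frame c K) step => [[[i j] k]|]; last first.
  move=> /allP f0; split; first by rewrite /evb ev_cst.
  by move=> l lK; rewrite /evb (ev_eq _ _ (f0 l _)) ?mem_undup// ev_cst.
have [iK jK kK /andP[D0 _]] := frameP E.
move=> /andP[/allP dv /allP dep].
have lab : labels_ok [:: i; j; k].
  by move/allP : Kok => Kok; rewrite /= !Kok.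
have zD0 : zr R (dt i j k) != 0 by rewrite zr_eq0.
split.
  have [e1 e2 e3] := subtri_bary lab D0 x.
  have cE a b : all (fun s => dt s a b mod dt i j k =? 0)%BZ [:: 1; 2; 3]%N ->
      evb v x (frame_coord a b (dt i j k)) =
      12 * bform (edge_form a b) v x / zr R (dt i j k).
    by move=> /(evb_frame_coord x) <-; rewrite mulrC mulKf.
  rewrite /evb !ev_add !ev_mul -/(evb v x) !cE ?e1 ?e2 ?e3.
  - by rewrite ![zr R _ * bary1 _ _]mulrC ![zr R _ * bary2 _ _]mulrC
      ![zr R _ * bary3 _ _]mulrC !mulfK// addrA.
  - by apply/allP => s /dv /and3P[].
  - by apply/allP => s /dv /and3P[].
  - by apply/allP => s /dv /and3P[].
move=> l lK; have [/= lijk|lijk] := boolP (l \in [:: i; j; k]).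
  have [z1 z2 z3] := dt_same i j; have [y1 y2 y3] := dt_same i k.
  have [w1 w2 w3] := dt_same j k; have [u1 u2 u3] := dt_same j i.
  have [s1 s2 s3] := dt_same k i; have [r1 r2 r3] := dt_same k j.
  move: lijk; rewrite !inE => /or3P[] /eqP ->.
  - by rewrite y1 z2 zr0; ring.
  - by rewrite w1 u3 zr0; ring.
  - by rewrite r2 s3 zr0; ring.
have := dep l; rewrite mem_filter lijk mem_undup => /(_ lK).
by move=> /(ev_eq (bary1 v x) (bary2 v x)); rewrite !ev_scale !ev_add !ev_scale addrA.
Qed.

Lemma sum_at (g : nat -> R) i (a : R) : (1 <= i <= 10)%N ->
  \sum_(1 <= j < 11) (if j == i then a else 0) * g j = a * g i.
Proof.
move=> /andP[i1 i10]; rewrite (bigD1_seq i) ?iota_uniq ?mem_index_iota ?i1//=.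
by rewrite eqxx big1 ?addr0// => j /negPf ->; rewrite mul0r.
Qed.

Lemma admissible_exists K x i j k : labels_ok [:: i; j; k] ->
  ~~ (dt i j k =? 0)%BZ -> i \in K -> j \in K -> k \in K ->
  admissible K x (affine_coords v K x).
Proof.
move=> lab D0 iK jK kK.
set t := subtri v [:: i; j; k].
pose at1 (l : nat) (a : R) j := if j == l then a else 0.
pose b l := at1 i (bary1 t x) l + at1 j (bary2 t x) l + at1 k (bary3 t x) l.
rewrite /affine_coords.
suff adm : admissible K x b by apply: (@xgetPex _ (fun=> 0) (admissible K x)); exists b.
have /and4P[il jl kl _] := lab.
have bsum g : \sum_(1 <= l < 11) b l * g l =
    bary1 t x * g i + bary2 t x * g j + bary3 t x * g k.
  rewrite -(sum_at g _ il) -(sum_at g _ jl) -(sum_at g _ kl) -!big_split /=.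
  by apply: eq_bigr => l _; rewrite !mulrDl.
split.
- move=> l lK; have ne p : p \in K -> (l == p) = false.
    by move=> pK; apply: contraNF lK => /eqP ->.
  by rewrite /b /at1 !ne// !addr0.
- have := bsum (fun=> 1); rewrite !mulr1; under eq_bigr do rewrite mulr1.
  by move=> ->; rewrite /bary1; ring.
- rewrite [RHS](baryE x (subtri_nondegenerate lab D0)).
  apply: pair_eq.
    rewrite (raddf_sum (fst : R * R -> R)) /=.
    exact: (bsum (fun l => (vertex v l).1)).
  rewrite (raddf_sum (snd : R * R -> R)) /=.
  exact: (bsum (fun l => (vertex v l).2)).
Qed.

Lemma affine_coords_supp K x l : l \notin K -> affine_coords v K x l = 0.
Proof. by rewrite /affine_coords; case: xgetP => // b _ [b0 _ _]; exact: b0. Qed.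

(** Any admissible coefficients combine the values of the faces to the value of
    the piece. *)
Lemma admissible_sum c n Ks x K b : K \in Ks -> (pieces c n.+1 Ks).2 ->
  labels_ok K -> admissible K x b ->
  \sum_(1 <= l < 11) b l * piece_value c n (faces Ks) x (rem l K) =
  piece_value c n.+1 Ks x K.
Proof.
move=> KKs ok Kok adm; have := piece_value_step x KKs ok Kok.
have [b0 _ _] := adm.
case E : (frame c K) => [[[i j] k]|] [-> dep]; last first.
  apply: big1 => l _; have [/dep ->|/b0 ->] := boolP (l \in K).
    by rewrite mulr0.
  by rewrite mul0r.
have [iK jK kK /andP[D0 _]] := frameP E.
have lab : labels_ok [:: i; j; k] by move/allP : Kok => Kok; rewrite /= !Kok.
have zD0 : zr R (dt i j k) != 0 by rewrite zr_eq0.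
apply: (mulfI zD0); rewrite mulr_sumr.
set fi := piece_value _ _ _ _ (rem i K) in dep *.
set fj := piece_value _ _ _ _ (rem j K) in dep *.
set fk := piece_value _ _ _ _ (rem k K) in dep *.
transitivity (\sum_(1 <= l < 11) (b l * zr R (dt l j k) * fi
    + b l * zr R (dt i l k) * fj + b l * zr R (dt i j l) * fk)).
  apply: eq_bigr => l _; have [/dep lE|/b0 ->] := boolP (l \in K).
    by rewrite mulrCA lE !mulrDr !mulrA.
  by rewrite !mul0r mulr0 !addr0.
have [e1 e2 e3] := subtri_bary lab D0 x.
have F (g : nat -> R) l0 : (forall l, g l = zr R (dot3 l0 (wt l))) ->
    \sum_(1 <= l < 11) b l * g l = 12 * bform l0 v x.
  by move=> gE; rewrite (admissible_form _ Kok adm); apply: eq_bigr => l _; rewrite gE.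
rewrite !big_split /= -!mulr_suml.
rewrite (F _ (edge_form j k)); last by move=> l; have [->] := dt_edge l j k.
rewrite (F _ (edge_form k i)); last by move=> l; have [_ ->] := dt_edge i l k.
rewrite (F _ (edge_form i j)); last by move=> l; have [_ _ ->] := dt_edge i j l.
by rewrite e1 e2 e3; ring.
Qed.

Lemma covers_bary c x i j k : labels_ok c -> in_cell c x ->
  labels_ok [:: i; j; k] -> covers c (i, j, k) ->
  let t := subtri v [:: i; j; k] in
  [/\ 0 <= bary1 t x, 0 <= bary2 t x & 0 <= bary3 t x].
Proof.
move=> cok cx lab /andP[D0 /allP cov].
have zD0 : zr R (dt i j k) != 0 by rewrite zr_eq0.
have [e1 e2 e3] := subtri_bary lab D0 x.
have sgn l y : 12 * bform l v x = zr R (dt i j k) * y ->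
    (forall u, u \in c -> (0 <=? dt i j k * dot3 l (wt u))%BZ) -> 0 <= y.
  move=> lE lc; rewrite -(@pmulr_rge0 _ (zr R (dt i j k) ^+ 2)); last first.
    by rewrite lt_neqAle sqr_ge0 eq_sym expf_neq0.
  have -> : zr R (dt i j k) ^+ 2 * y = 12 * (zr R (dt i j k) * bform l v x).
    by rewrite expr2 -mulrA -lE; ring.
  case: l lE lc => [[a b] d] lE lc.
  have := @cell_form_ge0 c x (dt i j k * a, dt i j k * b, dt i j k * d)%BZ cok cx.
  have -> : bform (dt i j k * a, dt i j k * b, dt i j k * d)%BZ v x =
      zr R (dt i j k) * bform (a, b, d) v x.
    by rewrite /bform !zrM; ring.
  move=> H; rewrite mulr_ge0 ?ler0n// H// => u uc.
  have := lc u uc; case: (wt u) => [[p q] r]; rewrite /dot3.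
  by rewrite !Z.mul_add_distr_l !Z.mul_assoc.
split.
- apply: sgn e1 _ => u uc; have [-> _ _] := dt_edge u j k.
  by have /and3P[] := cov u uc.
- apply: sgn e2 _ => u uc; have [_ -> _] := dt_edge i u k.
  by have /and3P[] := cov u uc.
- apply: sgn e3 _ => u uc; have [_ _ ->] := dt_edge i j u.
  by have /and3P[] := cov u uc.
Qed.

(** On its cell a piece is nonnegative, as the recursion with the frame only
    involves nonnegative coefficients. *)
Lemma piece_value_ge0 c n Ks x : labels_ok c -> in_cell c x ->
  all labels_ok Ks -> (pieces c n Ks).2 -> forall K, K \in Ks ->
  0 <= piece_value c n Ks x K.
Proof.
move=> cok cx; elim: n Ks => [|n IH] Ks Ksok ok K KKs.
  rewrite /piece_value /= look_map// /base_piece; case: (frame c K) => [[[i j] k]|].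
    rewrite /evb ev_cst zr_ge0//; apply/Z.leb_le.
    have := Z.abs_nonneg (dt i j k); case: (Z.abs (dt i j k)) => [|p|p] //.
    by move=> _; apply: Z.div_pos; lia.
  by rewrite /evb ev_cst.
have Kok := allP Ksok _ KKs; have := piece_value_step x KKs ok Kok.
case E : (frame c K) => [[[i j] k]|] [-> _] //.
have [iK jK kK cov] := frameP E.
have lab : labels_ok [:: i; j; k] by move/allP : Kok => Kok; rewrite /= !Kok.
have [t1 t2 t3] := covers_bary cok cx lab cov.
have okn : (pieces c n (faces Ks)).2.
  by move: ok => /=; case: (pieces c n (faces Ks)) => ? ? /= /andP[].
have ge0 l : l \in K -> 0 <= piece_value c n (faces Ks) x (rem l K).
  by move=> lK; apply: IH => //; [exact: faces_ok|exact: mem_faces].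
by rewrite !addr_ge0// mulr_ge0// ge0.
Qed.

(** Either the cell lies in the triangle [K], where the value is the ratio of the
    areas, or a line separates the open cell from the hull of [K]. *)
Lemma base_value c x K : labels_ok c -> in_open_cell c x -> labels_ok K ->
  base_ok c K ->
  simplex_spline_rec v 0 K x = evb v x (base_piece c K).
Proof.
move=> cok cx Kok; rewrite /base_ok /base_piece /=.
case E : (frame c K) => [[[i j] k]|].
  move=> /andP[/eqP KE dv]; have [iK jK kK cov] := frameP E.
  have lab : labels_ok [:: i; j; k] by rewrite -KE.
  have /andP[D0 _] := cov.
  rewrite (negbTE (area_chull_neq0 ndv Kok iK jK kK D0)) KE area_ratio//.
  have xK : chull v [:: i; j; k] x.
    rewrite chull_subtri; apply/(triangleP _ (subtri_nondegenerate lab D0)).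
    exact: covers_bary (open_cellW cx) lab cov.
  rewrite indicE mem_set// mul1r /evb ev_cst -zr_abs.
  have z0 : zr R (Z.abs (dt i j k)) != 0 by rewrite zr_abs normr_eq0 zr_eq0.
  apply: (mulfI z0); rewrite zr_div// mulrCA mulfV// mulr1.
  by rewrite /zr /=; ring.
move=> /hasP[[p q] _ /and3P[/allP Kn /allP cn cp]].
have xK : ~ chull v K x.
  move=> [d [d0 d1 dx]].
  have : 0 < bform (edge_form p q) v x.
    apply: (cell_form_gt0 cok cx) => [u uc|].
      by have [_ _ ->] := dt_edge p q u; exact: cn.
    by apply: sub_has cp => u; have [_ _ ->] := dt_edge p q u.
  apply/negP; rewrite -leNgt -(@pmulr_rle0 _ 12) ?ltr0n//.
  have szK : size [seq vertex v k | k <- K] = size K by rewrite size_map.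
  have dx' : x = \sum_(i <- enum 'I_(size [seq vertex v k | k <- K]))
      d i *: vertex v (nth 0%N K i).
    rewrite dx big_enum /=; apply: eq_bigr => i _.
    by rewrite (nth_map 0%N)// -szK.
  have mK (i : 'I_(size [seq vertex v k | k <- K])) : nth 0%N K i \in K.
    by rewrite mem_nth// -szK.
  rewrite (form_comb _ _ _ dx'); last by rewrite big_enum.
    rewrite sumr_le0// => i _; rewrite mulr_ge0_le0// zr_le0//.
    by have [_ _ ->] := dt_edge p q (nth 0%N K i); exact/Kn/mK.
  by move=> i _ _; exact/(allP Kok)/mK.
rewrite indicE memNset// mul0r; case: ifP => _; by rewrite /evb ev_cst.
Qed.

(** By induction on the size of [K]: the coefficients chosen by the recursion
    are admissible, hence combine the pieces of the faces to the piece of [K].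
    When the hull has no area, no triangle with corners in [K] surrounds the
    cell, and the piece vanishes. *)
Lemma rec_value c n Ks x : labels_ok c -> in_open_cell c x ->
  all labels_ok Ks -> (pieces c n Ks).2 -> forall K, K \in Ks ->
  simplex_spline_rec v n K x = piece_value c n Ks x K.
Proof.
move=> cok cx; elim: n Ks => [|n IH] Ks Ksok ok K KKs.
  have Kok := allP Ksok _ KKs.
  rewrite /piece_value look_map//.
  by apply: base_value => //; exact: (allP ok).
have Kok := allP Ksok _ KKs.
have okn : (pieces c n (faces Ks)).2.
  by move: ok => /=; case: (pieces c n (faces Ks)) => ? ? /= /andP[].
have IHK l : l \in K -> simplex_spline_rec v n (rem l K) x =
    piece_value c n (faces Ks) x (rem l K).
  by move=> lK; apply: IH => //; [exact: faces_ok|exact: mem_faces].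
have := piece_value_step x KKs ok Kok.
case E : (frame c K) => [[[i j] k]|] => [_|[-> f0]].
  have [iK jK kK /andP[D0 _]] := frameP E.
  have lab : labels_ok [:: i; j; k] by move/allP : Kok => Kok; rewrite /= !Kok.
  have adm := admissible_exists x lab D0 iK jK kK.
  have [b0 _ _] := adm.
  rewrite -(admissible_sum KKs ok Kok adm) /=.
  rewrite (negbTE (area_chull_neq0 ndv Kok iK jK kK D0)).
  apply: eq_bigr => l _; have [/IHK ->//|/b0 ->] := boolP (l \in K).
  by rewrite !mul0r.
rewrite /=; case: ifP => // _; apply: big1 => l _.
have [lK|lK] := boolP (l \in K); first by rewrite IHK// f0// mulr0.
by rewrite affine_coords_supp// mul0r.
Qed.

End recursion.

(** * Functions of class C^n on the plane *)

Section smoothness.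
Variable R : realType.
Implicit Types (f g : R * R -> R) (x v : R * R).

(** Partial derivatives are derivatives of functions of one variable. *)
Lemma is_derive_line f x v (d : R) :
  is_derive (0 : R) (1 : R) (fun s => f (s *: v + x)) d -> is_derive x v f d.
Proof.
move=> [df dE].
have E : (fun h : R => h^-1 *: (f (h *: v + x) - f x)) =
    (fun h : R => h^-1 *: ((fun s => f (s *: v + x)) (h *: (1 : R) + 0)
      - (fun s => f (s *: v + x)) 0)).
  have sc (h : R) : h *: (1 : R) = h by exact: mulr1.
  by apply/funext => h; rewrite addr0 sc scale0r add0r.
by split; rewrite /derivable /derive /= E.
Qed.

(** For functions given by cases, it is easier to bound the remainder than to
    take a limit at the points where the cases meet. *)
Lemma is_derive_quadratic (g : R -> R) (t d K : R) :
  (forall h, `|g (t + h) - g t - h * d| <= K * h ^+ 2) -> is_derive t (1 : R) g d.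
Proof.
move=> gK.
have lim0 : h^-1 *: (g (h *: (1 : R) + t) - g t) @[h --> 0^'] --> d.
  apply/cvgrPdist_le => e e0.
  have K0 : 0 < `|K| + 1 by rewrite ltr_wpDl.
  near=> h; have h0 : h != 0 by near: h; exact: nbhs_dnbhs_neq.
  have hn0 : 0 < `|h| by rewrite normr_gt0.
  rewrite distrC -(ler_pM2r hn0) -normrM mulrBl [h^-1 *: _ * h]mulrAC.
  rewrite mulVf// mul1r [d * h]mulrC.
  have -> : h *: (1 : R) = h by exact: mulr1.
  rewrite [h + t]addrC (le_trans (gK h))// -(real_normK (num_real h)) expr2 mulrA.
  rewrite ler_pM2r// (@le_trans _ _ ((`|K| + 1) * `|h|))//.
    by rewrite ler_wpM2r// ler_wpDr// ler_norm.
  rewrite mulrC -ler_pdivlMr//; apply: ltW; near: h.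
  apply: dnbhs0_lt; exact: divr_gt0.
split; first by apply/cvg_ex; exists d.
exact: cvg_lim lim0.
Unshelve. all: by end_near. Qed.

Lemma Ck0 f : Ck 0 f <-> continuous f.
Proof. by split=> // -[]. Qed.

Lemma CkS n f : Ck n.+1 f <-> continuous f /\
  [/\ forall x, derivable f x (dir1 R), forall x, derivable f x (dir2 R),
      Ck n (fun x => 'D_(dir1 R) f x) & Ck n (fun x => 'D_(dir2 R) f x)].
Proof. exact: iff_refl. Qed.

Lemma Ck_step m f f1 f2 :
  continuous f -> (forall x, is_derive x (dir1 R) f (f1 x)) ->
  (forall x, is_derive x (dir2 R) f (f2 x)) -> Ck m f1 -> Ck m f2 -> Ck m.+1 f.
Proof.
move=> cf d1 d2 c1 c2; apply/CkS; split=> //; split.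
- by move=> x; have [] := d1 x.
- by move=> x; have [] := d2 x.
- by have -> : (fun x => 'D_(dir1 R) f x) = f1; first by apply/funext => x; have [] := d1 x.
- by have -> : (fun x => 'D_(dir2 R) f x) = f2; first by apply/funext => x; have [] := d2 x.
Qed.

Lemma Ck_continuous n f : Ck n f -> continuous f.
Proof. by case: n => [|n] []. Qed.

Lemma Ck_pred n f : Ck n.+1 f -> Ck n f.
Proof.
elim: n f => [|n IH] f /CkS[cf [d1 d2 c1 c2]]; first by [].
by apply/CkS; split=> //; split=> //; exact: IH.
Qed.

Lemma Ck_derivable n f : Ck n.+1 f ->
  (forall x, is_derive x (dir1 R) f ('D_(dir1 R) f x)) *
  (forall x, is_derive x (dir2 R) f ('D_(dir2 R) f x)).
Proof. by move=> /CkS[_ [d1 d2 _ _]]; split=> x; split. Qed.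

Lemma Ck_cst n (c : R) : Ck n (fun=> c).
Proof.
elim: n c => [|n IH] c; first by split=> //; exact: cst_continuous.
by apply: (@Ck_step _ _ (fun=> 0) (fun=> 0)) => //; exact: cst_continuous.
Qed.

Lemma continuous_add f g : continuous f -> continuous g ->
  continuous (fun x => f x + g x).
Proof. by move=> cf cg x; apply: continuousD; [exact: cf|exact: cg]. Qed.

Lemma continuous_mul f g : continuous f -> continuous g ->
  continuous (fun x => f x * g x).
Proof. by move=> cf cg x; apply: continuousM; [exact: cf|exact: cg]. Qed.

Lemma CkD n f g : Ck n f -> Ck n g -> Ck n (fun x => f x + g x).
Proof.
elim: n f g => [|n IH] f g cf cg.
  by move: cf cg => /Ck0 cf /Ck0 cg; apply/Ck0; exact: continuous_add.
have [_ [_ _ f1 f2]] := (CkS n f).1 cf; have [_ [_ _ g1 g2]] := (CkS n g).1 cg.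
apply: (@Ck_step _ _ (fun x => 'D_(dir1 R) f x + 'D_(dir1 R) g x)
  (fun x => 'D_(dir2 R) f x + 'D_(dir2 R) g x)).
- exact: (continuous_add (Ck_continuous cf) (Ck_continuous cg)).
- move=> x; apply: (@is_deriveD _ _ _ f g);
    [exact: (Ck_derivable cf).1|exact: (Ck_derivable cg).1].
- move=> x; apply: (@is_deriveD _ _ _ f g);
    [exact: (Ck_derivable cf).2|exact: (Ck_derivable cg).2].
- exact: IH.
- exact: IH.
Qed.

Lemma CkM n f g : Ck n f -> Ck n g -> Ck n (fun x => f x * g x).
Proof.
elim: n f g => [|n IH] f g cf cg.
  by move: cf cg => /Ck0 cf /Ck0 cg; apply/Ck0; exact: continuous_mul.
have [_ [_ _ f1 f2]] := (CkS n f).1 cf; have [_ [_ _ g1 g2]] := (CkS n g).1 cg.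
have [cf' cg'] := (Ck_pred cf, Ck_pred cg).
apply: (@Ck_step _ _ (fun x => f x * 'D_(dir1 R) g x + g x * 'D_(dir1 R) f x)
  (fun x => f x * 'D_(dir2 R) g x + g x * 'D_(dir2 R) f x)).
- exact: (continuous_mul (Ck_continuous cf) (Ck_continuous cg)).
- move=> x; apply: (@is_deriveM _ _ f g);
    [exact: (Ck_derivable cf).1|exact: (Ck_derivable cg).1].
- move=> x; apply: (@is_deriveM _ _ f g);
    [exact: (Ck_derivable cf).2|exact: (Ck_derivable cg).2].
- by apply: CkD; exact: IH.
- by apply: CkD; exact: IH.
Qed.

Lemma Ck_sum n (I : Type) (s : seq I) (F : I -> R * R -> R) :
  (forall i, Ck n (F i)) -> Ck n (fun x => \sum_(i <- s) F i x).
Proof.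
move=> CF; elim: s => [|i s IH].
  by under eq_fun do rewrite big_nil; exact: Ck_cst.
by under eq_fun do rewrite big_cons; exact: CkD.
Qed.

Lemma affine_continuous f : affine f -> continuous f.
Proof.
move=> [a [b [c fE]]]; have -> : f = fun x => a * x.1 + b * x.2 + c.
  exact/funext.
move=> x; apply: cvgD; last exact: cvg_cst.
apply: cvgD; apply: cvgM; [exact: cvg_cst|exact: cvg_fst|exact: cvg_cst|exact: cvg_snd].
Qed.

(** Composition of an affine function with a function of one variable that has
    the successive derivatives [h 1, ..., h n]. *)
Lemma Ck_comp_affine n (h : nat -> R -> R) f : affine f ->
  (forall k, (k < n)%N -> forall t, is_derive t (1 : R) (h k) (h k.+1 t)) ->
  continuous (h n) -> Ck n (h 0%N \o f).
Proof.
move=> af; have cf := affine_continuous af.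
elim: n h => [|n IH] h dh ch.
  by apply/Ck0 => x; apply: continuous_comp; [exact: cf|exact: ch].
have ch0 : continuous (h 0%N).
  move=> t; apply: differentiable_continuous; apply/derivable1_diffP.
  by have [] := dh 0%N isT t.
have [a [b [c fE]]] := af.
have chain (u : R * R) (d : R) : (forall (s : R) x, f (s *: u + x) = d * s + f x) ->
    forall x, is_derive x u (h 0%N \o f) (d * h 1%N (f x)).
  move=> ud x; apply: is_derive_line.
  have -> : (fun s => (h 0%N \o f) (s *: u + x)) = h 0%N \o (fun s => d * s + f x).
    by apply/funext => s /=; rewrite ud.
  rewrite mulrC; apply: is_derive1_comp; first by rewrite mulr0 add0r; exact: dh.
  by apply: (@is_derive_quadratic _ _ _ 0) => s; rewrite mul0r normr_le0; apply/eqP; ring.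
have Ch1 : Ck n (h 1%N \o f).
  by apply: (IH (fun k => h k.+1)) => // k kn; exact: dh.
apply: (@Ck_step _ _ (fun x => a * h 1%N (f x)) (fun x => b * h 1%N (f x))).
- by move=> x; apply: continuous_comp; [exact: cf|exact: ch0].
- by apply: chain => s x; rewrite !fE !coordE /=; ring.
- by apply: chain => s x; rewrite !fE !coordE /=; ring.
- by apply: CkM => //; exact: Ck_cst.
- by apply: CkM => //; exact: Ck_cst.
Qed.

Lemma Ck_affine n f : affine f -> Ck n f.
Proof.
move=> af; have := @Ck_comp_affine n (fun k => nth (cst 0) [:: id; cst 1] k) f af.
apply.
- move=> [|[|k]] _ t; rewrite /= ?nth_nil;
    [exact: is_derive_id|exact: is_derive_cst|exact: is_derive_cst].
- case: n => [|[|n]] t; rewrite /= ?nth_nil; [exact: cvg_id|exact: cvg_cst|exact: cvg_cst].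
Qed.

Definition relu (t : R) : R := Num.max t 0.

Lemma relu_cases t : (0 <= t /\ relu t = t) \/ (t <= 0 /\ relu t = 0).
Proof.
rewrite /relu; have [t0|/ltW t0] := leP t 0; last by left.
by right.
Qed.

Lemma relu_continuous : continuous relu.
Proof.
move=> t; apply: (@continuous_max _ _ id (cst 0)); [exact: cvg_id|exact: cvg_cst].
Qed.

Lemma relu_derive k t : (0 < k)%N ->
  is_derive t (1 : R) (fun s => relu s ^+ k.+1) (k.+1%:R * relu t ^+ k).
Proof.
elim: k => // -[_ _|k IH _].
  rewrite expr1; apply: (@is_derive_quadratic _ _ _ 1) => h; rewrite mul1r ler_norml.
  have := sqr_ge0 h.
  case: (relu_cases (t + h)) => -[h1 ->]; case: (relu_cases t) => -[h2 ->];
    rewrite ?expr2 => h0; apply/andP; split; nra.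
have E (n : nat) s : s * relu s ^+ n.+1 = relu s ^+ n.+2.
  by case: (relu_cases s) => -[_ ->]; rewrite ?expr0n ?mulr0// -exprS.
have -> : (fun s => relu s ^+ k.+3) = id * (fun s => relu s ^+ k.+2).
  by apply/funext => s; rewrite -E.
apply: is_derive_eq; first by apply: is_deriveM; exact: IH.
rewrite /GRing.scale /= mulr1 mulrCA E -[X in _ + X]mul1r -mulrDl; congr (_ * _).
by rewrite -[RHS]natr1.
Qed.

Lemma Ck_relu4 f : affine f -> Ck 3 (fun x => relu (f x) ^+ 4).
Proof.
move=> af.
pose h := nth (fun t => 24 * relu t) [:: fun t => relu t ^+ 4;
  fun t => 4 * relu t ^+ 3; fun t => 12 * relu t ^+ 2].
apply: (@Ck_comp_affine 3 h f af).
  have dZ (c d : R) (q : R -> R) (t : R) : is_derive t (1 : R) q d ->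
      is_derive t (1 : R) (fun s : R => c * q s) (c * d).
    exact: is_deriveZ.
  move=> [|[|[|//]]] _ t; rewrite /h /=.
  - exact: relu_derive.
  - by rewrite (_ : 12 * _ = 4 * (3%:R * relu t ^+ 2)); [exact/dZ/relu_derive|ring].
  - by rewrite (_ : 24 * _ = 12 * (2%:R * relu t ^+ 1)); [exact/dZ/relu_derive|ring].
move=> t; apply: (@continuousM R R (cst 24) relu t); first exact: cst_continuous.
exact: relu_continuous.
Qed.

End smoothness.

(** * The simplex splines as truncated powers *)

Section splines.
Variable R : realType.
Variable v : 'I_3 -> R * R.
Hypothesis ndv : nondegenerate_triangle v.

Lemma cells_ok c : c \in split12 -> [&& labels_ok c, uniq c & size c == 3%N].
Proof. by move: c; apply/allP; vm_compute. Qed.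

Lemma cell_of_corners c0 c1 c2 (a0 a1 a2 : R) x : uniq [:: c0; c1; c2] ->
  0 <= a0 -> 0 <= a1 -> 0 <= a2 -> a0 + a1 + a2 = 1 ->
  x = a0 *: vertex v c0 + a1 *: vertex v c1 + a2 *: vertex v c2 ->
  in_cell v [:: c0; c1; c2] x.
Proof.
rewrite /= !inE negb_or => /and3P[/andP[n01 n02] n12 _] a0p a1p a2p a1E xE.
pose t u := if u == c0 then a0 else if u == c1 then a1 else a2.
have [t0 t1 t2] : [/\ t c0 = a0, t c1 = a1 & t c2 = a2].
  by rewrite /t !eqxx ![c1 == _]eq_sym ![c2 == _]eq_sym (negPf n01) (negPf n02) (negPf n12).
exists t; first by rewrite /on_cell !big_cons !big_nil t0 t1 t2 !addr0 !addrA.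
by move=> u _; rewrite /t; do 2?case: ifP.
Qed.

(** Sorting the barycentric coordinates and comparing the largest one with 1/2
    finds the cell of a point. *)
Lemma cell_cover x : triangle v x -> exists2 c, c \in split12 & in_cell v c x.
Proof.
move=> /(triangleP _ ndv)[b1_ge0 b2_ge0 b3_ge0]; rewrite [x](baryE x ndv).
have s1 : bary1 v x + bary2 v x + bary3 v x = 1 by rewrite /bary1; ring.
move: (bary1 v x) (bary2 v x) (bary3 v x) b1_ge0 b2_ge0 b3_ge0 s1.
move=> p q r p0 q0 r0 s1.
pose y := p *: v 0 + q *: v 1 + r *: v 2.
(* [a >= b >= d] are the sorted coordinates: the corners of the cell are a
   vertex of the triangle, the middle of an edge and one of [v_7, v_8, v_9]. *)
have outer c0 c1 c2 (a b d : R) : uniq [:: c0; c1; c2] ->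
    0 <= d -> d <= b -> b + d <= a -> a + b + d = 1 ->
    y = (a - b - d) *: vertex v c0 + (2 * (b - d)) *: vertex v c1
      + (4 * d) *: vertex v c2 -> in_cell v [:: c0; c1; c2] y.
  move=> uc d0 db bda abd; apply: cell_of_corners => //; lra.
have inner c0 c1 (a b d : R) : uniq [:: c0; c1; 10%N] ->
    0 <= d -> d <= b -> b <= a -> a <= b + d -> a + b + d = 1 ->
    y = (2 * (b - d)) *: vertex v c0 + (4 * (a - b)) *: vertex v c1
      + (3 * (b + d - a)) *: vertex v 10 -> in_cell v [:: c0; c1; 10%N] y.
  move=> uc d0 db ba abd1 abd; apply: cell_of_corners => //; lra.
have [s2 s3 s4 s5 s6] : [/\ q + p + r = 1, p + r + q = 1, q + r + p = 1,
  r + p + q = 1 & r + q + p = 1] by split; rewrite -s1; ring.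
have dec (a b c : R) : a <= b + c \/ b + c <= a.
  by have [|/ltW] := leP a (b + c); [left|right].
have [pq|/ltW qp] := leP p q; have [qr|/ltW rq] := leP q r; have [pr|/ltW rp] := leP p r.
- case: (dec r q p) => h.
    exists [:: 5; 9; 10]%N => //; apply: (inner _ _ r q p) => //.
    by apply: pair_eq; rewrite /y /vertex /= /GRing.scale /=; field.
  exists [:: 3; 5; 9]%N => //; apply: (outer _ _ _ r q p) => //.
  by apply: pair_eq; rewrite /y /vertex /= /GRing.scale /=; field.
- case: (dec r q p) => h.
    exists [:: 5; 9; 10]%N => //; apply: (inner _ _ r q p) => //.
    by apply: pair_eq; rewrite /y /vertex /= /GRing.scale /=; field.
  exists [:: 3; 5; 9]%N => //; apply: (outer _ _ _ r q p) => //.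
  by apply: pair_eq; rewrite /y /vertex /= /GRing.scale /=; field.
- case: (dec q r p) => h.
    exists [:: 5; 8; 10]%N => //; apply: (inner _ _ q r p) => //.
    by apply: pair_eq; rewrite /y /vertex /= /GRing.scale /=; field.
  exists [:: 2; 5; 8]%N => //; apply: (outer _ _ _ q r p) => //.
  by apply: pair_eq; rewrite /y /vertex /= /GRing.scale /=; field.
- case: (dec q p r) => h.
    exists [:: 4; 8; 10]%N => //; apply: (inner _ _ q p r) => //.
    by apply: pair_eq; rewrite /y /vertex /= /GRing.scale /=; field.
  exists [:: 2; 4; 8]%N => //; apply: (outer _ _ _ q p r) => //.
  by apply: pair_eq; rewrite /y /vertex /= /GRing.scale /=; field.
- case: (dec r p q) => h.
    exists [:: 6; 9; 10]%N => //; apply: (inner _ _ r p q) => //.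
    by apply: pair_eq; rewrite /y /vertex /= /GRing.scale /=; field.
  exists [:: 3; 6; 9]%N => //; apply: (outer _ _ _ r p q) => //.
  by apply: pair_eq; rewrite /y /vertex /= /GRing.scale /=; field.
- case: (dec p r q) => h.
    exists [:: 6; 7; 10]%N => //; apply: (inner _ _ p r q) => //.
    by apply: pair_eq; rewrite /y /vertex /= /GRing.scale /=; field.
  exists [:: 1; 6; 7]%N => //; apply: (outer _ _ _ p r q) => //.
  by apply: pair_eq; rewrite /y /vertex /= /GRing.scale /=; field.
- case: (dec p q r) => h.
    exists [:: 4; 7; 10]%N => //; apply: (inner _ _ p q r) => //.
    by apply: pair_eq; rewrite /y /vertex /= /GRing.scale /=; field.
  exists [:: 1; 4; 7]%N => //; apply: (outer _ _ _ p q r) => //.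
  by apply: pair_eq; rewrite /y /vertex /= /GRing.scale /=; field.
- case: (dec p q r) => h.
    exists [:: 4; 7; 10]%N => //; apply: (inner _ _ p q r) => //.
    by apply: pair_eq; rewrite /y /vertex /= /GRing.scale /=; field.
  exists [:: 1; 4; 7]%N => //; apply: (outer _ _ _ p q r) => //.
  by apply: pair_eq; rewrite /y /vertex /= /GRing.scale /=; field.
Qed.

Lemma zr_inj (a b : Z) : zr R a = zr R b -> a = b.
Proof.
move=> ab; have : zr R (a - b) == 0 by rewrite zrB ab subrr.
by rewrite zr_eq0 => /Z.eqb_eq; lia.
Qed.

Lemma vertex_inj i j : (1 <= i <= 10)%N -> (1 <= j <= 10)%N ->
  vertex v i = vertex v j -> i = j.
Proof.
move=> i10 j10 ij.
have [a1 a2 a3] := bary_vertex ndv i10; have [b1 b2 b3] := bary_vertex ndv j10.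
move: a1 a2 a3; rewrite ij b1 b2 b3 => /zr_inj e1 /zr_inj e2 /zr_inj e3.
have wE : wt i = wt j by move: e1 e2 e3; case: (wt i) (wt j) => [[? ?] ?] [[? ?] ?] /= -> -> ->.
have dist : all (fun i => all (fun j => (i == j) || ~~ [&& Z.eqb (wt i).1.1 (wt j).1.1,
    Z.eqb (wt i).1.2 (wt j).1.2 & Z.eqb (wt i).2 (wt j).2]) (iota 1 10)) (iota 1 10).
  by vm_compute.
move/allP: dist => /(_ i); rewrite mem_iota => /(_ i10)/allP/(_ j).
by rewrite mem_iota => /(_ j10); rewrite wE !Z.eqb_refl /= orbF => /eqP.
Qed.

(** A boundary point of a cell lies on a line through two of its corners. *)
Lemma off_lines_cell c x : c \in split12 -> in_cell v c x -> off_lines v x ->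
  in_open_cell v c x.
Proof.
move=> /cells_ok/and3P[cok + +] [t [t1 tx] t0] offx.
case: c cok t1 tx t0 => [|c0 [|c1 [|c2 []]]] //= /and4P[l0 l1 l2 _].
rewrite /on_cell !big_cons !big_nil !addr0 => t1 tx t0.
rewrite !inE negb_or => /and3P[/andP[n01 n02] n12 _] _.
have off a b : (1 <= a <= 10)%N -> (1 <= b <= 10)%N -> a != b -> t a + t b = 1 ->
    x = t a *: vertex v a + t b *: vertex v b -> False.
  move=> la lb ab tab xE; apply: (offx a b la lb _ (t b)); last first.
    by rewrite xE -tab addrK.
  by apply: contraNneq ab => /vertex_inj ->.
exists t => [|u uc]; first by rewrite /on_cell !big_cons !big_nil !addr0.
rewrite lt_neqAle t0// andbT eq_sym; apply/eqP => tu0.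
move: uc tu0; rewrite !inE => /or3P[] /eqP -> tu0.
- by apply: (off c1 c2) => //; [rewrite -t1 tu0 add0r|rewrite tx tu0 scale0r add0r].
- by apply: (off c0 c2) => //; [rewrite -t1 tu0 add0r|rewrite tx tu0 scale0r add0r].
- by apply: (off c0 c1) => //; [rewrite -t1 tu0 addr0|rewrite tx tu0 scale0r addr0].
Qed.

(** A point with this property lies on no line through two vertices. *)
Definition generic x : Prop := forall i j, (1 <= i <= 10)%N -> (1 <= j <= 10)%N ->
  i != j -> bform (edge_form i j) v x != 0.

Lemma generic_off_lines x : generic x -> off_lines v x.
Proof.
move=> gx i j i10 j10 vij t xE.
have ij : i != j by apply: contraNneq vij => ->.
have := gx i j i10 j10 ij; apply/negP; rewrite negbK.
rewrite -(mulrI_eq0 _ (@lregP R 12 _)) ?pnatr_eq0//.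
have := @form_comb _ _ ndv _ [:: i; j] id (fun l => if l == i then 1 - t else t) x (edge_form i j).
rewrite !big_cons !big_nil !addr0 eqxx eq_sym (negbTE ij) /= => ->.
- have [_ _ ->] := dt_edge i j i; have [_ _ ->] := dt_edge i j j.
  have [_ -> _] := dt_same i j; have [_ _ ->] := dt_same j i.
  by rewrite zr0 !mulr0 addr0.
- by move=> l; rewrite !inE => /orP[] /eqP ->.
- by ring.
- exact: xE.
Qed.

(** A point of the triangle with barycentric coordinates in a position general
    enough. *)
Definition generic_point : R * R :=
  (1 / 9) *: v 0 + (3 / 9) *: v 1 + (5 / 9) *: v 2.

Lemma generic_pointP : triangle v generic_point /\ generic generic_point.
Proof.
split.
  by apply/hull3P; exists (1 / 9), (3 / 9), (5 / 9); split=> //; lra.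
have chk : all (fun i => all (fun j => (i == j) ||
    ~~ (dot3 (edge_form i j) (1, 3, 5)%BZ =? 0)%BZ) (iota 1 10)) (iota 1 10).
  by vm_compute.
move=> i j i10 j10 ij.
move/allP: chk => /(_ i); rewrite mem_iota => /(_ i10)/allP/(_ j).
rewrite mem_iota => /(_ j10); rewrite (negbTE ij) /= -(zr_eq0 R).
apply: contra_neq; have [[p0 p1 p2] [q0 q1 q2]] := bary_corners ndv.
have s1 : 1 / 9 + 3 / 9 + 5 / 9 = 1 :> R by field.
rewrite /generic_point affine3//; last exact: affine_bform.
case: (edge_form i j) => [[a b] d] /=.
rewrite /bform /bary1 p0 p1 p2 q0 q1 q2 !zrE.
have -> : zr R 1 = 1 by [].
have -> : zr R 3 = 3 by rewrite /zr /=; ring.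
have -> : zr R 5 = 5 by rewrite /zr /=; ring.
by move=> H; lra.
Qed.

Lemma near_avoid (a b : R) : b != 0 -> \forall s \near 0^'+, (1 - s) * a + s * b != 0.
Proof.
move=> b0; have [->|a0] := eqVneq a 0.
  by near=> s; rewrite mulr0 add0r mulf_neq0// gt_eqF//; near: s; exact: nbhs_right_gt.
near=> s; have s0 : 0 < s by near: s; exact: nbhs_right_gt.
apply/eqP => E; have : `|a| <= s * (`|a - b| + 1).
  have aE : a = s * (a - b) by lra.
  by rewrite {1}aE normrM (gtr0_norm s0) ler_pM2l// lerDl.
apply/negP; rewrite -ltNge -ltr_pdivlMr ?ltr_wpDl//; near: s.
by apply: nbhs_right_lt; rewrite divr_gt0 ?normr_gt0// ltr_wpDl.
Unshelve. all: by end_near. Qed.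

Definition toward x (s : R) : R * R := (1 - s) *: x + s *: generic_point.

Lemma toward_generic x : \forall s \near 0^'+, generic (toward x s).
Proof.
have H (ps : seq (nat * nat)) : \forall s \near 0^'+, forall p, p \in ps ->
    (1 <= p.1 <= 10)%N -> (1 <= p.2 <= 10)%N -> p.1 != p.2 ->
    bform (edge_form p.1 p.2) v (toward x s) != 0.
  elim: ps => [|[i j] ps IH]; first by near=> s.
  have Hij : \forall s \near 0^'+, (1 <= i <= 10)%N -> (1 <= j <= 10)%N -> i != j ->
      bform (edge_form i j) v (toward x s) != 0.
    case: (boolP [&& (1 <= i <= 10)%N, (1 <= j <= 10)%N & i != j]); last first.
      by move=> nc; near=> s => i10 j10 ij; rewrite i10 j10 ij in nc.
    move=> /and3P[i10 j10 ij]; have [_ /(_ i j i10 j10 ij) gij] := generic_pointP.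
    have := near_avoid (bform (edge_form i j) v x) gij; apply: filterS => s sE _ _ _.
    have [a [b [c fE]]] := affine_bform (edge_form i j) v.
    by apply: contra_neq sE => <-; rewrite !fE !coordE; ring.
  near=> s => p; rewrite inE => /orP[/eqP -> /=|pps]; first by near: s.
  by move: p pps; near: s.
have {}H := H [seq (i, j) | i <- iota 1 10, j <- iota 1 10].
near=> s; move=> i j i10 j10 ij.
have /(_ (i, j)) : forall p, p \in [seq (i, j) | i <- iota 1 10, j <- iota 1 10] ->
    (1 <= p.1 <= 10)%N -> (1 <= p.2 <= 10)%N -> p.1 != p.2 ->
    bform (edge_form p.1 p.2) v (toward x s) != 0 by near: s.
apply=> //; apply/allpairsP; exists (i, j); split=> //; by rewrite mem_iota.
Unshelve. all: by end_near. Qed.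

Lemma toward_cvg x : toward x s @[s --> 0^'+] --> x.
Proof.
have E : toward x 0 = x by rewrite /toward subr0 scale1r scale0r addr0.
rewrite -[X in _ --> X]E; apply: cvg_at_right_filter.
apply: (@continuousD _ _ _ (fun s : R => (1 - s) *: x) (fun s : R => s *: generic_point)).
  apply: (@continuousZr_tmp _ _ _ (fun s : R => 1 - s)).
  by apply: (@cvgB R R^o R (nbhs 0) _ (cst 1) id); [exact: cvg_cst|exact: cvg_id].
by apply: (@continuousZr_tmp R _ R id); exact: cvg_id.
Qed.

(** A point moved slightly towards the generic point avoids each of the lines,
    so the limit that defines the extension is not vacuous. *)
Lemma off_lines_proper x : triangle v x ->
  ProperFilter (within (triangle v `&` off_lines v) (nbhs x)).
Proof.
move=> Tx; split; last exact: within_filter.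
rewrite /within /= => near0.
have /(_ _ near0) : toward x s @[s --> 0^'+] --> x by exact: toward_cvg.
rewrite /= => {}near0.
suff : \forall s \near (0 : R)^'+, False by move/filter_ex => [].
near=> s.
have : ~ (triangle v `&` off_lines v) (toward x s) by near: s.
apply; split; last by apply: generic_off_lines; near: s; exact: toward_generic.
have [Tg _] := generic_pointP.
have s0 : 0 < s by near: s; exact: nbhs_right_gt.
have s1 : s < 1 by near: s; exact: nbhs_right_lt.
move/(triangleP _ ndv) : Tx => [x1 x2 x3]; move/(triangleP _ ndv) : Tg => [g1 g2 g3].
have aff f : affine f -> f (toward x s) = (1 - s) * f x + s * f generic_point.
  by move=> [a [b [c fE]]]; rewrite !fE !coordE; ring.
by apply/(triangleP _ ndv); rewrite !aff; first [split; nra|exact: affine_bary1|exact: affine_bary2|exact: affine_bary3].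
Unshelve. all: by end_near. Qed.

Lemma verified_parts :
  [/\ all (fun T => T.2.2) cell_tables,
      all (fun K => truncated_ok (piece K) (truncated K)) basis_knots,
      all (reproduces truncated) all_bases
    & all (fun c => all (fun l => nonneg_on c l.1 || nonpos_on c l.1) cut_lines)
          split12].
Proof. apply/and4P; exact verified_true. Qed.

Lemma basis_knots_ok : all (fun K => (size K == 8%N) && labels_ok K) basis_knots.
Proof. by vm_compute. Qed.

Lemma knots_labels : all labels_ok basis_knots.
Proof. by apply: sub_all basis_knots_ok => K /andP[]. Qed.

Lemma piece_in_map (g : seq nat -> table * bool) (cs : seq (seq nat)) K c :
  c \in cs -> piece_in [seq (d, g d) | d <- cs] K c = look (g c).1 K.
Proof.
move=> cs_c; rewrite /piece_in /unzip1 /unzip2 -!map_comp.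
have -> : map (fst \o (fun d => (d, g d))) cs = cs by rewrite -[RHS]map_id; exact: eq_map.
by rewrite (nth_map [::]) ?index_mem//= nth_index.
Qed.

Lemma truncated_in_map (g : seq nat -> zpoly * seq zpoly) (Ks : seq (seq nat)) K :
  K \in Ks -> truncated_in [seq (L, g L) | L <- Ks] K = g K.
Proof.
move=> KKs; rewrite /truncated_in /unzip1 /unzip2 -!map_comp.
have -> : map (fst \o (fun L => (L, g L))) Ks = Ks by rewrite -[RHS]map_id; exact: eq_map.
by rewrite (nth_map [::]) ?index_mem//= nth_index.
Qed.

Lemma pieceE c K x : c \in split12 ->
  evb v x (piece K c) = piece_value v c 5 basis_knots x K.
Proof. by move=> cS; rewrite /piece /cell_tables piece_in_map. Qed.

Lemma pieces_verified c : c \in split12 -> (pieces c 5 basis_knots).2.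
Proof.
have [+ _ _ _] := verified_parts; rewrite /cell_tables all_map => /allP H cS.
exact: H cS.
Qed.

Local Opaque pieces basis_knots cell_tables truncated piece.

(** A polynomial plus truncated fourth powers of the lines of the 12-split; it is
    defined and C^3 on the whole plane. *)
Definition truncated_eval (g : zpoly * seq zpoly) x : R :=
  evb v x g.1 +
  \sum_(lq <- zip cut_lines g.2) relu (bform lq.1.1 v x) ^+ 4 * evb v x lq.2.

(** A line of the split does not cut the cell, so on the cell the truncated
    power is either the full power or zero. *)
Lemma truncated_cell c x (P : zpoly) (g : zpoly * seq zpoly) :
  labels_ok c -> in_cell v c x ->
  all (fun l => nonneg_on c l.1 || nonpos_on c l.1) cut_lines ->
  peq P (padd g.1 (psum [seq if nonneg_on c lq.1.1
                             then pmul (pow4 (pform lq.1.1)) lq.2 else pcst 0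
                        | lq <- zip cut_lines g.2])) ->
  truncated_eval g x = evb v x P.
Proof.
move=> cok cx sg ok.
rewrite /truncated_eval /evb (ev_eq _ _ ok) ev_add ev_sum big_map; congr (_ + _).
elim: cut_lines g.2 sg {ok} => [|l ls IH] [|q qs] //; rewrite /= ?big_nil//.
move=> /andP[lc lsc]; rewrite !big_cons (IH _ lsc); congr (_ + _) => /=.
case: ifP lc => [/allP ln _|_ /= /allP ln].
  have lE : ev (bary1 v x) (bary2 v x) (pform l.1) = bform l.1 v x by exact: evb_form.
  rewrite ev_mul /pow4 !ev_mul lE.
  have : 0 <= bform l.1 v x by apply: cell_form_ge0 cok cx ln.
  by case: (relu_cases (bform l.1 v x)) => -[h ->] h'; [|have -> : bform l.1 v x = 0 by lra];
    ring.
have : bform l.1 v x <= 0.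
  case: (l.1) ln => [[a b] d] ln.
  have := @cell_form_ge0 _ _ ndv c x (- a, - b, - d)%BZ cok cx.
  have -> : bform (- a, - b, - d)%BZ v x = - bform (a, b, d) v x.
    by rewrite /bform !zrN; ring.
  rewrite oppr_ge0; apply => u uc; have := ln u uc.
  by case: (wt u) => [[w1 w2] w3]; rewrite /dot3 => /Z.leb_le h; apply/Z.leb_le; lia.
rewrite ev_cst zr0; case: (relu_cases (bform l.1 v x)) => -[h ->] h'.
  have -> : bform l.1 v x = 0 by lra.
  by rewrite expr0n mul0r.
by rewrite expr0n mul0r.
Qed.

(** The function that extends [Q[K]] from the triangle to the plane. *)
Definition spline_ext (K : seq nat) x : R := truncated_eval (truncated K) x.

Lemma spline_ext_cell c K x : c \in split12 -> K \in basis_knots -> in_cell v c x ->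
  spline_ext K x = piece_value v c 5 basis_knots x K.
Proof.
move=> cS KB cx; have [_ okB _ sgB] := verified_parts.
have /and3P[cok _ _] := cells_ok cS.
rewrite -(pieceE K x cS); apply: truncated_cell cok cx _ _.
  exact: (allP sgB c cS).
exact: (allP (allP okB K KB)).
Qed.

Lemma spline_ext_ge0 K x : K \in basis_knots -> triangle v x -> 0 <= spline_ext K x.
Proof.
move=> KB /cell_cover[c cS cx]; have /and3P[cok _ _] := cells_ok cS.
rewrite (spline_ext_cell cS KB cx).
exact: (piece_value_ge0 ndv cok cx knots_labels (pieces_verified cS) KB).
Qed.

Lemma simplex_spline_ext K x : K \in basis_knots -> triangle v x -> off_lines v x ->
  simplex_spline v K x = spline_ext K x.
Proof.
move=> KB /cell_cover[c cS cx] offx; have /and3P[cok _ _] := cells_ok cS.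
have /andP[/eqP szK _] := allP basis_knots_ok _ KB.
rewrite (spline_ext_cell cS KB cx) /simplex_spline szK.
exact: (rec_value ndv cok (off_lines_cell cS cx offx) knots_labels
  (pieces_verified cS) KB).
Qed.

Lemma jump_iter (l : seq R) (j : positive) :
  BinList.jump j l = iter (Pos.to_nat j) (@List.tl R) l.
Proof.
elim: j l => [j IH|j IH|] l; last by [].
  have -> : Pos.to_nat j~1 = (Pos.to_nat j + Pos.to_nat j).+1 by lia.
  by rewrite iterSr iterD -!IH.
have -> : Pos.to_nat j~0 = (Pos.to_nat j + Pos.to_nat j)%N by lia.
by rewrite iterD -!IH.
Qed.

Lemma Ck_ev n (P : zpoly) : Ck n (fun x => evb v x P).
Proof.
have gen (l : R * R -> seq R) :
    (forall k, Ck n (fun x => List.hd 0 (iter k (@List.tl R) (l x)))) ->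
    Ck n (fun x => Pphi 0 +%R *%R (zr R) (l x) P).
  elim: P l => [c|j Q IH|P1 IH1 i Q IH2] l Cl /=; first exact: Ck_cst.
    by apply: IH => k; under eq_fun do rewrite jump_iter -iterD; exact: Cl.
  apply: CkD; last by apply: IH2 => k; under eq_fun do rewrite -iterSr; exact: Cl.
  apply: CkM; first exact: IH1.
  by elim: i => [i IH|i IH|] /=; do ?apply: CkM; do ?exact: IH; exact: (Cl 0%N).
have tl_nil k : iter k (@List.tl R) [::] = [::] by elim: k => //= k ->.
apply: gen => -[|[|k]].
- by apply: Ck_affine; exact: affine_bary1.
- by apply: Ck_affine; exact: affine_bary2.
- by under eq_fun do rewrite !iterSr /= tl_nil; exact: Ck_cst.
Qed.

Lemma Ck_spline_ext K : Ck 3 (spline_ext K).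
Proof.
apply: CkD; first exact: Ck_ev.
apply: Ck_sum => lq; apply: CkM; last exact: Ck_ev.
by apply: Ck_relu4; exact: affine_bform.
Qed.

(** Off the lines both functions agree, and [spline_ext] is continuous. *)
Lemma simplex_splineTE K x : K \in basis_knots -> triangle v x ->
  simplex_splineT v K x = spline_ext K x.
Proof.
move=> KB Tx; have PF := off_lines_proper Tx.
apply: cvg_lim; first exact: Rhausdorff.
have near_eq : {near within (triangle v `&` off_lines v) (nbhs x),
    spline_ext K =1 simplex_spline v K}.
  apply: (@filterE _ (nbhs x)) => y [Ty offy].
  exact/esym/simplex_spline_ext.
apply: cvg_trans (near_eq_cvg near_eq) _.
have cK : continuous (spline_ext K) := Ck_continuous (Ck_spline_ext K).
by apply: cvg_within_filter; exact: cK.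
Qed.

End splines.

(** * Bivariate polynomials *)

Section bivariate.
Variable R : realType.

Implicit Types (p q : R * R -> R).

Lemma bipoly_ext d p q : (forall x, p x = q x) -> bipoly d p -> bipoly d q.
Proof. by move=> pq [c cE]; exists c => x; rewrite -pq. Qed.

Lemma bipolyD d p q : bipoly d p -> bipoly d q -> bipoly d (fun x => p x + q x).
Proof.
move=> [a aE] [b bE]; exists (fun i j => a i j + b i j) => x.
rewrite aE bE -big_split /=; apply: eq_bigr => i _; rewrite -big_split /=.
by apply: eq_bigr => j _; rewrite !mulrDl.
Qed.

Lemma bipolyZ d (k : R) p : bipoly d p -> bipoly d (fun x => k * p x).
Proof.
move=> [a aE]; exists (fun i j => k * a i j) => x; rewrite aE mulr_sumr.
by apply: eq_bigr => i _; rewrite mulr_sumr; apply: eq_bigr => j _; rewrite !mulrA.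
Qed.

Lemma bipoly0 d : bipoly d (fun=> 0 : R).
Proof.
exists (fun _ _ => 0) => x; rewrite big1// => i _; rewrite big1// => j _.
by rewrite !mul0r.
Qed.

Lemma bipoly_sum d (I : Type) (s : seq I) (F : I -> R * R -> R) :
  (forall i, bipoly d (F i)) -> bipoly d (fun x => \sum_(i <- s) F i x).
Proof.
move=> dF; elim: s => [|i s IH].
  by under eq_fun do rewrite big_nil; exact: bipoly0.
by under eq_fun do rewrite big_cons; exact: bipolyD.
Qed.

Lemma bipoly_mono d i j : (i + j <= d)%N ->
  bipoly d (fun x : R * R => x.1 ^+ i * x.2 ^+ j).
Proof.
move=> ijd; exists (fun k l => ((k == i) && (l == j))%:R) => x.
have id : (i < d.+1)%N by rewrite ltnS (leq_trans (leq_addr j i)).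
have jd : (j < d.+1)%N by rewrite ltnS (leq_trans (leq_addl i j)).
rewrite (bigD1 (Ordinal id))//= [X in _ + X]big1 ?addr0; last first.
  move=> k ki; apply: big1 => l _.
  by rewrite (_ : (k == i :> nat) = false) ?mul0r//; apply/negbTE.
rewrite (bigD1 (Ordinal jd))//= !eqxx big1 ?addr0 ?mul1r// => l /andP[_ lj].
by rewrite (_ : (l == j :> nat) = false) ?mul0r//; apply/negbTE.
Qed.

(** Polynomials of degree [d] are the span of the monomials. *)
Lemma bipoly_span d p (P : (R * R -> R) -> Prop) :
  (forall p q, (forall x, p x = q x) -> P p -> P q) ->
  P (fun=> 0) -> (forall p q, P p -> P q -> P (fun x => p x + q x)) ->
  (forall k p, P p -> P (fun x => k * p x)) ->
  (forall i j, (i + j <= d)%N -> P (fun x => x.1 ^+ i * x.2 ^+ j)) ->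
  bipoly d p -> P p.
Proof.
move=> Pext P0 PD PZ Pm [c cE]; apply: (Pext _ _ (fun x => esym (cE x))).
have Psum (I : Type) (s : seq I) (A : pred I) (F : I -> R * R -> R) :
    (forall i, A i -> P (F i)) -> P (fun x => \sum_(i <- s | A i) F i x).
  move=> PF; elim: s => [|i s IH].
    by apply: Pext P0 => x; rewrite big_nil.
  case: (boolP (A i)) => Ai.
    by apply: Pext (PD _ _ (PF i Ai) IH) => x; rewrite big_cons Ai.
  by apply: Pext IH => x; rewrite big_cons (negbTE Ai).
apply: (Psum _ (index_enum 'I_d.+1) xpredT
  (fun i x => \sum_(j < d.+1 | (i + j <= d)%N) c i j * x.1 ^+ i * x.2 ^+ j)) => i _.
apply: (Psum _ (index_enum 'I_d.+1) (fun j : 'I_d.+1 => (i + j <= d)%N)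
  (fun j x => c i j * x.1 ^+ i * x.2 ^+ j)) => j ij.
by apply: Pext (PZ (c i j) _ (Pm i j ij)) => x; rewrite mulrA.
Qed.

Lemma bipolyM_affine d p f : bipoly d p -> affine f ->
  bipoly d.+1 (fun x => p x * f x).
Proof.
move=> dp [a [b [c fE]]].
apply: (bipoly_span (P := fun q => bipoly d.+1 (fun x => q x * f x))) dp.
- by move=> q r qr; apply: bipoly_ext => x; rewrite qr.
- by apply: bipoly_ext (bipoly0 _) => x; rewrite mul0r.
- by move=> q r dq dr; apply: bipoly_ext (bipolyD dq dr) => x; rewrite mulrDl.
- by move=> k q dq; apply: bipoly_ext (bipolyZ k dq) => x; rewrite mulrA.
- move=> i j ij.
  have m1 := @bipoly_mono d.+1 i.+1 j ij.
  have m2 : bipoly d.+1 (fun x : R * R => x.1 ^+ i * x.2 ^+ j.+1).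
    by apply: bipoly_mono; rewrite addnS.
  have m3 := @bipoly_mono d.+1 i j (leqW ij).
  apply: bipoly_ext (bipolyD (bipolyD (bipolyZ a m1) (bipolyZ b m2)) (bipolyZ c m3)) => x.
  by rewrite fE !exprS; ring.
Qed.

Lemma bipoly_cst d (k : R) : bipoly d (fun=> k).
Proof.
apply: bipoly_ext (bipolyZ k (@bipoly_mono d 0 0 isT)) => x.
by rewrite !expr0 !mulr1.
Qed.

(** A property that is stable under linear combinations and holds for the
    products of [d] affine functions taken from [b 0, b 1, b 2] holds for the
    polynomials of degree [d], if these three functions span the affine ones. *)
Lemma bipoly_span_products d p (P : (R * R -> R) -> Prop) (b : nat -> R * R -> R) :
  (forall f, affine f -> exists k : nat -> R,
     forall x, f x = k 0%N * b 0%N x + k 1%N * b 1%N x + k 2%N * b 2%N x) ->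
  (forall p q, (forall x, p x = q x) -> P p -> P q) ->
  P (fun=> 0) -> (forall p q, P p -> P q -> P (fun x => p x + q x)) ->
  (forall k p, P p -> P (fun x => k * p x)) ->
  (forall i j k, (i + j + k = d)%N ->
     P (fun x => b 0%N x ^+ i * b 1%N x ^+ j * b 2%N x ^+ k)) ->
  bipoly d p -> P p.
Proof.
move=> span Pext P0 PD PZ Pb; apply: bipoly_span => // i j ij.
have gen (fs : seq (R * R -> R)) : (forall f, List.In f fs -> affine f) ->
    forall i j k, (i + j + k + size fs = d)%N ->
    P (fun x => b 0%N x ^+ i * b 1%N x ^+ j * b 2%N x ^+ k * \prod_(f <- fs) f x).
  elim: fs => [|f fs IH] afs i' j' k' ijk.
    by apply: Pext (Pb i' j' k' _) => [x|]; rewrite ?big_nil ?mulr1// -ijk addn0.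
  have afs' g : List.In g fs -> affine g by move=> gfs; apply: afs; right.
  have [c cE] := span f (afs f (or_introl erefl)).
  have e1 := PZ (c 0%N) _ (IH afs' i'.+1 j' k' ltac:(rewrite /= in ijk; lia)).
  have e2 := PZ (c 1%N) _ (IH afs' i' j'.+1 k' ltac:(rewrite /= in ijk; lia)).
  have e3 := PZ (c 2%N) _ (IH afs' i' j' k'.+1 ltac:(rewrite /= in ijk; lia)).
  apply: Pext (PD _ _ (PD _ _ e1 e2) e3) => x; rewrite big_cons cE !exprS; ring.
pose fs := nseq i (fun x : R * R => x.1) ++ nseq j (fun x : R * R => x.2)
  ++ nseq (d - (i + j)) (fun=> 1).
have := gen fs _ 0%N 0%N 0%N; rewrite /fs !size_cat !size_nseq.
move=> H; apply: Pext (H _ _); last by lia.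
- move=> x; rewrite !big_cat /= !big_nseq !iter_mulr_1 !expr0 expr1n.
  by rewrite !mul1r mulr1.
- move=> f; rewrite !List.in_app_iff.
  have in_nseq n (g : R * R -> R) : List.In f (nseq n g) -> f = g.
    by elim: n => //= n IH [<-//|/IH].
  case=> [/in_nseq ->|[/in_nseq ->|/in_nseq ->]].
  + by exists 1, 0, 0 => x; ring.
  + by exists 0, 1, 0 => x; ring.
  + by exists 0, 0, 1 => x; ring.
Qed.

End bivariate.

(** * The dual functionals and the quasi-interpolant *)

Section quasi_interpolation.
Variable R : realType.
Variable v : 'I_3 -> R * R.
Hypothesis ndv : nondegenerate_triangle v.

(** Splitting the subsets of an ordinal by membership of the first element. *)
Lemma big_set_recl n (G : {set 'I_n.+1} -> R) :
  \sum_(A : {set 'I_n.+1}) G A =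
  \sum_(A : {set 'I_n}) (G (lift ord0 @: A)%SET
    + G ((ord0 |: (lift ord0 @: A))%SET)).
Proof.
pose h (bA : bool * {set 'I_n}) : {set 'I_n.+1} :=
  if bA.1 then (ord0 |: (lift ord0 @: bA.2))%SET else (lift ord0 @: bA.2)%SET.
pose g (A : {set 'I_n.+1}) := (ord0 \in A, [set i | lift ord0 i \in A]%SET).
have n0 (A : {set 'I_n}) : ord0 \notin (lift ord0 @: A)%SET.
  by apply/imsetP => -[i _ /eqP]; rewrite (negbTE (neq_lift _ _)).
have ml (A : {set 'I_n}) i : (lift ord0 i \in (lift ord0 @: A)%SET) = (i \in A).
  by rewrite mem_imset//; exact: lift_inj.
have hK : cancel h g.
  move=> [[] A]; rewrite /h /g /=; congr (_, _).
  - by rewrite !inE eqxx.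
  - by apply/setP => i; rewrite !inE ml.
  - exact/negbTE.
  - by apply/setP => i; rewrite !inE ml.
have gK : cancel g h.
  move=> A; apply/setP => i; rewrite /h /g /=.
  have [j ->|->] := unliftP ord0 i.
    by case: ifP => _; rewrite ?inE ml inE.
  case: ifP => [|/negP A0]; first by rewrite !inE eqxx.
  by rewrite (negbTE (n0 _)); apply/esym/negbTE/negP.
rewrite (reindex h); last by exists g => x _; [exact: hK|exact: gK].
rewrite -(pair_bigA _ (fun b A => G (h (b, A)))) /= big_bool /=.
by rewrite addrC -big_split.
Qed.

Definition rmono (a : nat * nat * nat) (x y z : R) : R :=
  x ^+ a.1.1 * (y ^+ a.1.2 * z ^+ a.2).

Lemma zr_zmono a (u : Z3) : zr R (zmono a u) = rmono a (zr R u.1.1) (zr R u.1.2) (zr R u.2).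
Proof.
have zr_iter n x : zr R (iter n (Z.mul x) 1%BZ) = zr R x ^+ n.
  by elim: n => [|n IH]; rewrite ?expr0// iterS zrM IH exprS.
by case: a u => [[i j] k] [[x y] z]; rewrite /zmono !zrM !zr_iter.
Qed.

(** The recursion on the list of points enumerates the subsets. *)
Lemma subset_sumE a n (w : 'I_n -> Z3) sg acc :
  zr R (subset_sum (zmono a) sg acc [seq w i | i <- enum 'I_n]) =
  \sum_(A : {set 'I_n}) (-1) ^+ #|A| * zr R sg *
    rmono a (zr R acc.1.1 + \sum_(r in A) zr R (w r).1.1)
            (zr R acc.1.2 + \sum_(r in A) zr R (w r).1.2)
            (zr R acc.2 + \sum_(r in A) zr R (w r).2).
Proof.
elim: n w sg acc => [|n IH] w sg acc.
  rewrite (big_pred1 finset.set0); last first.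
    by move=> A; apply/esym/eqP/setP => -[].
  rewrite cards0 expr0 mul1r !big_set0 !addr0 -zr_zmono.
  rewrite (_ : enum 'I_0 = [::]); last by apply: size0nil; rewrite size_enum_ord.
  exact: zrM.
rewrite enum_ordSl /= -map_comp zrD !IH big_set_recl -big_split /=.
apply: eq_bigr => A _; have li : {in A &, injective (lift (@ord0 n))}.
  by move=> i j _ _; exact: lift_inj.
have n0 : ord0 \notin (lift ord0 @: A)%SET.
  by apply/imsetP => -[i _ /eqP]; rewrite (negbTE (neq_lift _ _)).
rewrite cardsU1 n0 card_in_imset// !big_setU1//= !big_imset//=.
case: (w ord0) acc => [[w1 w2] w3] [[a1 a2] a3] /=.
by rewrite !zrD zrN !addrA add1n exprS mulN1r mulrN !mulNr.
Qed.

(** One sum over the nonempty subsets of dual points, in place of a sum over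
    their sizes. *)
Lemma dual_functionalE (e : R * (seq nat * seq nat)) f :
  dual_functional v e f = \sum_(A : {set 'I_5} | A != finset.set0)
    (#|A|%:R ^+ 5 / 120) * (-1) ^+ #|A|.-1 *
      f (#|A|%:R^-1 *: \sum_(r in A) dual_point v e r).
Proof.
rewrite /dual_functional.
under eq_bigr do rewrite mulr_sumr.
rewrite big_add1 /= big_mkord (exchange_big_dep (fun A : {set 'I_5} => A != finset.set0)).
2:{ by move=> k A _ /eqP Ak; rewrite -card_gt0 Ak. }
apply: eq_bigr => A A0.
have kA : (#|A|.-1 < 5)%N.
  by rewrite prednK ?card_gt0// -[X in (_ <= X)%N]card_ord max_card.
rewrite (big_pred1 (Ordinal kA)).
  by rewrite [Ordinal kA : nat]/= prednK ?card_gt0.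
by move=> k /=; rewrite -(inj_eq val_inj) /= [RHS]eq_sym -[in RHS]eqSS prednK ?card_gt0.
Qed.

Definition dual_labels (P : seq nat) : bool := (size P == 5%N) && labels_ok P.

Definition eval_point (e : R * (seq nat * seq nat)) (A : {set 'I_5}) : R * R :=
  #|A|%:R^-1 *: \sum_(r in A) dual_point v e r.

Lemma eval_point_affine e A f : A != finset.set0 -> affine f ->
  #|A|%:R * f (eval_point e A) = \sum_(r in A) f (dual_point v e r).
Proof.
move=> A0 af; have k0 : #|A|%:R != 0 :> R by rewrite pnatr_eq0 cards_eq0.
rewrite /eval_point scaler_sumr big_enum_val /=.
rewrite affine_sum//; last by rewrite sumr_const card_ord -[LHS]mulr_natl mulfV.
by rewrite -mulr_sumr mulrA mulfV// mul1r [RHS]big_enum_val.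
Qed.

Lemma rmono_scale a (s x y z : R) : (a.1.1 + a.1.2 + a.2 = 5)%N ->
  rmono a (s * x) (s * y) (s * z) = s ^+ 5 * rmono a x y z.
Proof. by move=> <-; rewrite /rmono !exprMn !exprD; ring. Qed.

(** A dual functional on a quintic monomial in the barycentric coordinates: the
    powers of the sizes of the subsets cancel by homogeneity. *)
Lemma dual_functional_mono e a : dual_labels e.2.2 -> (a.1.1 + a.1.2 + a.2 = 5)%N ->
  120 * 12 ^+ 5 *
    dual_functional v e (fun x => rmono a (bary1 v x) (bary2 v x) (bary3 v x))
  = zr R (dual_mono a e.2.2).
Proof.
move=> /andP[/eqP P5 /allP Pok] a5.
pose w (r : 'I_5) : Z3 := wt (nth 0%N e.2.2 r).
have -> : dual_mono a e.2.2 =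
    subset_sum (zmono a) (-1) (0, 0, 0)%BZ [seq w r | r <- enum 'I_5].
  rewrite /dual_mono; congr subset_sum.
  rewrite -[in LHS](mkseq_nth 0%N e.2.2) P5 /mkseq -val_enum_ord -!map_comp.
  exact: eq_map.
rewrite subset_sumE dual_functionalE mulr_sumr [RHS](bigD1 finset.set0)//=.
rewrite !big_set0 [in X in X + _]/rmono !addr0 -!exprD.
rewrite (_ : a.1.1 + (a.1.2 + a.2) = 5)%N; last by rewrite addnA.
rewrite expr0n mulr0 add0r; apply: eq_bigr => A A0.
have k0 : #|A|%:R != 0 :> R by rewrite pnatr_eq0 cards_eq0.
have bE b (g : Z3 -> Z) : affine b ->
    (forall k, (1 <= k <= 10)%N -> 12 * b (vertex v k) = zr R (g (wt k))) ->
    b (eval_point e A) = (12 * #|A|%:R)^-1 * (0 + \sum_(r in A) zr R (g (w r))).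
  move=> ab bv; rewrite add0r.
  under eq_bigr => r _.
    rewrite -bv; last by apply: Pok; rewrite mem_nth// P5.
    over.
  rewrite -mulr_sumr -(eval_point_affine _ A0 ab) invfM -!mulrA.
  by rewrite [12 * (_ * _)]mulrCA (mulKf k0) mulKf// pnatr_eq0.
rewrite -/(eval_point e A).
rewrite (bE _ (fun u => u.1.1) (affine_bary1 v)); last by move=> k /(bary_vertex ndv)[].
rewrite (bE _ (fun u => u.1.2) (affine_bary2 v)); last by move=> k /(bary_vertex ndv)[].
rewrite (bE _ snd (affine_bary3 v)); last by move=> k /(bary_vertex ndv)[].
rewrite rmono_scale//; set M := rmono _ _ _ _.
have [k ->] : exists k, #|A| = k.+1.
  by exists #|A|.-1; rewrite prednK// card_gt0.
have alg (h c q s : R) : h != 0 -> c != 0 -> q != 0 ->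
    h * c ^+ 5 * (q ^+ 5 / h * s * ((c * q)^-1 ^+ 5 * M)) = -1 * s * -1 * M.
  by move=> h0 c0 q0; field; rewrite h0 c0 q0.
by rewrite [in RHS]exprS alg ?pnatr_eq0.
Qed.

Lemma zbasis_labels B : all (fun e => dual_labels e.2.2) (zbasis B).
Proof. by case: B; vm_compute. Qed.

Lemma zbasis_weight B : all (fun e => 0 <=? e.1)%BZ (zbasis B).
Proof. by case: B; vm_compute. Qed.

Lemma zbasis_knots B : all (fun e => e.2.1 \in basis_knots) (zbasis B).
Proof.
rewrite -(all_map (fun e : Z * (seq nat * seq nat) => e.2.1) (mem basis_knots)).
have sub (F : basis_name -> seq (seq nat)) K Bs : List.In B Bs -> K \in F B ->
    K \in flatten [seq F B' | B' <- Bs].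
  elim: Bs => // B' Bs IH [->|BBs] KB /=; first by rewrite mem_cat KB.
  by rewrite mem_cat IH ?orbT.
apply/allP => K KB; rewrite inE mem_undup; apply: (sub _ _ _ _ KB).
by case: (B); rewrite /=; tauto.
Qed.

Lemma zbasis_ok B : all (fun e => [&& dual_labels e.2.2, (0 <=? e.1)%BZ
  & e.2.1 \in basis_knots]) (zbasis B).
Proof.
have alls (T : Type) (p q r : pred T) s : all p s -> all q s -> all r s ->
    all (fun e => [&& p e, q e & r e]) s.
  by elim: s => //= e s IH /andP[-> /IH{}IH] /andP[-> /IH{}IH] /andP[-> /IH ->].
exact: (alls _ _ _ _ _ (zbasis_labels B) (zbasis_weight B) (zbasis_knots B)).
Qed.

Definition real_entry (e : Z * (seq nat * seq nat)) : R * (seq nat * seq nat) :=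
  (zr R e.1 / 4, e.2).

Lemma real_reps B : common_reps R ++ extra_reps R B = [seq real_entry e | e <- zcommon ++ zextra B].
Proof.
have C (q : Z) (w : R) KP s s' : w = zr R q / 4 -> s = [seq real_entry e | e <- s'] ->
    (w, KP) :: s = [seq real_entry e | e <- (q, KP) :: s'].
  by move=> -> ->.
have [c1 c2 c3 c4] : [/\ 1 / 4 = zr R 1 / 4, 1 / 2 = zr R 2 / 4,
    3 / 4 = zr R 3 / 4 & 1 = zr R 4 / 4].
  by split; rewrite /zr /=; field.
rewrite map_cat; congr (_ ++ _); last case: B.
all: repeat (apply C; [first [exact c1|exact c2|exact c3|exact c4]|]).
all: reflexivity.
Qed.

Lemma basis_dataE B : basis_data R B = [seq real_entry e | e <- zbasis B].
Proof.
rewrite /basis_data real_reps /zbasis; elim: (zcommon ++ zextra B) => // e s IH.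
rewrite map_cons !allpairs_cons IH map_cat; congr (_ ++ _).
by rewrite -map_comp.
Qed.

Lemma truncated_size K : K \in basis_knots -> size (truncated K).2 = 6%N.
Proof. by move=> KB; rewrite /truncated /truncated_table truncated_in_map ?size_map. Qed.

(** Each level of the recursion multiplies by affine functions. *)
Lemma piece_bipoly c n Ks K : all labels_ok Ks -> (pieces c n Ks).2 -> K \in Ks ->
  bipoly n (fun x => piece_value v c n Ks x K).
Proof.
elim: n Ks K => [|n IH] Ks K Ksok ok KKs.
  suff [q qE] : exists q, forall x, piece_value v c 0 Ks x K = zr R q.
    by apply: bipoly_ext (bipoly_cst 0 (zr R q)) => x; rewrite qE.
  rewrite /piece_value /= look_map// /base_piece.
  case: (frame c K) => [[[i j] k]|]; last by exists 0%BZ.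
  by exists (1728 / Z.abs (dt i j k))%BZ.
have Kok := allP Ksok _ KKs.
have okn : (pieces c n (faces Ks)).2.
  by move: ok => /=; case: (pieces c n (faces Ks)) => ? ? /= /andP[].
have bip l : l \in K -> bipoly n (fun x => piece_value v c n (faces Ks) x (rem l K)).
  by move=> lK; apply: IH => //; [exact: faces_ok|exact: mem_faces].
case E : (frame c K) => [[[i j] k]|].
  have [iK jK kK _] := frameP E.
  set t := subtri v [:: i; j; k].
  apply: bipoly_ext (bipolyD (bipolyD (bipolyM_affine (bip i iK) (affine_bary1 t))
    (bipolyM_affine (bip j jK) (affine_bary2 t))) (bipolyM_affine (bip k kK) (affine_bary3 t))).
  move=> x; have := piece_value_step ndv x KKs ok Kok; rewrite E => -[-> _].
  by rewrite -/t; ring.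
apply: bipoly_ext (bipoly0 R n.+1) => x.
by have := piece_value_step ndv x KKs ok Kok; rewrite E => -[-> _].
Qed.

Local Opaque pieces basis_knots cell_tables truncated piece zbasis dual_mono.

Lemma sum_zip (T U : Type) (d : T) (d' : U) (F : T -> U -> R) s t : size t = size s ->
  \sum_(lq <- zip s t) F lq.1 lq.2 = \sum_(l <- iota 0 (size s)) F (nth d s l) (nth d' t l).
Proof.
move=> ts; rewrite (big_nth (d, d')) size_zip ts minnn /index_iota subn0.
by apply: eq_bigr => l _; rewrite nth_zip.
Qed.

Definition cut_line (l : nat) : Z3 := (nth ((0, 0, 0)%BZ, ([::], [::])) cut_lines l).1.

Lemma spline_extE K x : K \in basis_knots ->
  spline_ext v K x = evb v x (truncated K).1 +
    \sum_(l <- iota 0 6) relu (bform (cut_line l) v x) ^+ 4 *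
      evb v x (nth (pcst 0) (truncated K).2 l).
Proof.
move=> KB; rewrite /spline_ext /truncated_eval; congr (_ + _).
exact: (@sum_zip _ _ ((0, 0, 0)%BZ, ([::], [::])) (pcst 0)
  (fun l q => relu (bform l.1 v x) ^+ 4 * evb v x q) cut_lines _ (truncated_size KB)).
Qed.

Lemma all_In (T : Type) (p : pred T) s x : List.In x s -> all p s -> p x.
Proof. by elim: s => //= y s IH [->|/IH{}IH] /andP[]. Qed.

Lemma bases_reproduce B : reproduces truncated B.
Proof.
have [_ _ + _] := verified_parts; apply: all_In.
by case: (B); rewrite /=; tauto.
Qed.

Lemma eq_big_all (T : Type) (p : pred T) s (F G : T -> R) : all p s ->
  (forall e, p e -> F e = G e) -> \sum_(e <- s) F e = \sum_(e <- s) G e.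
Proof.
move=> + FG; elim: s => [|e s IH]; first by rewrite !big_nil.
by move=> /= /andP[/FG pe /IH sE]; rewrite !big_cons pe sE.
Qed.

Lemma evb_pmono a x :
  evb v x (pmono a) = rmono a (bary1 v x) (bary2 v x) (bary3 v x).
Proof.
have it n p : evb v x (iter n (pmul p) (pcst 1)) = evb v x p ^+ n.
  elim: n => [|n IH]; first by rewrite expr0 /evb ev_cst.
  by rewrite iterS exprS /evb ev_mul -/(evb v x) IH.
case: a => [[i j] k]; rewrite /pmono /rmono /evb !ev_mul -/(evb v x) !it.
by rewrite /evb ev_X1 ev_X2 ev_X3 bary_sum.
Qed.

Lemma quintic_exponentsP a : (a.1.1 + a.1.2 + a.2 = 5)%N -> a \in quintic_exponents.
Proof.
case: a => [[i j] k] /= ijk; apply/mapP; exists (i, j).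
  rewrite mem_filter [X in X && _](_ : _ = true); last by rewrite /= -ijk leq_addr.
  by apply/allpairsP; exists (i, j); split; rewrite ?mem_iota; cbn [fst snd]; [lia|lia|].
by cbn [fst snd]; rewrite -ijk addKn.
Qed.

(** The identity holds for the polynomial parts, and for each line the
    coefficients of the truncated power cancel. *)
Lemma spline_monomial B a x : (a.1.1 + a.1.2 + a.2 = 5)%N ->
  \sum_(e <- zbasis B) zr R e.1 * zr R (dual_mono a e.2.2) * spline_ext v e.2.1 x
  = 4 * 120 * 12 ^+ 5 * rmono a (bary1 v x) (bary2 v x) (bary3 v x).
Proof.
move=> a5; have /allP/(_ _ (quintic_exponentsP a5)) := bases_reproduce B.
move=> /andP[/(ev_eq (bary1 v x) (bary2 v x)) poly /allP cut].
transitivity (\sum_(e <- zbasis B) (zr R (e.1 * dual_mono a e.2.2) * evb v x (truncated e.2.1).1 +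
  \sum_(l <- iota 0 6) relu (bform (cut_line l) v x) ^+ 4 *
     (zr R (e.1 * dual_mono a e.2.2) * evb v x (nth (pcst 0) (truncated e.2.1).2 l)))).
  apply: eq_big_all (zbasis_knots B) _ => e eB.
  rewrite (spline_extE x eB) zrM mulrDr mulr_sumr; congr (_ + _).
  by apply: eq_bigr => l _; rewrite mulrCA.
rewrite big_split exchange_big /= [X in _ + X]big1_seq ?addr0; last first.
  move=> l /andP[_ /cut /(ev_eq (bary1 v x) (bary2 v x))].
  rewrite ev_sum ev_cst !big_map -mulr_sumr => E.
  apply/eqP; rewrite mulf_eq0; apply/orP; right; apply/eqP; rewrite -[RHS]E.
  by apply: eq_bigr => e _; rewrite ev_scale.
move: poly; rewrite ev_scale -[ev _ _ (pmono a)]/(evb v x (pmono a)) evb_pmono.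
rewrite ev_sum !big_map; under eq_bigr do rewrite ev_scale.
move=> E; apply: etrans E _; congr (_ * _).
have -> : (4 * 120 * 12 ^ 5 = 4 * 120 * (12 * (12 * (12 * (12 * 12)))))%BZ by [].
have z12 : zr R 12 = 12 by rewrite /zr /=; ring.
have z4 : zr R 4 = 4 by rewrite /zr /=; ring.
have z120 : zr R 120 = 120 by rewrite /zr /=; ring.
by rewrite !zrM z12 z4 z120 !exprS expr0 mulr1.
Qed.

(** The quasi-interpolant on the triangle, as a combination of functions that
    are defined and smooth on the whole plane. *)
Lemma quasi_interpolantE B f x : triangle v x ->
  quasi_interpolant v B f x = \sum_(e <- zbasis B)
    dual_functional v (real_entry e) f * (zr R e.1 / 4 * spline_ext v e.2.1 x).
Proof.
move=> Tx; rewrite /quasi_interpolant basis_dataE big_map.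
apply: eq_big_all (zbasis_knots B) _ => e eB.
by rewrite /basis_fun [(real_entry e).2]/= [(real_entry e).1]/= (simplex_splineTE ndv eB Tx).
Qed.

Lemma dual_functionalD e f g : dual_functional v e (fun x => f x + g x) =
  dual_functional v e f + dual_functional v e g.
Proof.
rewrite !dual_functionalE -big_split; apply: eq_bigr => A _.
by rewrite /= mulrDr.
Qed.

Lemma dual_functionalZ e k f : dual_functional v e (fun x => k * f x) =
  k * dual_functional v e f.
Proof.
by rewrite !dual_functionalE mulr_sumr; apply: eq_bigr => A _; rewrite mulrCA.
Qed.

Lemma quasi_interpolantD B f g x : quasi_interpolant v B (fun x => f x + g x) x =
  quasi_interpolant v B f x + quasi_interpolant v B g x.
Proof.
rewrite /quasi_interpolant -big_split; apply: eq_bigr => e _.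
by rewrite dual_functionalD mulrDl.
Qed.

Lemma quasi_interpolantZ B k f x : quasi_interpolant v B (fun x => k * f x) x =
  k * quasi_interpolant v B f x.
Proof.
rewrite /quasi_interpolant mulr_sumr; apply: eq_bigr => e _.
by rewrite dual_functionalZ mulrA.
Qed.

Lemma affine_bary_span f : affine f -> exists k : nat -> R, forall x,
  f x = k 0%N * bary1 v x + k 1%N * bary2 v x + k 2%N * bary3 v x.
Proof.
move=> af; exists (nth 0 [:: f (v 0); f (v 1); f (v 2)]) => x /=.
rewrite {1}(baryE x ndv) affine3//; first by ring.
by rewrite /bary1; ring.
Qed.

Lemma reproduction B p x : bipoly 5 p -> triangle v x ->
  quasi_interpolant v B p x = p x.
Proof.
move=> pp Tx; move: p pp.
pose P p := quasi_interpolant v B p x = p x.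
have P0 : P (fun=> 0).
  have := quasi_interpolantZ B 0 (fun=> 0) x; by rewrite mul0r /P => ->; exact: mul0r.
have PD p q : P p -> P q -> P (fun y => p y + q y).
  by move=> pE qE; rewrite /P quasi_interpolantD pE qE.
have PZ k p : P p -> P (fun y => k * p y) by move=> pE; rewrite /P quasi_interpolantZ pE.
have Pext p q : (forall y, p y = q y) -> P p -> P q by move=> /funext ->.
move=> p; apply: (bipoly_span_products (b := nth (bary1 v) [:: bary1 v; bary2 v; bary3 v])
  affine_bary_span Pext P0 PD PZ) => i j k ijk.
apply: (Pext (fun y => rmono (i, j, k) (bary1 v y) (bary2 v y) (bary3 v y))).
  by move=> y; rewrite /rmono mulrA.
rewrite /P quasi_interpolantE//.
have c0 : 4 * 120 * 12 ^+ 5 != 0 :> R.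
  by rewrite !mulf_neq0 ?expf_neq0 ?pnatr_eq0.
apply: (mulfI c0); rewrite -[RHS](@spline_monomial B (i, j, k) x ijk) mulr_sumr.
apply: eq_big_all (zbasis_labels B) _ => e eP.
rewrite -(@dual_functional_mono (real_entry e) (i, j, k) eP ijk).
have alg (h c q w S L : R) : q != 0 ->
    q * h * c * (L * (w / q * S)) = w * (h * c * L) * S.
  by move=> q0; field.
by apply: alg; rewrite pnatr_eq0.
Qed.

(** * Range and bounds of the quasi-interpolant *)

Lemma hull_cell c x : c \in split12 -> hull [seq vertex v k | k <- c] x ->
  triangle v x /\ in_cell v c x.
Proof.
move=> cS cx; have /and3P[cok uc /eqP c3] := cells_ok cS; split.
  exact: (chull_sub_triangle ndv cok cx).
case: c cok uc c3 cS cx => [|c0 [|c1 [|c2 []]]] // cok uc _ _.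
move=> /hull3P[a [b [d [a0 b0 d0 abd ->]]]].
exact: (@cell_of_corners R v c0 c1 c2 a b d).
Qed.

Lemma quasi_interpolant_spline B f : spline_space v (quasi_interpolant v B f).
Proof.
split.
  exists (fun x => \sum_(e <- zbasis B) dual_functional v (real_entry e) f *
      (zr R e.1 / 4 * spline_ext v e.2.1 x)); last by move=> x; exact: quasi_interpolantE.
  apply: Ck_sum => e; apply: CkM; first exact: Ck_cst.
  by apply: CkM; [exact: Ck_cst|exact: Ck_spline_ext].
move=> c cS; exists (fun x => \sum_(e <- zbasis B) dual_functional v (real_entry e) f *
      (zr R e.1 / 4 * piece_value v c 5 basis_knots x e.2.1)).
  have pc := @piece_bipoly c 5 basis_knots _ knots_labels (pieces_verified cS).
  elim: (zbasis B) (zbasis_knots B) => [|e s IH].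
    by move=> _; apply: bipoly_ext (bipoly0 R 5) => x; rewrite big_nil.
  move=> /andP[/pc eB /IH sB].
  pose l := dual_functional v (real_entry e) f; pose w := zr R e.1 / 4.
  by apply: bipoly_ext (bipolyD (bipolyZ l (bipolyZ w eB)) sB) => x; rewrite big_cons.
move=> x /(hull_cell cS)[Tx cx]; rewrite quasi_interpolantE//.
apply: eq_big_all (zbasis_knots B) _ => e eB.
by rewrite (spline_ext_cell ndv cS eB cx).
Qed.

Lemma basis_data_ok B : all (fun e => [&& dual_labels e.2.2, 0 <= e.1
  & e.2.1 \in basis_knots]) (basis_data R B).
Proof.
rewrite basis_dataE all_map; apply: sub_all (zbasis_ok B) => e /and3P[lab w0 KB].
by rewrite /= lab KB divr_ge0 ?ler0n ?zr_ge0.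
Qed.

Lemma basis_fun_ge0 B e x : e \in basis_data R B -> triangle v x -> 0 <= basis_fun v e x.
Proof.
move=> /(allP (basis_data_ok B))/and3P[_ w0 KB] Tx.
rewrite /basis_fun (simplex_splineTE ndv KB Tx).
exact: mulr_ge0 w0 (spline_ext_ge0 ndv KB Tx).
Qed.

Lemma eval_point_triangle e A : dual_labels e.2.2 -> A != finset.set0 ->
  triangle v (eval_point e A).
Proof.
move=> /andP[/eqP P5 /allP Pok] A0.
have k0 : 0 < #|A|%:R :> R by rewrite ltr0n card_gt0.
have dp r : triangle v (dual_point v e r).
  by apply: vertex_in_triangle => //; apply: Pok; rewrite mem_nth// P5.
have ge0 f : affine f -> (forall y, triangle v y -> 0 <= f y) -> 0 <= f (eval_point e A).
  move=> af f0; rewrite -(pmulr_rge0 _ k0) eval_point_affine// sumr_ge0// => r _.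
  exact/f0/dp.
apply/(triangleP _ ndv); split; apply: ge0 => [|y /(triangleP _ ndv)[]//].
- exact: affine_bary1.
- exact: affine_bary2.
- exact: affine_bary3.
Qed.

Lemma sum_subset_card k (c : R) : \sum_(A : {set 'I_5} | #|A| == k) c = 'C(5, k)%:R * c.
Proof.
rewrite sumr_const mulr_natl; congr (_ *+ _).
by rewrite -[5%N in RHS]card_ord -card_draws cardsE.
Qed.

Lemma big_nat16 (F : nat -> R) :
  \sum_(1 <= k < 6) F k = F 1%N + (F 2%N + (F 3%N + (F 4%N + F 5%N))).
Proof. by do 5!rewrite big_ltn//; rewrite big_geq// addr0. Qed.

Lemma binomial5 (F : nat -> R) : \sum_(1 <= k < 6) 'C(5, k)%:R * F k =
  5 * F 1%N + (10 * F 2%N + (10 * F 3%N + (5 * F 4%N + F 5%N))).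
Proof.
have [b1 b2 b3 b4 b5] : [/\ 'C(5, 1) = 5, 'C(5, 2) = 10, 'C(5, 3) = 10, 'C(5, 4) = 5
  & 'C(5, 5) = 1]%N by [].
by rewrite big_nat16 b1 b2 b3 b4 b5 mul1r.
Qed.

Lemma fact5 : (5`!)%:R = 120 :> R. Proof. by []. Qed.

(** The signed sum of [C(5, k) * k ^ 5 / 5!] is a fifth difference of the fifth
    power. *)
Lemma dual_functional_cst e c : dual_functional v e (fun=> c) = c.
Proof.
rewrite /dual_functional; under eq_bigr do rewrite sum_subset_card mulrCA.
rewrite binomial5 fact5; cbn [predn].
by field.
Qed.

(** The sum of [C(5, k) * k ^ 5 / 5!] is 275/3. *)
Lemma dual_functional_bound e f (M : R) : dual_labels e.2.2 ->
  (forall y, triangle v y -> `|f y| <= M) -> `|dual_functional v e f| <= 275 / 3 * M.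
Proof.
move=> eP fM.
have E : \sum_(1 <= k < 6) 'C(5, k)%:R * (k%:R ^+ 5 / (5`!)%:R * M) = 275 / 3 * M.
  by rewrite binomial5 fact5; field.
rewrite -E /dual_functional; apply: le_trans (ler_norm_sum _ _ _) _.
rewrite big_nat_cond [leRHS]big_nat_cond; apply: ler_sum => k /andP[/andP[k1 _] _].
have : 0 <= k%:R ^+ 5 / (5`!)%:R :> R by rewrite divr_ge0 ?exprn_ge0 ?ler0n.
move: (_ / _) => c c0.
rewrite 2!normrM normrX normrN1 expr1n mulr1 (ger0_norm c0) mulrCA ler_wpM2l//.
rewrite -sum_subset_card; apply: le_trans (ler_norm_sum _ _ _) _.
apply: ler_sum => A /eqP Ak; apply: fM; rewrite -Ak.
by apply: (@eval_point_triangle e) => //; rewrite -card_gt0 Ak.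
Qed.

(** The quasi-interpolant reproduces the constant one. *)
Lemma partition_of_unity B x : triangle v x ->
  \sum_(e <- basis_data R B) basis_fun v e x = 1.
Proof.
move=> Tx; rewrite -[RHS](reproduction B (bipoly_cst 5 1) Tx).
by apply: eq_bigr => e _; rewrite dual_functional_cst mul1r.
Qed.

Lemma max_functional_ub B f e : e \in basis_data R B ->
  `|dual_functional v e f| <= max_functional v B f.
Proof.
rewrite /max_functional; elim: (basis_data R B) => // e' s IH.
rewrite inE big_cons le_max => /orP[/eqP ->|/IH ->]; first by rewrite lexx.
by rewrite orbT.
Qed.

Lemma quasi_interpolant_bound B f x : triangle v x ->
  `|quasi_interpolant v B f x| <= max_functional v B f.
Proof.
move=> Tx; rewrite -[leRHS]mulr1 -(partition_of_unity B Tx) mulr_sumr.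
apply: le_trans (ler_norm_sum _ _ _) _.
rewrite big_seq [leRHS]big_seq; apply: ler_sum => e eB.
have b0 := basis_fun_ge0 eB Tx.
by rewrite normrM (ger0_norm b0); apply: (ler_wpM2r b0); exact: max_functional_ub.
Qed.

Lemma max_functional_bound B f (M : R) : 0 <= M -> (forall y, triangle v y -> `|f y| <= M) ->
  max_functional v B f <= 275 / 3 * M.
Proof.
move=> M0 fM; rewrite /max_functional; have := basis_data_ok B.
elim: (basis_data R B) => [|e s IH].
  by rewrite big_nil mulr_ge0// divr_ge0// ler0n.
move=> /andP[/and3P[eP _ _] /IH sM]; rewrite big_cons ge_max sM andbT.
exact: dual_functional_bound.
Qed.

End quasi_interpolation.

(** * The norm of L_oo on the triangle *)

Section essential_bounds.
Variable R : realType.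
Variable v : 'I_3 -> R * R.
Hypothesis ndv : nondegenerate_triangle v.
Notation mR := (measurableTypeR R).
Notation m2 := (lebesgue2 R).
Notation T := (triangle v).

Lemma triangle_measure_gt0 (w : 'I_3 -> R * R) : nondegenerate_triangle w ->
  (0 < m2 (triangle w))%E.
Proof.
have [k k0 kE] := measure_triangle R => ndw.
by rewrite kE// lte_fin mulr_gt0// normr_gt0.
Qed.

Lemma plane_measure_gt0 : (0 < m2 [set: mR * mR])%E.
Proof.
apply: lt_le_trans (triangle_measure_gt0 ndv) _.
by apply: le_measure; rewrite ?inE//; exact: measurable_triangle.
Qed.

Lemma LinfE A (f : R * R -> R) :
  Linf A f = ess_sup m2 (fun x => `|\1_A x * f x|%:E).
Proof. by rewrite /Linf unlock plane_measure_gt0. Qed.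

Lemma Linf_ge0 A (f : R * R -> R) : (0 <= Linf A f)%E.
Proof. exact: Lnorm_ge0. Qed.

Lemma Linf_le (f : R * R -> R) (y : R) : 0 <= y -> (forall x, T x -> `|f x| <= y) ->
  (Linf T f <= y%:E)%E.
Proof.
move=> y0 fy; rewrite LinfE; apply/ess_supP/aeW => x; rewrite lee_fin indicE.
have [/set_mem Tx|_] := boolP (x \in T); first by rewrite mul1r fy.
by rewrite mul0r normr0.
Qed.

Lemma Linf_ae (f : R * R -> R) : {ae m2, forall x, T x -> (`|f x|%:E <= Linf T f)%E}.
Proof.
rewrite LinfE; have := ess_sup_ge m2 (fun x => `|\1_T x * f x|%:E).
by apply: filterS => x + Tx; rewrite indicE mem_set// mul1r.
Qed.

(** The image of the triangle under the homothety of center [x] and ratio [s]. *)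
Definition contracted x (s : R) : 'I_3 -> R * R := fun i => (1 - s) *: x + s *: v i.

Lemma contracted_det x s : tri_det (contracted x s) = s ^+ 2 * tri_det v.
Proof. by rewrite /tri_det /contracted !coordE; ring. Qed.

Lemma contracted_triangle x s y : T x -> 0 <= s <= 1 -> triangle (contracted x s) y ->
  exists2 z, T z & y = (1 - s) *: x + s *: z /\ T y.
Proof.
move=> Tx /andP[s0 s1] /hull3P[a [b [c [a0 b0 c0 abc yE]]]].
pose z := a *: v 0 + b *: v 1 + c *: v 2.
have Tz : T z by apply/hull3P; exists a, b, c.
have yz : y = (1 - s) *: x + s *: z.
  rewrite yE /contracted /z; apply: pair_eq; rewrite !coordE.
    transitivity ((1 - s) * (a + b + c) * x.1 + s * (a * (v 0).1 + b * (v 1).1 + c * (v 2).1)).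
      by ring.
    by rewrite abc mulr1.
  transitivity ((1 - s) * (a + b + c) * x.2 + s * (a * (v 0).2 + b * (v 1).2 + c * (v 2).2)).
    by ring.
  by rewrite abc mulr1.
exists z => //; split=> //.
move/hull3P : Tx => [a' [b' [c' [a0' b0' c0' abc' xE]]]].
apply/hull3P; exists ((1 - s) * a' + s * a), ((1 - s) * b' + s * b), ((1 - s) * c' + s * c).
have s1' : 0 <= 1 - s by rewrite subr_ge0.
split; rewrite ?addr_ge0 ?mulr_ge0//.
  transitivity ((1 - s) * (a' + b' + c') + s * (a + b + c)); first by ring.
  by rewrite abc abc' !mulr1 subrK.
by rewrite yz xE /z; apply: pair_eq; rewrite !coordE; ring.
Qed.

Lemma triangle_bounded x : exists2 D : R, 0 < D & forall z, T z -> `|z - x| <= D.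
Proof.
exists (`|v 0 - x| + `|v 1 - x| + `|v 2 - x| + 1).
  by rewrite ltr_wpDl// !addr_ge0.
move=> _ /hull3P[a [b [c [a0 b0 c0 abc ->]]]].
have -> : a *: v 0 + b *: v 1 + c *: v 2 - x = a *: (v 0 - x) + b *: (v 1 - x) + c *: (v 2 - x).
  rewrite !scalerBr -[in LHS](scale1r x) -abc !scalerDl; apply: pair_eq; rewrite !coordE; ring.
have [a1 b1 c1] : [/\ a <= 1, b <= 1 & c <= 1] by split; lra.
have le u (k : R) : 0 <= k -> k <= 1 -> `|k *: (u : R * R)| <= `|u|.
  by move=> k0 k1; rewrite normrZ ger0_norm// ler_piMl.
have A1 := le (v 0 - x) a a0 a1; have B1 := le (v 1 - x) b b0 b1.
have C1 := le (v 2 - x) c c0 c1.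
apply: (le_trans (ler_normD _ _)); apply: (le_trans (lerD (ler_normD _ _) (lexx _))).
lra.
Qed.

(** Contracting the triangle to [x] shows that every point of the triangle,
    also on the boundary, has a part of positive area nearby. *)
Lemma small_triangle x (r : R) : T x -> 0 < r ->
  exists w : 'I_3 -> R * R, [/\ nondegenerate_triangle w, triangle w `<=` T
    & triangle w `<=` ball x r].
Proof.
move=> Tx r0; have [D D0 xD] := triangle_bounded x.
pose s := r / (r + D); have rD : 0 < r + D by rewrite addr_gt0.
have s0 : 0 < s by rewrite divr_gt0.
have s1 : s <= 1 by rewrite ler_pdivrMr// mul1r lerDl ltW.
have sD : s * D < r by rewrite mulrAC ltr_pdivrMr// ltr_pM2l// ltrDr.
have s01 : 0 <= s <= 1 by rewrite ltW.
exists (contracted x s); split.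
- have : tri_det (contracted x s) != 0.
    by rewrite contracted_det mulf_neq0// expf_neq0// gt_eqF.
  by [].
- by move=> y /(contracted_triangle Tx s01)[z _ []].
move=> y /(contracted_triangle Tx s01)[z Tz [yE _]].
rewrite -ball_normE /ball_ /= yE distrC.
have -> : (1 - s) *: x + s *: z - x = s *: (z - x).
  by apply: pair_eq; rewrite !coordE; ring.
by rewrite normrZ gtr0_norm//; apply: le_lt_trans sD; rewrite ler_pM2l// xD.
Qed.

(** A continuous function is bounded everywhere by its essential supremum, as
    the part of the triangle near one of its points has positive area. *)
Lemma continuous_Linf (f : R * R -> R) : {within T, continuous f} ->
  forall x, T x -> (`|f x|%:E <= Linf T f)%E.
Proof.
have far (a b l : R) : `|a - b| < `|a| - l -> `|b| <= l -> False.
  by move=> ab bl; have := ler_normD (a - b) b; rewrite subrK; lra.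
move=> /subspace_continuousP cf x Tx; rewrite leNgt; apply/negP => lt_fx.
have : Linf T f \is a fin_num.
  by rewrite ge0_fin_numE ?Linf_ge0//; apply: lt_le_trans lt_fx (leey _).
move=> /fineK lE; set l := fine (Linf T f) in lE.
have lx : 0 < `|f x| - l by rewrite subr_gt0 -lte_fin lE.
have /cvgrPdist_lt/(_ _ lx) := cf x Tx; rewrite near_withinE => /nbhs_ballP[e /= e0 fe].
have [w [ndw wT we]] := small_triangle Tx e0.
have [N [mN N0 fN]] := Linf_ae f.
have := triangle_measure_gt0 ndw; rewrite ltNge => /negP; apply.
rewrite -N0; apply: le_measure; rewrite ?inE//; first exact: measurable_triangle.
move=> y wy; apply: fN => /= fy; have Ty := wT y wy.
move: (we y wy) => /fe/(_ Ty) fxy; have {}fxy : `|f x - f y| < `|f x| - l := fxy.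
by have := fy Ty; rewrite -lE lee_fin => fyl; exact: far fxy fyl.
Qed.

Lemma max_functional_Linf B (f : R * R -> R) : {within T, continuous f} ->
  ((max_functional v B f)%:E <= (275 / 3)%:E * Linf T f)%E.
Proof.
move=> cf; have fL := continuous_Linf cf.
have [/eqP lE|lfin] := boolP (Linf T f == +oo%E).
  by rewrite lE gt0_muley ?leey// lte_fin divr_gt0// ltr0n.
have /fineK lE : Linf T f \is a fin_num.
  by rewrite ge0_fin_numE ?Linf_ge0// ltey.
rewrite -lE -EFinM lee_fin; apply: max_functional_bound => //.
  by rewrite -lee_fin lE Linf_ge0.
by move=> y Ty; rewrite -lee_fin lE fL.
Qed.

Lemma quasi_interpolant_Linf B (f : R * R -> R) :
  (Linf T (quasi_interpolant v B f) <= (max_functional v B f)%:E)%E.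
Proof.
apply: Linf_le => [|x Tx]; last exact: quasi_interpolant_bound.
have [Tg _] := generic_pointP ndv.
exact: le_trans (normr_ge0 _) (quasi_interpolant_bound ndv B f Tg).
Qed.

End essential_bounds.

(** * A smooth bump function *)

Section bump_function.
Variable R : realType.

Implicit Types (f g : R -> R).

(** Existence of the first [n] derivatives, in a recursive form that is stable
    under products by a plain induction on [n]. *)
Fixpoint smooth (n : nat) f : Prop :=
  if n is m.+1 then (forall t, derivable f t 1) /\ smooth m (fun t => 'D_1 f t) else True.

Lemma smooth_step m f f' : (forall t : R, is_derive t (1 : R) f (f' t)) ->
  smooth m f' -> smooth m.+1 f.
Proof.
move=> ff' sf'; split; first by move=> t; have [] := ff' t.
by have -> : (fun t => 'D_1 f t) = f' by apply/funext => t; have [] := ff' t.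
Qed.

Lemma smooth_derive m f : smooth m.+1 f -> forall t : R, is_derive t (1 : R) f ('D_1 f t).
Proof. by move=> [df _] t; split. Qed.

Lemma smooth_pred m f : smooth m.+1 f -> smooth m f.
Proof. by elim: m f => // m IH f [df sf]; split=> //; exact: IH. Qed.

Lemma smoothD m f g : smooth m f -> smooth m g -> smooth m (fun t => f t + g t).
Proof.
elim: m f g => // m IH f g sf sg.
apply: smooth_step (IH _ _ sf.2 sg.2) => t.
exact: is_deriveD (smooth_derive sf t) (smooth_derive sg t).
Qed.

Lemma smoothM m f g : smooth m f -> smooth m g -> smooth m (fun t => f t * g t).
Proof.
elim: m f g => // m IH f g sf sg.
apply: (@smooth_step _ _ (fun t => f t * 'D_1 g t + g t * 'D_1 f t)).
  move=> t; exact: is_deriveM (smooth_derive sf t) (smooth_derive sg t).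
by apply: smoothD; apply: IH; rewrite ?(smooth_pred sf) ?(smooth_pred sg)// ?sf.2 ?sg.2;
  [exact: smooth_pred|exact: sg.2|exact: smooth_pred|exact: sf.2].
Qed.

Lemma smooth_cst m (c : R) : smooth m (fun=> c).
Proof.
elim: m c => // m IH c; apply: smooth_step (IH 0) => t; exact: is_derive_cst.
Qed.

Lemma smooth_affine m f (a c : R) : smooth m f -> smooth m (fun t => f (a * t + c)).
Proof.
elim: m f => // m IH f sf.
apply: (@smooth_step _ _ (fun t => 'D_1 f (a * t + c) * a)).
  move=> t; have df := smooth_derive sf (a * t + c).
  have da : is_derive t (1 : R) (fun t => a * t + c) a.
    by apply: is_derive_eq; rewrite /GRing.scale /= mulr1 addr0 ?mul0r ?addr0.
  exact: (@is_derive1_comp R f (fun t => a * t + c) t _ _ df da).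
by apply: smoothM; [exact: (IH _ sf.2)|exact: smooth_cst].
Qed.

(** The functions [t ^ -m * exp (- t ^ -1)], flat at the origin; their span is
    stable under derivation. *)
Definition flat (m : nat) (t : R) : R :=
  if 0 < t then t^-1 ^+ m * expR (- t^-1) else 0.

Lemma flat_ge0 m t : 0 <= flat m t.
Proof.
by rewrite /flat; case: ifP => // t0; rewrite mulr_ge0 ?expR_ge0// exprn_ge0// invr_ge0 ltW.
Qed.

(** From [exp s >= s ^ (m + 2) / (m + 2)!] with [s = 1 / t]; it shows that the
    derivative at the origin vanishes. *)
Lemma flat_le m t : flat m t <= (m.+2)`!%:R * t ^+ 2.
Proof.
rewrite /flat; case: ifP => t0; last by rewrite mulr_ge0 ?ler0n ?sqr_ge0.
have s0 : 0 < t^-1 by rewrite invr_gt0.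
rewrite expRN ler_pdivrMr ?expR_gt0//.
have := expR_ge1Dxn m.+1 (ltW s0).
set E := expR _ => H.
have {}H : t^-1 ^+ m.+2 <= (m.+2)`!%:R * E.
  by rewrite -ler_pdivrMl ?ltr0n ?fact_gt0//; rewrite mulrC; apply: le_trans H; rewrite lerDr.
have -> : t^-1 ^+ m = t^-1 ^+ m.+2 * t ^+ 2.
  by rewrite !exprS expr0 mulr1; field; rewrite gt_eqF.
by rewrite [leRHS]mulrAC ler_wpM2r// sqr_ge0.
Qed.

Lemma flat_derive m t :
  is_derive t (1 : R) (flat m) (flat m.+2 t - m%:R * flat m.+1 t).
Proof.
have [t0|t0|t0] := ltgtP t 0.
- have E : \forall s \near t, cst (0 : R) s = flat m s.
    near=> s; rewrite /flat ltNge ltW//; near: s; exact: lt_nbhsl.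
  apply: near_eq_is_derive E _; rewrite /flat !ltNge (ltW t0) /= mulr0 subr0.
  exact: is_derive_cst.
- have E : \forall s \near t, (fun s => s^-1 ^+ m * expR (- s^-1)) s = flat m s.
    near=> s; rewrite /flat ifT//; near: s; exact: lt_nbhsr.
  apply: near_eq_is_derive E _; rewrite /flat t0.
  have tn0 : t != 0 by rewrite gt_eqF.
  have dV : is_derive t (1 : R) (fun s => s^-1) (- t^-1 ^+ 2).
    apply: (@is_derive_eq _ _ _ _ _ _ _ _ (@is_deriveV R id t 1 1 tn0 _)).
    by rewrite /GRing.scale /= mulr1 exprVn.
  have dE : is_derive t (1 : R) (expR \o (fun s => - s^-1)) (expR (- t^-1) * t^-1 ^+ 2).
    apply: is_derive1_comp.
    by apply: is_derive_eq (is_deriveN dV) _; rewrite opprK.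
  have dX : is_derive t (1 : R) (fun s => s^-1 ^+ m) (- m%:R * t^-1 ^+ m.+1).
    elim: (m) => [|k IH].
      by rewrite oppr0 mul0r; exact: is_derive_cst.
    have -> : (fun s : R => s^-1 ^+ k.+1) = (fun s => s^-1) \* (fun s => s^-1 ^+ k).
      by apply/funext => s; rewrite /= exprS.
    apply: is_derive_eq (is_deriveM dV IH) _.
    by rewrite /GRing.scale /= -natr1 !exprS; ring.
  apply: is_derive_eq (is_deriveM dX dE) _.
  by rewrite /GRing.scale /= !exprS; ring.
- apply: (@is_derive_quadratic _ _ _ _ (m.+2)`!%:R) => h.
  rewrite t0 /flat ltxx !(mulr0, subr0) add0r -/(flat m h) ger0_norm ?flat_ge0//.
  exact: flat_le.
Unshelve. all: by end_near. Qed.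

Lemma smooth_flat n m : smooth n (flat m).
Proof.
elim: n m => // n IH m; apply: smooth_step (flat_derive m) _.
apply: smoothD; first exact: IH.
under eq_fun do rewrite -mulNr.
by apply: smoothM; [exact: smooth_cst|exact: IH].
Qed.

Section bump.
Variable e : R.

(** Supported in the interval from [- e] to [e]; the affine arguments have the form required by
    [smooth_affine]. *)
Definition bump (t : R) : R := flat 0 (1 * t + e) * flat 0 (-1 * t + e).

Definition dbump (i : nat) : R -> R := iter i (fun g t => 'D_1 g t) bump.

Lemma dbump_derive i t : is_derive t (1 : R) (dbump i) (dbump i.+1 t).
Proof.
have sb n : smooth n bump by apply: smoothM; apply: smooth_affine; exact: smooth_flat.
suff : smooth 1 (dbump i) by move=> /smooth_derive.
have iter_smooth k n g : smooth (n + k) g -> smooth n (iter k (fun g t => 'D_1 g t) g).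
  elim: k n => [|k IH] n; first by rewrite addn0.
  by rewrite addnS -addSn => /IH [].
exact: iter_smooth.
Qed.

Lemma dbump_continuous i : continuous (dbump i).
Proof.
move=> t; apply: differentiable_continuous; apply/derivable1_diffP.
by have [] := dbump_derive i t.
Qed.

Lemma dbump_out i t : e < `|t| -> dbump i t = 0.
Proof.
elim: i t => [|i IH] t et.
  rewrite /dbump /= /bump /flat; have [t0|t0] := leP 0 t.
    have -> : (0 < -1 * t + e) = false; last by rewrite mulr0.
    by apply/negbTE; rewrite -leNgt; move: et; rewrite ger0_norm//; lra.
  have -> : (0 < 1 * t + e) = false; last by rewrite mul0r.
  by apply/negbTE; rewrite -leNgt; move: et; rewrite ltr0_norm//; lra.
rewrite /dbump iterS -/(dbump i) (@near_eq_derive _ _ _ _ (cst 0)); first exact: derive_cst.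
near=> s; apply: IH; near: s.
apply: (@cvgr_gt _ _ (nbhs t) _ (fun s : R => `|s|) `|t|) => //.
exact: norm_continuous.
Unshelve. all: by end_near. Qed.

Lemma dbump_bounded i : exists2 K : R, 0 <= K & forall t, `|dbump i t| <= K.
Proof.
have [e0|e0] := ltP e 0.
  by exists 0 => // t; rewrite dbump_out ?normr0// (lt_le_trans e0).
have ee : - e <= e by lra.
have cn : {within `[- e, e], continuous (fun t => `|dbump i t|)}.
  apply: continuous_subspaceT => t.
  by apply: (@continuous_comp _ _ _ (dbump i) (fun x : R => `|x|)); [exact: dbump_continuous|exact: norm_continuous].
have [c _ cmax] := EVT_max ee cn; exists `|dbump i c| => // t.
have [te|te] := leP `|t| e; last by rewrite dbump_out// normr0.
by apply: cmax; rewrite in_itv /= -ler_norml.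
Qed.

Lemma bump_ge0 t : 0 <= dbump 0 t.
Proof. by rewrite mulr_ge0// flat_ge0. Qed.

Lemma bump_gt0 : 0 < e -> 0 < dbump 0 0.
Proof.
by move=> e0; rewrite /dbump /= /bump !mulr0 add0r /flat e0 !mulr_gt0// ?expR_gt0// expr0 ltr01.
Qed.

End bump.
Arguments dbump : simpl never.

End bump_function.
Arguments dbump : simpl never.

(** * Taylor polynomials *)

Section taylor_polynomials.
Variable R : realType.

Lemma pow_derive n (t : R) :
  is_derive t (1 : R) (fun s => s ^+ n.+1) (n.+1%:R * t ^+ n).
Proof.
elim: n => [|n IH].
  by rewrite expr0 mulr1; exact: is_derive_id.
have -> : (fun s : R => s ^+ n.+2) = id \* (fun s => s ^+ n.+1).
  by apply/funext => s; rewrite /= exprS.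
apply: is_derive_eq (is_deriveM (is_derive_id _ _) IH) _.
by rewrite /GRing.scale /= -(natr1 n.+1) exprS; ring.
Qed.

Lemma taylor_poly_derive n (c : nat -> R) (t : R) : is_derive t (1 : R)
  (fun s => \sum_(k < n.+1) c k * (s ^+ k / k`!%:R))
  (\sum_(k < n) c k.+1 * (t ^+ k / k`!%:R)).
Proof.
elim: n => [|n IH].
  rewrite big_ord0; under eq_fun do rewrite big_ord_recl big_ord0 expr0.
  exact: is_derive_cst.
under eq_fun do rewrite big_ord_recr /=; rewrite big_ord_recr /=.
apply: is_deriveD => //.
have -> : (fun s : R => c n.+1 * (s ^+ n.+1 / (n.+1)`!%:R)) =
    (fun=> c n.+1 / (n.+1)`!%:R) \* (fun s => s ^+ n.+1).
  by apply/funext => s; rewrite /= mulrAC mulrA.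
apply: is_derive_eq (is_deriveM (is_derive_cst _ _ _) (pow_derive n t)) _.
have f0 : n`!%:R != 0 :> R by rewrite pnatr_eq0 -lt0n fact_gt0.
have n0 : n.+1%:R != 0 :> R by rewrite pnatr_eq0.
rewrite factS natrM /GRing.scale /= mulr0 addr0.
move: (c n.+1) (n`!%:R) (n.+1%:R) (t ^+ n) f0 n0 => C F N X f0 n0.
by field; rewrite n0 f0.
Qed.

(** The derivative of the remainder is the remainder of the derivative, and the
    mean value theorem on a part of the unit interval does not increase the
    bound; this costs the factorial of the usual bound. *)
Lemma taylor n (g : nat -> R -> R) (K t : R) :
  (forall k t, (k < n)%N -> is_derive t (1 : R) (g k) (g k.+1 t)) ->
  (forall t, 0 <= t <= 1 -> `|g n t| <= K) -> 0 <= t <= 1 ->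
  `|g 0%N t - \sum_(k < n) g k 0 * (t ^+ k / k`!%:R)| <= K.
Proof.
elim: n g t => [|n IH] g t dg gK t01; first by rewrite big_ord0 subr0 gK.
pose r s := g 0%N s - \sum_(k < n.+1) g k 0 * (s ^+ k / k`!%:R).
pose r' s := g 1%N s - \sum_(k < n) g k.+1 0 * (s ^+ k / k`!%:R).
have rr (s : R) : is_derive s (1 : R) r (r' s).
  apply: is_deriveB; [exact: dg|exact: (taylor_poly_derive n (fun k => g k 0))].
have r0 : r 0 = 0.
  rewrite /r big_ord_recl expr0 fact0 divr1 mulr1 big1 ?addr0 ?subrr// => k _.
  by rewrite expr0n mul0r mulr0.
have /andP[t0 t1] := t01.
have cr : {within `[0, t], continuous r}.
  apply: continuous_subspaceT => s; apply: differentiable_continuous.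
  by apply/derivable1_diffP; have [] := rr s.
have [c] := MVT_segment t0 (fun s _ => rr s) cr.
rewrite in_itv /= => /andP[c0 ct]; rewrite r0 !subr0 -/(r t) => ->.
have cK : `|r' c| <= K.
  apply: (IH (fun k => g k.+1) c _ gK); last by rewrite c0 (le_trans ct).
  by move=> k s kn; exact: dg.
rewrite normrM (ger0_norm t0); apply: le_trans cK.
by rewrite ler_piMr.
Qed.

(** When [a i j] is the partial derivative of order [(i, j)] of a function, this
    is the [k]-th derivative of [a i j] in the direction [w].  The recursive form
    avoids binomial coefficients. *)
Fixpoint dir_deriv (a : nat -> nat -> R * R -> R) (w : R * R) (k i j : nat) (z : R * R) : R :=
  if k is m.+1 then
    w.1 * dir_deriv a w m i.+1 j z + w.2 * dir_deriv a w m i j.+1 z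
  else a i j z.

Implicit Types (a : nat -> nat -> R * R -> R) (w z : R * R).

Lemma dir_deriv_derive a w z :
  (forall i j (t : R), is_derive t (1 : R) (fun t => a i j (z + t *: w))
     (w.1 * a i.+1 j (z + t *: w) + w.2 * a i j.+1 (z + t *: w))) ->
  forall k i j (t : R), is_derive t (1 : R) (fun t => dir_deriv a w k i j (z + t *: w))
    (dir_deriv a w k.+1 i j (z + t *: w)).
Proof.
move=> da; elim=> [|k IH] i j t; first exact: da.
apply: is_derive_eq (is_deriveD (is_deriveM (is_derive_cst w.1 t 1) (IH i.+1 j t))
   (is_deriveM (is_derive_cst w.2 t 1) (IH i j.+1 t))) _.
by rewrite !scaler0 !addr0.
Qed.

Lemma dir_deriv_bound a w z n (M : R) : (forall i j, (i + j = n)%N -> `|a i j z| <= M) ->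
  forall k i j, (i + j + k = n)%N -> `|dir_deriv a w k i j z| <= (`|w.1| + `|w.2|) ^+ k * M.
Proof.
move=> aM; elim=> [|k IH] i j ijk; first by rewrite expr0 mul1r aM// -ijk addn0.
rewrite /= (le_trans (ler_normD _ _))// !normrM exprS -mulrA mulrDl.
by apply: lerD; apply: ler_wpM2l => //; apply: IH; lia.
Qed.

Lemma bipoly_le d d' (p : R * R -> R) : (d <= d')%N -> bipoly d p -> bipoly d' p.
Proof.
move=> dd pp; apply: bipoly_span pp => //.
- by move=> q r; exact: bipoly_ext.
- exact: bipoly0.
- by move=> q r; exact: bipolyD.
- by move=> k q; exact: bipolyZ.
- by move=> i j ij; apply: bipoly_mono; exact: leq_trans ij dd.
Qed.

Lemma dir_deriv_bipoly a f g z k i j : affine f -> affine g ->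
  bipoly k (fun x => dir_deriv a (f x, g x) k i j z).
Proof.
move=> af ag; elim: k i j => [|k IH] i j; first exact: bipoly_cst.
apply: bipoly_ext (bipolyD (bipolyM_affine (IH i.+1 j) af) (bipolyM_affine (IH i j.+1) ag)).
by move=> x; rewrite /= ![_ * f x]mulrC ![_ * g x]mulrC.
Qed.

(** Taylor's formula along the segment from [z] to [z + w]. *)
Lemma taylor_plane a w z n (M : R) :
  (forall i j (t : R), is_derive t (1 : R) (fun t => a i j (z + t *: w))
     (w.1 * a i.+1 j (z + t *: w) + w.2 * a i j.+1 (z + t *: w))) ->
  (forall i j t, (i + j = n)%N -> 0 <= t <= 1 -> `|a i j (z + t *: w)| <= M) ->
  `|a 0%N 0%N (z + w) - \sum_(k < n) (k`!%:R)^-1 * dir_deriv a w k 0 0 z|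
    <= (`|w.1| + `|w.2|) ^+ n * M.
Proof.
move=> da aM; have dd := dir_deriv_derive da.
have := @taylor n (fun k t => dir_deriv a w k 0 0 (z + t *: w)) ((`|w.1| + `|w.2|) ^+ n * M) 1.
rewrite /= scale1r scale0r addr0.
under eq_bigr do rewrite expr1n mul1r mulrC.
move=> H; apply: H.
- by move=> t t01; apply: (@dir_deriv_bound a w _ n M _ n 0 0 erefl) => i j ij; exact: aM.
- by rewrite ler01 lexx.
Qed.

End taylor_polynomials.

(** * Mollification *)

Section mollification.
Variable R : realType.
Variable v : 'I_3 -> R * R.
Hypothesis ndv : nondegenerate_triangle v.
Notation mR := (measurableTypeR R).
Notation m2 := (lebesgue2 R).
Notation T := (triangle v).
Variable e : R.
Implicit Types (z w y : R * R).

(** The partial derivative of order [(i, j)] in [z] of a bump around [z]. *)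
Definition kernel (i j : nat) z y : R := dbump e i (z.1 - y.1) * dbump e j (z.2 - y.2).

Lemma kernel_bounded i j : exists2 K : R, 0 <= K & forall z y, `|kernel i j z y| <= K.
Proof.
have [K K0 bK] := dbump_bounded e i; have [L L0 bL] := dbump_bounded e j.
by exists (K * L) => [|z y]; [exact: mulr_ge0|rewrite normrM ler_pM].
Qed.

Lemma kernel_ge0 z y : 0 <= kernel 0 0 z y.
Proof. by rewrite mulr_ge0// bump_ge0. Qed.

Lemma kernel_measurable i j z (D : set (mR * mR)) : measurable_fun D (kernel i j z : mR * mR -> R).
Proof.
have mb k (c : R) (g : mR * mR -> mR) : measurable_fun setT g ->
    measurable_fun setT (fun y => dbump e k (c - g y)).
  move=> mg; apply: (measurableT_comp (continuous_measurable_fun (@dbump_continuous R e k))).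
  exact: measurable_funB.
apply: measurable_funTS; apply: measurable_funM; apply: mb.
  exact: measurable_fst.
exact: measurable_snd.
Qed.

Lemma continuous_measurable (f : R * R -> R) : {within T, continuous f} ->
  measurable_fun (T : set (mR * mR)) f.
Proof.
move=> /continuousP cf; apply: (measurability _ (RGenOpens.measurableE R)).
move=> _ [_ [a [b ->] <-]].
have /open_subspaceP[V oV VT] : open ((f : subspace T -> R) @^-1` `]a, b[%classic).
  by apply: cf; exact: interval_open.
rewrite setIC -VT; apply: measurableI; first exact: open_measurable2.
exact: measurable_triangle.
Qed.

Lemma continuous_bounded (f : R * R -> R) : {within T, continuous f} ->
  exists2 M : R, 0 <= M & forall y, T y -> `|f y| <= M.
Proof.
move=> cf; have cT : compact T by exact: hull_compact.
have := compact_bounded (continuous_compact cf cT).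
move=> [M [_ fM]]; exists (`|M| + 1); first by rewrite addr_ge0.
move=> y Ty; apply: (fM (`|M| + 1)); last by exists y.
by rewrite (le_lt_trans (ler_norm M))// ltrDl.
Qed.

Lemma T_finite : (m2 T < +oo)%E.
Proof. by rewrite ltey_eq triangle_fin. Qed.

Lemma bounded_integrable (g : R * R -> R) (M : R) :
  measurable_fun (T : set (mR * mR)) g -> (forall y, T y -> `|g y| <= M) ->
  m2.-integrable T (EFin \o g).
Proof.
move=> mg gM; apply: measurable_bounded_integrable => //.
- exact: measurable_triangle.
- exact: T_finite.
exists M; split; first exact: num_real.
by move=> x Mx y Ty; exact: le_trans (gM y Ty) (ltW Mx).
Qed.

(** The derivative of order [(i, j)] of the convolution of [f], extended by
    zero, with the bump; it is not normalized. *)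
Definition moll (f : R * R -> R) (i j : nat) z : R :=
  \int[m2]_(y in T) (f y * kernel i j z y).

Section derivatives.
Variable f : R * R -> R.
Hypothesis cf : {within T, continuous f}.

Lemma moll_integrable i j z : m2.-integrable T (EFin \o (fun y => f y * kernel i j z y)).
Proof.
have [M M0 fM] := continuous_bounded cf; have [K K0 kK] := kernel_bounded i j.
apply: (@bounded_integrable _ (M * K)).
  by apply: measurable_funM; [exact: continuous_measurable|exact: kernel_measurable].
by move=> y Ty; rewrite normrM ler_pM// fM.
Qed.

Lemma kernel_derive i j z w y (t : R) : is_derive t (1 : R)
  (fun t => kernel i j (z + t *: w) y)
  (w.1 * kernel i.+1 j (z + t *: w) y + w.2 * kernel i j.+1 (z + t *: w) y).
Proof.
have db k (c d s : R) : is_derive s (1 : R) (fun s => dbump e k (c + s * d))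
    (d * dbump e k.+1 (c + s * d)).
  have da : is_derive s (1 : R) (fun s => c + s * d) d.
    by apply: is_derive_eq; rewrite /GRing.scale /=; ring.
  rewrite mulrC.
  exact: (@is_derive1_comp R (dbump e k) (fun s => c + s * d) s _ _ (dbump_derive e k _) da).
have E k (c d s y1 : R) : dbump e k (c + s * d - y1) = dbump e k (c - y1 + s * d).
  by rewrite addrAC.
rewrite /kernel !coordE !E.
under eq_fun do rewrite !coordE !E.
apply: is_derive_eq (is_deriveM (db i (z.1 - y.1) w.1 t) (db j (z.2 - y.2) w.2 t)) _.
by rewrite /GRing.scale /=; ring.
Qed.

(** Differentiation under the integral sign: the derivatives of the kernel are
    bounded and the triangle has finite area. *)
Lemma moll_derive i j z w (t : R) : is_derive t (1 : R)
  (fun t => moll f i j (z + t *: w))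
  (w.1 * moll f i.+1 j (z + t *: w) + w.2 * moll f i j.+1 (z + t *: w)).
Proof.
have [M M0 fM] := continuous_bounded cf.
have [K K0 kK] := kernel_bounded i.+1 j; have [L L0 kL] := kernel_bounded i j.+1.
pose F (s : R) y := f y * kernel i j (z + s *: w) y.
have dF y s : is_derive s (1 : R) (F ^~ y) (f y * (w.1 * kernel i.+1 j (z + s *: w) y
    + w.2 * kernel i j.+1 (z + s *: w) y)).
  apply: is_derive_eq (is_deriveM (is_derive_cst (f y) s 1) (kernel_derive i j z w y s)) _.
  by rewrite scaler0 addr0.
pose B : R := M * (`|w.1| * K + `|w.2| * L).
have B0 : 0 <= B by rewrite mulr_ge0// addr_ge0// mulr_ge0.
have It : `]t - 1, t + 1[%classic t by rewrite /= in_itv /=; apply/andP; split; lra.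
have mT := measurable_triangle ndv.
have intF s : m2.-integrable T (EFin \o F s) by exact: moll_integrable.
have partialE s y : partial1of2 F s y = f y * (w.1 * kernel i.+1 j (z + s *: w) y
    + w.2 * kernel i j.+1 (z + s *: w) y).
  by rewrite partial1of2E; have [_ ->] := dF y s.
have G_ub s y : `]t - 1, t + 1[%classic s -> T y -> `|partial1of2 F s y| <= cst B y.
  move=> _ Ty; rewrite partialE normrM ler_pM// ?fM//.
  apply: (le_trans (ler_normD _ _)); rewrite [`|w.1 * _|]normrM [`|w.2 * _|]normrM.
  by apply: lerD; apply: ler_wpM2l.
have intG : m2.-integrable T (EFin \o cst B).
  by apply: (@bounded_integrable _ B) => // y _; rewrite ger0_norm.
have dFs s y : `]t - 1, t + 1[%classic s -> T y -> derivable (F ^~ y) s 1.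
  by move=> _ _; have [] := dF y s.
have D1 := derivable_under_integral mT It (fun s _ => intF s) dFs (fun=> B0) intG G_ub.
have D2 := differentiation_under_integral mT It (fun s _ => intF s) dFs (fun=> B0) intG G_ub.
split; first exact: D1.
rewrite -derive1E [LHS]D2.
have iZ (c : R) i' j' : m2.-integrable T (EFin \o (fun y => c * (f y * kernel i' j' (z + t *: w) y))).
  by apply: (integrableZl mT c (moll_integrable _ _ _)).
transitivity (\int[m2]_(y in T) (w.1 * (f y * kernel i.+1 j (z + t *: w) y) +
    w.2 * (f y * kernel i j.+1 (z + t *: w) y))).
  by apply: eq_Rintegral => y _; rewrite partialE; ring.
rewrite RintegralD//.
by rewrite !RintegralZl//; exact: moll_integrable.
Qed.

End derivatives.

Definition box z : set (R * R) :=
  [set y | `|z.1 - y.1| <= e /\ `|z.2 - y.2| <= e].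

Lemma kernel_out i j z y : ~ box z y -> kernel i j z y = 0.
Proof.
move=> /not_andP[] /negP; rewrite -ltNge => ze; rewrite /kernel.
  by rewrite dbump_out ?mul0r.
by rewrite (dbump_out _ ze) mulr0.
Qed.

Lemma box_compact z : compact (box z).
Proof.
have -> : box z = `[z.1 - e, z.1 + e] `*` `[z.2 - e, z.2 + e].
  by apply/seteqP; split=> y; rewrite /box /= !in_itv /= !ler_norml => -[y1 y2]; split; lra.
by apply: compact_setX; exact: segment_compact.
Qed.

Lemma kernel_partial i j z x (d : R * R) :
  is_derive x d (kernel i j z) (- d.1 * kernel i.+1 j z x + - d.2 * kernel i j.+1 z x).
Proof.
apply: is_derive_line; have := kernel_derive i j z (- d) x 0.
rewrite scale0r addr0 !coordE; congr (is_derive _ _ _ _); apply/funext => s.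
by rewrite /kernel !coordE; congr (dbump _ _ _ * dbump _ _ _); rewrite /GRing.scale /=; ring.
Qed.

Lemma kernel_partial1 i j z x (c : R) :
  is_derive x (dir1 R) (fun y => c * kernel i j z y) (- c * kernel i.+1 j z x).
Proof.
apply: is_derive_eq (is_deriveM (is_derive_cst c x (dir1 R)) (kernel_partial i j z x (dir1 R))) _.
by rewrite scaler0 addr0 /dir1 /GRing.scale /=; ring.
Qed.

Lemma kernel_partial2 i j z x (c : R) :
  is_derive x (dir2 R) (fun y => c * kernel i j z y) (- c * kernel i j.+1 z x).
Proof.
apply: is_derive_eq (is_deriveM (is_derive_cst c x (dir2 R)) (kernel_partial i j z x (dir2 R))) _.
by rewrite scaler0 addr0 /dir2 /GRing.scale /=; ring.
Qed.

Lemma kernel_continuous i j z : continuous (kernel i j z).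
Proof.
have cb k (g : R * R -> R) : affine g -> continuous (fun y => dbump e k (g y)).
  move=> ag y; apply: (@continuous_comp _ _ _ g (dbump e k)); last exact: dbump_continuous.
  exact: affine_continuous.
apply: continuous_mul; apply: cb.
  by exists (-1), 0, z.1 => y; ring.
by exists 0, (-1), z.2 => y; ring.
Qed.

Lemma Ck_kernel n i j z (c : R) : Ck n (fun y => c * kernel i j z y).
Proof.
have cont k l (d : R) : continuous (fun y => d * kernel k l z y).
  by apply: continuous_mul; [exact: cst_continuous|exact: kernel_continuous].
elim: n i j c => [|n IH] i j c; first exact/Ck0.
exact: Ck_step (cont i j c) (fun x => kernel_partial1 i j z x c)
  (fun x => kernel_partial2 i j z x c) (IH _ _ _) (IH _ _ _).
Qed.

Lemma iter_partial_kernel i j z :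
  iter_partial i j (kernel 0 0 z) = fun y => (-1) ^+ (i + j) * kernel i j z y.
Proof.
have I2 k : iter k (fun h x => 'D_(dir2 R) h x) (kernel 0 0 z) =
    fun y => (-1) ^+ k * kernel 0 k z y.
  elim: k => [|k IH]; first by apply/funext => y; rewrite expr0 mul1r.
  rewrite iterS IH; apply/funext => x; have [_ ->] := kernel_partial2 0 k z x ((-1) ^+ k).
  by rewrite exprS mulN1r.
rewrite /iter_partial I2; elim: i => [|i IH]; first by [].
rewrite iterS IH; apply/funext => x; have [_ ->] := kernel_partial1 i j z x ((-1) ^+ (i + j)).
by rewrite addSn exprS mulN1r.
Qed.

Lemma kernel_test z : box z `<=` T° -> test_function T (kernel 0 0 z).
Proof.
move=> zT; split=> [n|].
  by have := @Ck_kernel n 0 0 z 1; under eq_fun do rewrite mul1r.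
by exists (box z); split=> // [|y]; [exact: box_compact|exact: kernel_out].
Qed.

(** The weak derivatives of [f] are mollified along with [f]. *)
Lemma moll_weak (f g : R * R -> R) i j z : {within T, continuous f} -> weak_derivative T i j f g ->
  box z `<=` T° -> moll f i j z = \int[m2]_(y in T) (g y * kernel 0 0 z y).
Proof.
move=> cf wd zT; have := wd _ (kernel_test zT); rewrite iter_partial_kernel.
under eq_Rintegral do rewrite mulrCA.
rewrite RintegralZl//; [|exact: measurable_triangle|exact: moll_integrable].
have s0 : (-1) ^+ (i + j) != 0 :> R by rewrite expf_neq0// oppr_eq0 oner_eq0.
by move=> /(mulfI s0).
Qed.

Definition mass z : R := \int[m2]_(y in T) kernel 0 0 z y.

Lemma kernel_integrable z : m2.-integrable T (EFin \o kernel 0 0 z).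
Proof.
have [K K0 kK] := kernel_bounded 0 0.
by apply: (@bounded_integrable _ K) => //; exact: kernel_measurable.
Qed.

Lemma kernel_translation z :
  (\int[m2]_y (kernel 0 0 z y)%:E = \int[m2]_y (kernel 0 0 0 y)%:E)%E.
Proof.
pose tr (y : mR * mR) : mR * mR := (1 * y.1 + 0 * y.2 + - z.1, 0 * y.1 + 1 * y.2 + - z.2).
have [mtr trE] : rescales tr 1.
  have := @rescales_affine R 1 0 (- z.1) 0 1 (- z.2).
  by rewrite mulr1 mulr0 subr0 normr1 invr1; apply; exact: oner_neq0.
pose F (y : mR * mR) : \bar R := (kernel 0 0 0 y)%:E.
have mF : measurable_fun setT F by apply/measurable_EFinP; exact: kernel_measurable.
have F0 : {in [set: mR * mR], forall y, (0 <= F y)%E}.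
  by move=> y _; rewrite lee_fin kernel_ge0.
have I12 := ge0_integral_pushforward mtr m2 measurableT mF F0.
have I3 : (\int[m2]_y (kernel 0 0 z y)%:E = \int[m2]_(x in tr @^-1` setT) (F \o tr) x)%E.
  rewrite preimage_setT; apply: eq_integral => y _; rewrite /F /= /kernel /tr /=.
  by congr ((dbump _ _ _ * dbump _ _ _)%:E); ring.
apply: (etrans I3); apply: (etrans (esym I12)).
apply: eq_measure_integral => A mA _; have := trE A mA; rewrite mul1e.
exact.
Qed.

(** As the kernel vanishes off the triangle, the integral extends to the plane,
    where it is translation invariant. *)
Lemma massE z : box z `<=` T -> (mass z)%:E = (\int[m2]_y (kernel 0 0 0 y)%:E)%E.
Proof.
move=> zT; rewrite -(kernel_translation z) /mass /Rintegral fineK; last first.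
  by apply: integrable_fin_num => //; [exact: measurable_triangle|exact: kernel_integrable].
rewrite [LHS]integral_mkcond; apply: eq_integral => y _.
rewrite /patch; case: ifPn => // /negP yT.
rewrite kernel_out// => zy; apply: yT; rewrite inE; exact: zT.
Qed.

Lemma mass_const z z' : box z `<=` T -> box z' `<=` T -> mass z = mass z'.
Proof. by move=> zT zT'; apply: EFin_inj; rewrite !massE. Qed.

Lemma moll_bound (g : R * R -> R) (M : R) z : measurable_fun (T : set (mR * mR)) g ->
  {ae m2, forall y, T y -> `|g y| <= M} -> 0 <= M ->
  `|\int[m2]_(y in T) (g y * kernel 0 0 z y)| <= M * mass z.
Proof.
move=> mg gM M0; have mT := measurable_triangle ndv.
have mk := @kernel_measurable 0 0 z T.
have iMk : m2.-integrable T (EFin \o (fun y => M * kernel 0 0 z y)).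
  exact: (integrableZl mT M (kernel_integrable z)).
have le_int : (\int[m2]_(y in T) `|(g y * kernel 0 0 z y)%:E| <=
    \int[m2]_(y in T) (M * kernel 0 0 z y)%:E)%E.
  apply: ae_ge0_le_integral => //.
  - apply: measurableT_comp => //; apply/measurable_EFinP; exact: measurable_funM.
  - by move=> y _; rewrite lee_fin mulr_ge0// kernel_ge0.
  - exact: measurable_int iMk.
  - move: gM => [N [mN N0 gN]]; exists N; split=> //.
    apply: subset_trans gN; apply: subsetC => y gMy Ty.
    rewrite abse_EFin lee_fin normrM.
    by rewrite (ger0_norm (kernel_ge0 z y)) ler_wpM2r ?kernel_ge0 ?gMy.
have int : m2.-integrable T (EFin \o (fun y => g y * kernel 0 0 z y)).
  apply/integrableP; split; first by apply/measurable_EFinP; exact: measurable_funM.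
  apply: le_lt_trans le_int _; rewrite ltey_eq.
  by rewrite (integrable_fin_num mT iMk).
rewrite -lee_fin EFin_normr_Rintegral//; apply: le_trans (le_abse_integral _ mT _) _.
  exact: measurable_int int.
apply: le_trans le_int _.
rewrite /mass -RintegralZl//; last exact: kernel_integrable.
by rewrite /Rintegral fineK// (integrable_fin_num mT iMk).
Qed.

(** The kernel exceeds half its maximum on a small triangle near its center. *)
Lemma mass_gt0 z : 0 < e -> T z -> 0 < mass z.
Proof.
move=> e0 Tz; have mT := measurable_triangle ndv.
pose m := kernel 0 0 z z.
have m0 : 0 < m by rewrite /m /kernel !subrr mulr_gt0// bump_gt0.
have m20 : 0 < m / 2 by rewrite divr_gt0.
have /cvgrPdist_lt/(_ _ m20)/nbhs_ballP[r /= r0 km] := @kernel_continuous 0 0 z z.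
have [w [ndw wT wr]] := small_triangle ndv Tz r0.
have mw := measurable_triangle ndw.
have mk := @kernel_measurable 0 0 z T.
rewrite -lte_fin /mass /Rintegral fineK; last first.
  exact: (integrable_fin_num mT (kernel_integrable z)).
apply: (@lt_le_trans _ _ ((m / 2)%:E * m2 (triangle w))%E).
  by rewrite mule_gt0// triangle_measure_gt0.
rewrite -(integral_cst m2 mw).
apply: (@le_trans _ _ (\int[m2]_(y in triangle w) (kernel 0 0 z y)%:E)%E).
  apply: ge0_le_integral => //.
  - by move=> y _; rewrite lee_fin ltW.
  - by apply/measurable_EFinP; exact: kernel_measurable.
  - move=> y /wr /km; rewrite lee_fin -/m => H.
    by have := ler_norm (m - kernel 0 0 z y); lra.
apply: ge0_subset_integral => //; first by apply/measurable_EFinP.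
by move=> y _; rewrite lee_fin kernel_ge0.
Qed.

Lemma moll_close f z (c eta : R) : {within T, continuous f} ->
  (forall y, T y -> box z y -> `|f y - c| <= eta) ->
  `|moll f 0 0 z - c * mass z| <= eta * mass z.
Proof.
move=> cf fc; have mT := measurable_triangle ndv.
have ik := kernel_integrable z.
have iZ (d : R) : m2.-integrable T (EFin \o (fun y => d * kernel 0 0 z y)).
  exact: (integrableZl mT d ik).
have iF := moll_integrable cf 0 0 z.
have iD : m2.-integrable T (EFin \o (fun y => f y * kernel 0 0 z y - c * kernel 0 0 z y)).
  exact: (integrableB mT iF (iZ c)).
rewrite /mass -!RintegralZl// -RintegralB//.
apply: le_trans (le_normr_Rintegral mT iD) _.
apply: le_Rintegral => //; first exact: integrable_norm.
move=> y Ty; rewrite -mulrBl normrM (ger0_norm (kernel_ge0 z y)).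
have [zy|zy] := pselect (box z y); last by rewrite kernel_out// !mulr0.
by rewrite ler_wpM2r ?kernel_ge0 ?fc.
Qed.

(** The Taylor polynomial of the mollified function at [z] approximates it as
    well as its weak derivatives of order [n] are bounded. *)
Lemma moll_taylor f (D : nat -> nat -> R * R -> R) n (M : R) z w :
  {within T, continuous f} ->
  (forall i j, (i + j = n)%N -> [/\ weak_derivative T i j f (D i j),
     measurable_fun (T : set (mR * mR)) (D i j) &
     {ae m2, forall y, T y -> `|D i j y| <= M}]) -> 0 <= M ->
  (forall t, 0 <= t <= 1 -> box (z + t *: w) `<=` T°) ->
  `|moll f 0 0 (z + w) - \sum_(k < n) (k`!%:R)^-1 * dir_deriv (moll f) w k 0 0 z|
    <= (`|w.1| + `|w.2|) ^+ n * (M * mass z).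
Proof.
move=> cf fD M0 zw; apply: taylor_plane => [i j t|i j t ij t01]; first exact: moll_derive.
have [wd mD bD] := fD i j ij.
have bT := zw t t01; rewrite (moll_weak cf wd bT).
have -> : mass z = mass (z + t *: w).
  apply: mass_const; last exact: subset_trans bT (@interior_subset _ _).
  have := zw 0; rewrite scale0r addr0 lexx ler01 => /(_ isT) zT.
  exact: subset_trans zT (@interior_subset _ _).
exact: moll_bound.
Qed.

End mollification.

(** * The order of approximation *)

Section approximation.
Variable R : realType.
Variable v : 'I_3 -> R * R.
Hypothesis ndv : nondegenerate_triangle v.
Notation mR := (measurableTypeR R).
Notation m2 := (lebesgue2 R).
Notation T := (triangle v).
Variable B : basis_name.

Local Opaque pieces basis_knots cell_tables truncated piece zbasis dual_mono basis_data.

(** The error functional vanishes on [p], so it may be applied to [g - p]. *)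
Lemma quasi_interpolant_error p (g : R * R -> R) (K : R) x : bipoly 5 p ->
  (forall y, T y -> `|g y - p y| <= K) -> T x ->
  `|g x - quasi_interpolant v B g x| <= (1 + 275 / 3) * K.
Proof.
move=> pp gp Tx; pose d y := g y + -1 * p y.
have dK y : T y -> `|d y| <= K by move=> Ty; rewrite /d mulN1r gp.
have K0 : 0 <= K by exact: le_trans (normr_ge0 _) (gp x Tx).
have -> : g x - quasi_interpolant v B g x = d x - quasi_interpolant v B d x.
  rewrite /d quasi_interpolantD quasi_interpolantZ (reproduction ndv B pp Tx).
  by ring.
rewrite (le_trans (ler_normB _ _))// mulrDl mul1r lerD ?dK//.
apply: le_trans (quasi_interpolant_bound ndv B d Tx) _.
exact: max_functional_bound.
Qed.

(** Only finitely many point values enter. *)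
Lemma quasi_interpolant_cvg (F : set_system R) (FF : Filter F) (g : R -> R * R -> R)
    (f : R * R -> R) x :
  (forall y, T y -> g s y @[s --> F] --> f y) ->
  quasi_interpolant v B (g s) x @[s --> F] --> quasi_interpolant v B f x.
Proof.
move=> gf; have dc e : dual_labels e.2.2 ->
    dual_functional v e (g s) @[s --> F] --> dual_functional v e f.
  move=> eP; under eq_fun do rewrite dual_functionalE; rewrite dual_functionalE.
  apply: cvg_big => [|A A0]; first exact: add_continuous.
  apply: cvgM; first exact: cvg_cst.
  by apply: gf; apply: (@eval_point_triangle R v ndv e).
rewrite /quasi_interpolant; under eq_fun do rewrite big_seq; rewrite big_seq.
apply: cvg_big => [|e eB]; first exact: add_continuous.
apply: cvgM; last exact: cvg_cst.
by apply: dc; have /and3P[] := allP (basis_data_ok R B) e eB.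
Qed.

Lemma bary_positive_interior q : 0 < bary1 v q -> 0 < bary2 v q -> 0 < bary3 v q -> T° q.
Proof.
move=> q1 q2 q3.
have pos f : affine f -> 0 < f q -> \forall y \near q, 0 < f y.
  by move=> af fq; exact: (@cvgr_gt _ _ (nbhs q) _ f (f q) (@affine_continuous R f af q) 0 fq).
have n1 := pos _ (affine_bary1 v) q1; have n2 := pos _ (affine_bary2 v) q2.
have n3 := pos _ (affine_bary3 v) q3.
near=> y; apply/(triangleP _ ndv); split; apply: ltW; near: y.
- exact: n1.
- exact: n2.
- exact: n3.
Unshelve. all: by end_near. Qed.

Lemma affine_segment (f : R * R -> R) (s t : R) p q : affine f -> s + t = 1 ->
  f (s *: p + t *: q) = s * f p + t * f q.
Proof.
move=> [a [b [c fE]]] st; rewrite !fE !coordE.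
have -> : s = 1 - t by rewrite -st addrK.
by ring.
Qed.

Lemma triangle_segment p q (s t : R) : T p -> T q -> 0 <= s -> 0 <= t -> s + t = 1 ->
  T (s *: p + t *: q).
Proof.
move=> /(triangleP _ ndv)[p1 p2 p3] /(triangleP _ ndv)[q1 q2 q3] s0 t0 st.
have seg f : affine f -> 0 <= f p -> 0 <= f q -> 0 <= f (s *: p + t *: q).
  move=> af fp fq; rewrite (affine_segment _ _ af st).
  exact: addr_ge0 (mulr_ge0 s0 fp) (mulr_ge0 t0 fq).
apply/(triangleP _ ndv); split.
- exact: seg (affine_bary1 v) p1 q1.
- exact: seg (affine_bary2 v) p2 q2.
- exact: seg (affine_bary3 v) p3 q3.
Qed.

Lemma generic_point_interior :
  [/\ 0 < bary1 v (generic_point v), 0 < bary2 v (generic_point v)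
    & 0 < bary3 v (generic_point v)].
Proof.
have [[p0 p1 p2] [q0 q1 q2]] := bary_corners ndv.
have s1 : 1 / 9 + 3 / 9 + 5 / 9 = 1 :> R by field.
rewrite /generic_point !affine3//; [|exact: affine_bary3|exact: affine_bary2|exact: affine_bary1].
by rewrite /bary1 p0 p1 p2 q0 q1 q2; split; lra.
Qed.

(** Moving the points of the triangle towards the interior point leaves room
    for a box, of a size proportional to the displacement. *)
Lemma toward_box : exists2 kappa : R, 0 < kappa & forall y d, T y -> 0 < d -> d <= 1 ->
  box (kappa * d) (toward v y d) `<=` T°.
Proof.
have [g1 g2 g3] := generic_point_interior; set g := generic_point v in g1 g2 g3 *.
have pos f : affine f -> 0 < f g -> \forall y \near g, 0 < f y.
  by move=> af fg; exact: (@cvgr_gt _ _ (nbhs g) _ f (f g) (@affine_continuous R f af g) 0 fg).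
have : \forall y \near g, [/\ 0 < bary1 v y, 0 < bary2 v y & 0 < bary3 v y].
  have n1 := pos _ (affine_bary1 v) g1; have n2 := pos _ (affine_bary2 v) g2.
  have n3 := pos _ (affine_bary3 v) g3.
  by near=> y; split; near: y; [exact: n1|exact: n2|exact: n3].
move=> /nbhs_ballP[r /= r0 rg].
exists (r / 2) => [|y d Ty d0 d1 q [q1 q2]]; first by rewrite divr_gt0.
pose u := d^-1 *: (q - (1 - d) *: y).
have dn0 : d != 0 by rewrite gt_eqF.
have qE : q = (1 - d) *: y + d *: u.
  by rewrite /u scalerA mulfV// scale1r addrC subrK.
have gu : ball g r u.
  have dlt (a b c : R) : `|(1 - d) * a + d * b - ((1 - d) * a + d * c)| <= r / 2 * d ->
      `|b - c| < r.
    have -> : (1 - d) * a + d * b - ((1 - d) * a + d * c) = d * (b - c) by ring.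
    rewrite normrM (gtr0_norm d0) mulrC ler_pM2r// => h.
    by apply: le_lt_trans h _; lra.
  move: q1 q2; rewrite {1 2}qE /toward !coordE => /dlt u1 /dlt u2.
  by split.
have [u1 u2 u3] := rg u gu.
move/(triangleP _ ndv) : Ty => [y1 y2 y3].
have dd : 1 - d + d = 1 by rewrite subrK.
have d1' : 0 <= 1 - d by rewrite subr_ge0.
have seg f : affine f -> 0 <= f y -> 0 < f u -> 0 < f q.
  move=> af fy fu; rewrite qE (affine_segment _ _ af dd).
  exact: ltr_wpDl (mulr_ge0 d1' fy) (mulr_gt0 d0 fu).
apply: bary_positive_interior.
- exact: seg (affine_bary1 v) y1 u1.
- exact: seg (affine_bary2 v) y2 u2.
- exact: seg (affine_bary3 v) y3 u3.
Unshelve. all: by end_near. Qed.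

Lemma longest_edge_coord y : T y ->
  `|y.1 - (v 0).1| <= longest_edge v /\ `|y.2 - (v 0).2| <= longest_edge v.
Proof.
have ed1 (p q : R * R) : `|q.1 - p.1| <= Defs.edist p q.
  by rewrite distrC -sqrtr_sqr /Defs.edist ler_wsqrtr// lerDl sqr_ge0.
have ed2 (p q : R * R) : `|q.2 - p.2| <= Defs.edist p q.
  by rewrite distrC -sqrtr_sqr /Defs.edist ler_wsqrtr// lerDr sqr_ge0.
move=> /hull3P[a [b [c [a0 b0 c0 abc ->]]]].
have h1 : Defs.edist (v 0) (v 1) <= longest_edge v by rewrite /longest_edge le_max lexx.
have h2 : Defs.edist (v 0) (v 2) <= longest_edge v by rewrite /longest_edge !le_max lexx !orbT.
have h0 : 0 <= longest_edge v by apply: le_trans h1; exact: sqrtr_ge0.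
have co (p0 p1 p2 : R) : `|p1 - p0| <= longest_edge v -> `|p2 - p0| <= longest_edge v ->
    `|a * p0 + b * p1 + c * p2 - p0| <= longest_edge v.
  move=> l1 l2; have -> : a * p0 + b * p1 + c * p2 - p0 = b * (p1 - p0) + c * (p2 - p0).
    by rewrite -[X in _ - X]mul1r -abc; ring.
  apply: le_trans (ler_normD _ _) _; rewrite !normrM (ger0_norm b0) (ger0_norm c0).
  have := ler_wpM2l b0 l1; have := ler_wpM2l c0 l2.
  move: `|p1 - p0| `|p2 - p0| l1 l2 => P1 P2 l1 l2 H1 H2; nra.
rewrite !coordE; split; apply: co.
- exact: le_trans (ed1 _ _) h1.
- exact: le_trans (ed1 _ _) h2.
- exact: le_trans (ed2 _ _) h1.
- exact: le_trans (ed2 _ _) h2.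
Qed.

Section smoothing.
Variable kappa : R.
Hypothesis kappa0 : 0 < kappa.
Hypothesis kappa_box : forall y d, T y -> 0 < d -> d <= 1 ->
  box (kappa * d) (toward v y d) `<=` T°.
Variable f : R * R -> R.
Hypothesis cf : {within T, continuous f}.

(** The division by the mass normalizes the kernel; by [mass_toward] the mass
    may be taken at any point of the contracted triangle. *)
Definition smoothed (d : R) y : R :=
  moll v (kappa * d) f 0 0 (toward v y d) / mass v (kappa * d) (toward v (v 0) d).

Lemma T_corner : T (v 0).
Proof. by apply: mem_hull; rewrite inE eqxx. Qed.

Lemma mass_toward y d : T y -> 0 < d -> d <= 1 ->
  mass v (kappa * d) (toward v y d) = mass v (kappa * d) (toward v (v 0) d) /\
  0 < mass v (kappa * d) (toward v (v 0) d).
Proof.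
move=> Ty d0 d1; have sub y' : T y' -> box (kappa * d) (toward v y' d) `<=` T.
  by move=> Ty'; apply: subset_trans (kappa_box Ty' d0 d1) (@interior_subset _ _).
split; first by apply: (mass_const ndv); apply: sub => //; exact: T_corner.
apply: (mass_gt0 ndv); first exact: mulr_gt0.
apply: (sub _ T_corner); rewrite /box /= !subrr normr0.
by split; rewrite ltW// mulr_gt0.
Qed.

Lemma smoothed_cvg y : T y -> smoothed d y @[d --> 0^'+] --> f y.
Proof.
move=> Ty; apply/cvgrPdist_le => eta eta0.
have /subspace_continuousP/(_ y Ty)/cvgrPdist_lt/(_ _ eta0) := cf.
rewrite near_withinE => /nbhs_ballP[r /= r0 fr].
set g := generic_point v.
have k0 : 0 < kappa + `|g - y| by rewrite ltr_wpDr.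
near=> d.
have d0 : 0 < d by near: d; exact: nbhs_right_gt.
have d1 : d <= 1 by near: d; exact: nbhs_right_le.
have dr : d < r / (kappa + `|g - y|) by near: d; apply: nbhs_right_lt; rewrite divr_gt0.
have [my m0] := mass_toward Ty d0 d1.
have close y' : T y' -> box (kappa * d) (toward v y d) y' -> `|f y' - f y| <= eta.
  move=> Ty' [b1 b2]; rewrite distrC; apply: ltW.
  have : ball y r y'.
    rewrite -ball_normE /ball_ /=.
    have -> : y - y' = d *: (y - g) + (toward v y d - y').
      by apply: pair_eq; rewrite /toward !coordE -/g; ring.
    apply: le_lt_trans (ler_normD _ _) _; rewrite normrZ (gtr0_norm d0).
    have : `|toward v y d - y'| <= kappa * d by rewrite prod_normE ge_max b1 b2.
    move: dr; rewrite ltr_pdivlMr// distrC; move: `|toward v y d - y'| `|g - y| => A G.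
    by nra.
  by move=> /fr /(_ Ty').
have := moll_close ndv cf close; rewrite my.
rewrite /smoothed; set m := mass _ _ _ in m0 *; set I := moll _ _ _ _ _ _ => Im.
have -> : f y - I / m = - (I - f y * m) / m by field; rewrite gt_eqF.
by rewrite mulNr normrN normrM normfV (gtr0_norm m0) ler_pdivrMr.
Unshelve. all: by end_near. Qed.

Variables (D : nat -> nat -> R * R -> R) (M : R).
Hypothesis M0 : 0 <= M.
Hypothesis fD : forall i j, (i + j = 6)%N -> [/\ weak_derivative T i j f (D i j),
  measurable_fun (T : set (mR * mR)) (D i j) &
  {ae m2, forall y, T y -> `|D i j y| <= M}].

(** The Taylor polynomial at the image of the corner [v 0], pulled back to the
    original triangle; 64 is [(1 + 1) ^ 6], since both coordinates of the
    direction are bounded by [h]. *)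
Lemma smoothed_taylor d : 0 < d -> d <= 1 -> exists2 p, bipoly 5 p &
  forall y, T y -> `|smoothed d y - p y| <= 64 * longest_edge v ^+ 6 * M.
Proof.
move=> d0 d1; pose z := toward v (v 0) d; pose e := kappa * d.
pose w y : R * R := ((1 - d) * (y.1 - (v 0).1), (1 - d) * (y.2 - (v 0).2)).
have [_ m0] := mass_toward T_corner d0 d1; rewrite -/e -/z in m0.
pose p y := (mass v e z)^-1 *
  \sum_(k < 6) (k`!%:R)^-1 * dir_deriv (moll v e f) (w y) k 0 0 z.
exists p.
  apply: bipolyZ; apply: bipoly_sum => k; apply: bipolyZ.
  apply: (@bipoly_le R k); first by rewrite -ltnS.
  apply: dir_deriv_bipoly.
  - by exists (1 - d), 0, (- (1 - d) * (v 0).1) => x; ring.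
  - by exists 0, (1 - d), (- (1 - d) * (v 0).2) => x; ring.
move=> y Ty; have zw t : 0 <= t <= 1 -> box e (z + t *: w y) `<=` T°.
  move=> /andP[t0 t1].
  have -> : z + t *: w y = toward v ((1 - t) *: v 0 + t *: y) d.
    by apply: pair_eq; rewrite /z /w /toward !coordE /=; ring.
  apply: kappa_box => //; apply: triangle_segment => //.
  - exact: T_corner.
  - by rewrite subr_ge0.
  - by rewrite subrK.
have := moll_taylor ndv cf fD M0 zw.
have -> : z + w y = toward v y d.
  by apply: pair_eq; rewrite /z /w /toward !coordE /=; ring.
rewrite /smoothed /p -/e -/z; set I := moll _ _ _ _ _ _; set S := \sum_(k < 6) _.
move=> IS; rewrite mulrC -mulrBr normrM normfV (gtr0_norm m0) mulrC ler_pdivrMr//.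
apply: le_trans IS _; rewrite [M * _]mulrC mulrA mulrAC (ler_wpM2r (ltW m0))//.
rewrite ler_wpM2r//; have [y1 y2] := longest_edge_coord Ty.
have dle (a : R) : `|(1 - d) * a| <= `|a|.
  by rewrite normrM ler_piMl// ger0_norm ?subr_ge0// lerBlDr lerDl ltW.
have -> : 64 * longest_edge v ^+ 6 = (longest_edge v + longest_edge v) ^+ 6 by ring.
rewrite lerXn2r ?nnegrE ?addr_ge0//; last first.
  by apply: lerD; apply: le_trans (dle _) _.
all: exact: le_trans (normr_ge0 _) y1.
Qed.

End smoothing.

(** The point evaluation of the error is a combination of point values, so the
    bound for the smoothed functions passes to the limit. *)
Lemma quasi_interpolant_order f (D : nat -> nat -> R * R -> R) (M : R) x :
  {within T, continuous f} -> 0 <= M ->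
  (forall i j, (i + j = 6)%N -> [/\ weak_derivative T i j f (D i j),
     measurable_fun (T : set (mR * mR)) (D i j) &
     {ae m2, forall y, T y -> `|D i j y| <= M}]) -> T x ->
  `|f x - quasi_interpolant v B f x| <=
    (1 + 275 / 3) * (64 * longest_edge v ^+ 6 * M).
Proof.
move=> cf M0 fD Tx; have [kappa kappa0 kbox] := toward_box.
have sf := smoothed_cvg kappa0 kbox cf.
have : `|smoothed kappa f d x - quasi_interpolant v B (smoothed kappa f d) x| @[d --> 0^'+]
    --> `|f x - quasi_interpolant v B f x|.
  apply: cvg_norm; apply: cvgB; first exact: sf.
  exact: quasi_interpolant_cvg.
move=> /cvgr_to_le; apply; near=> d.
have d0 : 0 < d by near: d; exact: nbhs_right_gt.
have d1 : d <= 1 by near: d; exact: nbhs_right_le.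
have [p pp pS] := smoothed_taylor kappa0 kbox cf M0 fD d0 d1.
exact: quasi_interpolant_error pp pS Tx.
Unshelve. all: by end_near. Qed.

Lemma Linf_quasi_interpolant_order f (Df : nat -> nat -> R * R -> R) :
  {within T, continuous f} ->
  (forall i j, (i + j <= 6)%N ->
     weak_derivative T i j f (Df i j) /\ in_Linf T (Df i j)) ->
  (Linf T (fun x => f x - quasi_interpolant v B f x)%R
     <= ((1 + 275 / 3) * 64)%:E * (longest_edge v ^+ 6)%:E *
        \big[maxe/0%E]_(i < 7) Linf T (Df i (6 - i)%N))%E.
Proof.
move=> cf fD; set L := (\big[maxe/0%E]_(i < 7) _)%E.
have Lfin : (L < +oo)%E.
  rewrite /L; elim/big_ind: _ => // [a b a0 b0|i _]; first by rewrite gt_max a0.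
  by have [|_ []] := fD i (6 - i)%N; first by rewrite subnKC// -ltnS.
have L0 : (0 <= L)%E.
  by rewrite /L; elim/big_ind: _ => // [a b a0 b0|i _]; [rewrite le_max a0|exact: Linf_ge0].
have /fineK LE : L \is a fin_num by rewrite ge0_fin_numE.
set M := fine L in LE.
have M0 : 0 <= M by rewrite -lee_fin LE.
have h0 : 0 <= longest_edge v.
  by have [h _] := longest_edge_coord T_corner; exact: le_trans (normr_ge0 _) h.
rewrite -LE -!EFinM; apply: Linf_le => // [|x Tx].
  by rewrite !mulr_ge0 ?addr_ge0 ?divr_ge0 ?ler0n ?exprn_ge0.
rewrite -[leRHS](mulrA _ _ M) -[leRHS]mulrA [64 * _]mulrA; apply: (@quasi_interpolant_order f Df) => //.
move=> i j ij; have [wd [mD _]] := fD i j (eq_leq ij); split=> //.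
have i7 : (i < 7)%N by rewrite ltnS -ij leq_addr.
have jE : j = (6 - i)%N by rewrite -ij addKn.
have := Linf_ae ndv (Df i j); move=> [N [mN N0 DN]]; exists N; split=> //.
apply: subset_trans DN; apply: subsetC => y H Ty; rewrite -lee_fin LE.
apply: le_trans (H Ty) _; rewrite jE.
exact: (@le_bigmax _ _ _ _ (fun i : 'I_7 => Linf T (Df i (6 - i)%N)) (Ordinal i7)).
Qed.

End approximation.

Unset Implicit Arguments.

Theorem mainTheorem6 (R : realType) (B : basis_name) :
  (forall v : 'I_3 -> R * R, nondegenerate_triangle v ->
    [/\ forall f : R * R -> R, {within triangle v, continuous f} ->
          spline_space v (quasi_interpolant v B f),
        forall p : R * R -> R, bipoly 5 p ->
          forall x, triangle v x -> quasi_interpolant v B p x = p x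
      & forall f : R * R -> R, {within triangle v, continuous f} ->
          (Linf (triangle v) (quasi_interpolant v B f)
             <= (max_functional v B f)%:E)%E /\
          ((max_functional v B f)%:E
             <= (275 / 3)%:E * Linf (triangle v) f)%E])
  /\
  exists C : R, forall v : 'I_3 -> R * R, nondegenerate_triangle v ->
    forall (f : R * R -> R) (Df : nat -> nat -> R * R -> R),
      {within triangle v, continuous f} ->
      (forall i j, (i + j <= 6)%N ->
         weak_derivative (triangle v) i j f (Df i j) /\
         in_Linf (triangle v) (Df i j)) ->
      (Linf (triangle v) (fun x => f x - quasi_interpolant v B f x)%R
         <= C%:E * (longest_edge v ^+ 6)%:E *
            \big[maxe/0%E]_(i < 7) Linf (triangle v) (Df i (6 - i)%N))%E.
Proof.
split=> [v ndv|].
  split=> [f _|p pp x Tx|f cf].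
  - exact: quasi_interpolant_spline.
  - exact: reproduction.
  - by split; [exact: quasi_interpolant_Linf|exact: max_functional_Linf].
exists ((1 + 275 / 3) * 64) => v ndv f Df cf fD.
exact: Linf_quasi_interpolant_order.
Qed.
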